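(* Let $\Omega\subset\mathbb R^2$ be a bounded smooth domain, $P\in\Omega$, $\Omega_\varepsilon=\Omega\setminus\overline{B(P,\varepsilon)}$. (a) If $\varepsilon_n\to0$ and $(x_n,y_n)$ are critical points of $\mathcal{KR}_{\Omega_{\varepsilon_n}}$ converging to $(x_0,y_0)\in(\Omega\setminus\{P\})\times(\Omega\setminus\{P\})$, then $x_0\neq y_0$ and $(x_0,y_0)$ is a critical point of $\mathcal{KR}_\Omega$. (b) Conversely, if $(x_0,y_0)$ (with $x_0,y_0\in\Omega\setminus\{P\}$, $x_0\ne y_0$) is a nondegenerate critical point of $\mathcal{KR}_\Omega$, then there exist $d>0$ and $\varepsilon_0>0$ such that for every $\varepsilon\in(0,\varepsilon_0)$, $\mathcal{KR}_{\Omega_\varepsilon}$ has exactly one critical point $(x_\varepsilon,y_\varepsilon)$ in $B(x_0,d)\times B(y_0,d)$; this critical point is nondegenerate and $(x_\varepsilon,y_\varepsilon)\to(x_0,y_0)$ as $\varepsilon\to0$.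
   Context: For a bounded smooth domain $D\subset\mathbb R^2$, $G_D(x,y)=S(x,y)-H_D(x,y)$ is the Dirichlet Green function of $-\Delta$ in $D$, with $S(x,y)=-\frac1{2\pi}\ln|x-y|$ and $H_D$ harmonic in each variable; $\mathcal R_D(x)=H_D(x,x)$. Fix $\Lambda_1,\Lambda_2>0$ and set $\mathcal{KR}_D(x,y)=\Lambda_1^2\mathcal R_D(x)+\Lambda_2^2\mathcal R_D(y)-2\Lambda_1\Lambda_2G_D(x,y)$, $x\ne y$. A critical point is nondegenerate if the $4\times4$ Hessian of the function there is invertible. *)

(* Defs.v *)
From Stdlib Require Import Reals.
From Coquelicot Require Import Coquelicot.
From mathcomp Require Import all_boot all_algebra.
From mathcomp Require Import Rstruct.

Open Scope R_scope.

Definition pt := (R * R)%type.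

Definition dist2 (p q : pt) : R :=
  sqrt ((fst p - fst q) ^ 2 + (snd p - snd q) ^ 2).

Definition open2 (D : pt -> Prop) : Prop :=
  forall p, D p -> exists r, 0 < r /\ forall q, dist2 p q < r -> D q.

Definition bounded2 (D : pt -> Prop) : Prop :=
  exists M, forall p, D p -> dist2 (0, 0) p < M.

Definition open_set2 (U : pt -> Prop) : Prop := open2 U.

Definition connected2 (D : pt -> Prop) : Prop :=
  forall U V : pt -> Prop, open_set2 U -> open_set2 V ->
    (forall p, D p -> U p \/ V p) ->
    (forall p, D p -> U p -> V p -> False) ->
    (exists p, D p /\ U p) -> (exists p, D p /\ V p) -> False.

Definition bdry (D : pt -> Prop) (p : pt) : Prop :=
  (forall r, 0 < r -> exists q, D q /\ dist2 p q < r) /\ ~ D p.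

Definition smooth1 (g : R -> R) : Prop := forall n x, ex_derive_n g n x.

(** Smooth boundary: near each boundary point, after a rigid motion, the
    domain is the region strictly above the graph of a C^infinity function. *)
Definition smooth_boundary (D : pt -> Prop) : Prop :=
  forall p, bdry D p ->
    exists r theta (g : R -> R), 0 < r /\ smooth1 g /\
      forall q, dist2 p q < r ->
        (D q <->
           (- sin theta * (fst q - fst p) + cos theta * (snd q - snd p)
              > g (cos theta * (fst q - fst p) + sin theta * (snd q - snd p)))).

Definition smooth_domain (D : pt -> Prop) : Prop :=
  open2 D /\ bounded2 D /\ connected2 D /\ (exists p, D p) /\ smooth_boundary D.

Definition d1 (h : pt -> R) (p : pt) : R := Derive (fun t => h (t, snd p)) (fst p).
Definition d2 (h : pt -> R) (p : pt) : R := Derive (fun t => h (fst p, t)) (snd p).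

Definition C2_on (D : pt -> Prop) (h : pt -> R) : Prop :=
  forall p, D p ->
    ex_derive (fun t => h (t, snd p)) (fst p) /\
    ex_derive (fun t => h (fst p, t)) (snd p) /\
    ex_derive (fun t => d1 h (t, snd p)) (fst p) /\
    ex_derive (fun t => d1 h (fst p, t)) (snd p) /\
    ex_derive (fun t => d2 h (t, snd p)) (fst p) /\
    ex_derive (fun t => d2 h (fst p, t)) (snd p) /\
    continuous h p /\ continuous (d1 h) p /\ continuous (d2 h) p /\
    continuous (d1 (d1 h)) p /\ continuous (d2 (d1 h)) p /\
    continuous (d1 (d2 h)) p /\ continuous (d2 (d2 h)) p.

Definition harmonic_on (D : pt -> Prop) (h : pt -> R) : Prop :=
  C2_on D h /\ forall p, D p -> d1 (d1 h) p + d2 (d2 h) p = 0.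

Definition S (x y : pt) : R := - (1 / (2 * PI)) * ln (dist2 x y).

(** H is the regular part of the Dirichlet Green function of -Laplacian in D:
    for each x in D, H(x,.) is harmonic in D, continuous up to the boundary,
    with boundary values S(x,.).  (This determines H uniquely on D x D by the
    maximum principle; G_D = S - H.) *)
Definition green_regular_part (D : pt -> Prop) (H : pt -> pt -> R) : Prop :=
  forall x, D x ->
    harmonic_on D (H x) /\
    forall y0, bdry D y0 ->
      forall eps, 0 < eps -> exists delta, 0 < delta /\
        forall y, D y -> dist2 y y0 < delta -> Rabs (H x y - S x y0) < eps.

Definition green (H : pt -> pt -> R) (x y : pt) : R := S x y - H x y.
Definition robin (H : pt -> pt -> R) (x : pt) : R := H x x.

Definition KR (H : pt -> pt -> R) (L1 L2 : R) (x y : pt) : R :=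
  L1 ^ 2 * robin H x + L2 ^ 2 * robin H y - 2 * L1 * L2 * green H x y.

Definition coord4 (z : pt * pt) (i : nat) : R :=
  match i with
  | 0%nat => fst (fst z) | 1%nat => snd (fst z)
  | 2%nat => fst (snd z) | _ => snd (snd z) end.

Definition upd4 (z : pt * pt) (i : nat) (t : R) : pt * pt :=
  match i with
  | 0%nat => ((t, snd (fst z)), snd z) | 1%nat => ((fst (fst z), t), snd z)
  | 2%nat => (fst z, (t, snd (snd z))) | _ => (fst z, (fst (snd z), t)) end.

Definition part4 (F : pt * pt -> R) (i : nat) (z : pt * pt) : R :=
  Derive (fun t => F (upd4 z i t)) (coord4 z i).

Definition critical4 (U : pt * pt -> Prop) (F : pt * pt -> R) (z : pt * pt) : Prop :=
  U z /\ forall i : nat, (i < 4)%nat -> is_derive (fun t => F (upd4 z i t)) (coord4 z i) 0.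

Definition hessian4 (F : pt * pt -> R) (z : pt * pt) : 'M[R]_4 :=
  \matrix_(i < 4, j < 4) part4 (part4 F (nat_of_ord j)) (nat_of_ord i) z.

Definition nondegenerate_critical4 (U : pt * pt -> Prop) (F : pt * pt -> R)
  (z : pt * pt) : Prop :=
  critical4 U F z /\ (\det (hessian4 F z) != 0)%R.

Definition KRdom (D : pt -> Prop) (z : pt * pt) : Prop :=
  D (fst z) /\ D (snd z) /\ fst z <> snd z.

Definition KRcrit (D : pt -> Prop) (H : pt -> pt -> R) (L1 L2 : R) (z : pt * pt) :=
  critical4 (KRdom D) (fun w => KR H L1 L2 (fst w) (snd w)) z.

Definition KRnondeg (D : pt -> Prop) (H : pt -> pt -> R) (L1 L2 : R) (z : pt * pt) :=
  nondegenerate_critical4 (KRdom D) (fun w => KR H L1 L2 (fst w) (snd w)) z.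

Definition punctured (Om : pt -> Prop) (P : pt) (eps : R) (q : pt) : Prop :=
  Om q /\ eps < dist2 P q.

(* Main.v *)
Require Import Defs.
From mathcomp Require all_boot all_order all_algebra Rstruct.
From Stdlib Require Import Reals Lra Lia List Classical ClassicalChoice FunctionalExtensionality.
From Coquelicot Require Import Coquelicot.
Open Scope R_scope.

(** On the punctured domain the regular part changes by the harmonic function
    with data G on the small circle and 0 on the boundary of Om, which the barrier
    ln (R / |y - P|) / ln (R / eps) dominates.  The boundary data of the
    regular part are linear in S(x, .), so for every finite combination of points
    x_i the combination of H(x_i, y) is bounded by that of S(x_i, z) over
    the boundary.  Taking the combination to be an iterated difference, and
    using the interior gradient estimate for harmonic functions once in x (for S)
    and once in y (for H), one controls all finite differences of H and of
    H_eps - H in the four variables, hence the derivatives up to order two, with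
    no integral representation and without the symmetry of the Green
    function.  Thus KR_eps - KR tends to 0 in C^2 near (x0, y0).  In (a) the
    singular gradient of S forces x0 <> y0, and one passes to the limit; (b) is
    Newton's method with the inverse Hessian at (x0, y0). *)

(** The hypotheses describe H(x, .) for each fixed x and say nothing of its dependence on x, yet KR
    contains H(x, x) and is differentiated in x. This is the obstacle that shapes the proof: no
    derivative in x may be assumed, so estimates are stated for finite differences and derivatives
    appear only at the end, as limits of quotients. Three orders are carried because bounds of
    orders one and two make first partial derivatives exist, orders two and three do the same for
    second ones, and order three makes these Lipschitz, which Newton's method uses. Squares replace
    discs because all differences are taken along coordinate axes. The comparison of H_eps with H is
    merely logarithmic, of size 1 / ln (1 / eps), but no rate is required: the small factor is the
    norm of the map from data to harmonic function, so every difference inherits it. In (a) the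
    limits x0 and y0 might a priori coincide, hence convergence is first proved for the part of KR
    without S, which does not see the diagonal. *)

Definition box (c : pt) (r : R) (p : pt) : Prop :=
  Rabs (fst p - fst c) < r /\ Rabs (snd p - snd c) < r.

Lemma dist2_fst p q : Rabs (fst p - fst q) <= dist2 p q.
Proof.
  unfold dist2. rewrite <- sqrt_Rsqr_abs. apply sqrt_le_1_alt. unfold Rsqr.
  pose proof (pow2_ge_0 (snd p - snd q)). simpl in *; lra.
Qed.

Lemma dist2_snd p q : Rabs (snd p - snd q) <= dist2 p q.
Proof.
  unfold dist2. rewrite <- sqrt_Rsqr_abs. apply sqrt_le_1_alt. unfold Rsqr.
  pose proof (pow2_ge_0 (fst p - fst q)). simpl in *; lra.
Qed.

Lemma dist2_le p q : dist2 p q <= Rabs (fst p - fst q) + Rabs (snd p - snd q).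
Proof.
  unfold dist2. set (a := fst p - fst q). set (b := snd p - snd q).
  pose proof (Rabs_pos a). pose proof (Rabs_pos b).
  rewrite <- (sqrt_Rsqr (Rabs a + Rabs b)) by lra.
  apply sqrt_le_1_alt. unfold Rsqr.
  pose proof (pow2_abs a). pose proof (pow2_abs b). nra.
Qed.

Lemma dist2_sym p q : dist2 p q = dist2 q p.
Proof. unfold dist2. f_equal. ring. Qed.

Lemma dist2_pos p q : 0 <= dist2 p q.
Proof. apply sqrt_pos. Qed.

Lemma dist2_sqr p q : dist2 p q * dist2 p q = (fst p - fst q) ^ 2 + (snd p - snd q) ^ 2.
Proof. unfold dist2. apply sqrt_sqrt.
  pose proof (pow2_ge_0 (fst p - fst q)). pose proof (pow2_ge_0 (snd p - snd q)). lra. Qed.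

Lemma dist2_triangle p q s : dist2 p s <= dist2 p q + dist2 q s.
Proof.
  pose proof (dist2_pos p q). pose proof (dist2_pos q s). pose proof (dist2_pos p s).
  pose proof (dist2_sqr p q) as E1. pose proof (dist2_sqr q s) as E2.
  pose proof (dist2_sqr p s) as E3.
  set (a := fst p - fst q) in *. set (b := snd p - snd q) in *.
  set (c := fst q - fst s) in *. set (d := snd q - snd s) in *.
  replace (fst p - fst s) with (a + c) in E3 by (unfold a, c; ring).
  replace (snd p - snd s) with (b + d) in E3 by (unfold b, d; ring).
  (* Cauchy-Schwarz from Lagrange's identity: the two squares differ by [(a * d - b * c) ^ 2]. *)
  assert (K : a * c + b * d <= dist2 p q * dist2 q s).
  { apply Rsqr_incr_0_var; [ | now apply Rmult_le_pos]. unfold Rsqr.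
    replace (dist2 p q * dist2 q s * (dist2 p q * dist2 q s))
      with ((a ^ 2 + b ^ 2) * (c ^ 2 + d ^ 2)) by (rewrite <- E1, <- E2; ring).
    pose proof (pow2_ge_0 (a * d - b * c)). simpl in *; lra. }
  apply Rsqr_incr_0_var; [ | lra]. unfold Rsqr. simpl in *; lra.
Qed.

Lemma dist2_pos_neq p q : p <> q -> 0 < dist2 p q.
Proof.
  intros N.
  destruct (Rle_lt_or_eq_dec _ _ (dist2_pos p q)) as [H | H]; [exact H | ].
  exfalso. apply N. pose proof (dist2_fst p q). pose proof (dist2_snd p q).
  rewrite <- H in H0, H1. destruct p, q; simpl in *. f_equal.
  - revert H0. unfold Rabs; destruct (Rcase_abs _); lra.
  - revert H1. unfold Rabs; destruct (Rcase_abs _); lra.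
Qed.

Lemma box_dist2 c r p : box c r p -> dist2 p c < 2 * r.
Proof. intros [H1 H2]. pose proof (dist2_le p c). lra. Qed.

Lemma dist2_box c r p : dist2 p c < r -> box c r p.
Proof. intros H. pose proof (dist2_fst p c). pose proof (dist2_snd p c). split; lra. Qed.

Lemma open2_box D p : open2 D -> D p -> exists r, 0 < r /\ forall q, box p r q -> D q.
Proof.
  intros O Hp. destruct (O p Hp) as [r [Hr H]]. exists (r / 2). split; [lra | ].
  intros q Hq. apply H. rewrite dist2_sym. apply box_dist2 in Hq. lra.
Qed.

(** Open squares are the balls of the product uniform structure on [R * R], so the translation loses
    no constants. *)
Lemma continuous_box (u : pt -> R) p :
  continuous u p <->
  (forall e, 0 < e -> exists d, 0 < d /\ forall q, box p d q -> Rabs (u q - u p) < e).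
Proof.
  split.
  - intros H e He.
    assert (L : locally (u p) (fun y => Rabs (y - u p) < e)).
    { exists (mkposreal e He). intros y Hy. exact Hy. }
    specialize (H _ L). destruct H as [d Hd]. exists d. split; [apply cond_pos | ].
    intros q [H1 H2]. apply Hd. split; assumption.
  - intros H Q [e He]. destruct (H e (cond_pos e)) as [d [Hd K]].
    exists (mkposreal d Hd). intros q [H1 H2]. apply He. apply K. split; assumption.
Qed.

(** * Maximum principle and interior gradient estimate *)

(** Only axis derivatives are recorded: this class is visibly stable under
    linear combinations and the maximum principle needs no more. *)
Definition harm (D : pt -> Prop) (u : pt -> R) : Prop :=
  exists ux uy uxx uyy : pt -> R, forall p, D p ->
    continuous u p /\
    is_derive (fun t => u (t, snd p)) (fst p) (ux p) /\
    is_derive (fun t => u (fst p, t)) (snd p) (uy p) /\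
    is_derive (fun t => ux (t, snd p)) (fst p) (uxx p) /\
    is_derive (fun t => uy (fst p, t)) (snd p) (uyy p) /\
    uxx p + uyy p = 0.

Ltac split6 := split; [ | split; [ | split; [ | split; [ | split]]]].

Lemma harm_of_harmonic_on D h : harmonic_on D h -> harm D h.
Proof.
  intros [C E]. exists (Defs.d1 h), (Defs.d2 h), (Defs.d1 (Defs.d1 h)), (Defs.d2 (Defs.d2 h)). intros p Hp.
  destruct (C p Hp) as (A1 & A2 & A3 & _ & _ & A4 & A5 & _).
  split6; try assumption.
  - apply Derive_correct, A1.
  - apply Derive_correct, A2.
  - apply Derive_correct, A3.
  - apply Derive_correct, A4.
  - apply E, Hp.
Qed.

Lemma harm_subset (D D' : pt -> Prop) u : (forall p, D' p -> D p) -> harm D u -> harm D' u.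
Proof.
  intros S (ux & uy & uxx & uyy & H). exists ux, uy, uxx, uyy. intros p Hp. apply H, S, Hp.
Qed.

Lemma is_derive_lin (f g : R -> R) a b x l m :
  is_derive f x l -> is_derive g x m ->
  is_derive (fun t => a * f t + b * g t) x (a * l + b * m).
Proof.
  intros F G.
  apply (is_derive_plus (K := R_AbsRing) (V := R_NormedModule) (fun t => a * f t)
    (fun t => b * g t)); apply is_derive_scal; assumption.
Qed.

Lemma harm_lin D u v a b : harm D u -> harm D v -> harm D (fun p => a * u p + b * v p).
Proof.
  intros (ux & uy & uxx & uyy & H) (vx & vy & vxx & vyy & K).
  exists (fun p => a * ux p + b * vx p), (fun p => a * uy p + b * vy p),
    (fun p => a * uxx p + b * vxx p), (fun p => a * uyy p + b * vyy p).
  intros p Hp. destruct (H p Hp) as (H0 & H1 & H2 & H3 & H4 & H5).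
  destruct (K p Hp) as (K0 & K1 & K2 & K3 & K4 & K5).
  split6.
  - apply (continuous_plus (V := R_NormedModule)); apply (continuous_mult (K := R_AbsRing)); (assumption || apply continuous_const).
  - apply is_derive_lin; assumption.
  - apply is_derive_lin; assumption.
  - apply is_derive_lin; assumption.
  - apply is_derive_lin; assumption.
  - nra.
Qed.

Lemma harm_const D c : harm D (fun _ => c).
Proof.
  exists (fun _ => 0), (fun _ => 0), (fun _ => 0), (fun _ => 0). intros p _.
  split6; try (exact (is_derive_const 0 _)); try (exact (is_derive_const c _)); [apply continuous_const | ring].
Qed.

Lemma is_derive_affine (f : R -> R) s t x l :
  is_derive f (s * x + t) l -> is_derive (fun y => f (s * y + t)) x (s * l).
Proof.
  intros H. apply (is_derive_comp f (fun y => s * y + t)); [exact H | ].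
  auto_derive; [trivial | ring].
Qed.

(** Translations recentre the gradient estimate at an arbitrary point, and a reflection produces the
    odd part used in it. Coefficients of square 1 suffice for both and leave the second derivatives
    unscaled. *)
Lemma harm_affine (D D' : pt -> Prop) u s1 t1 s2 t2 :
  harm D u -> s1 * s1 = 1 -> s2 * s2 = 1 ->
  (forall p, D' p -> D (s1 * fst p + t1, s2 * snd p + t2)) ->
  harm D' (fun p => u (s1 * fst p + t1, s2 * snd p + t2)).
Proof.
  intros (ux & uy & uxx & uyy & H) E1 E2 S.
  set (m := fun p : pt => (s1 * fst p + t1, s2 * snd p + t2)).
  exists (fun p => s1 * ux (m p)), (fun p => s2 * uy (m p)), (fun p => uxx (m p)),
    (fun p => uyy (m p)).
  intros p Hp. destruct (H _ (S p Hp)) as (H0 & H1 & H2 & H3 & H4 & H5). simpl in *.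
  split6.
  - apply continuous_box. intros e He.
    destruct (proj1 (continuous_box _ _) H0 e He) as [d [Hd K]].
    exists d. split; [exact Hd | ]. intros q [Q1 Q2]. apply K. split; simpl.
    + replace (s1 * fst q + t1 - (s1 * fst p + t1)) with (s1 * (fst q - fst p)) by ring.
      rewrite Rabs_mult. replace (Rabs s1) with 1; [lra | ].
      symmetry. apply Rsqr_inj; [apply Rabs_pos | lra | ]. rewrite <- Rsqr_abs. unfold Rsqr. lra.
    + replace (s2 * snd q + t2 - (s2 * snd p + t2)) with (s2 * (snd q - snd p)) by ring.
      rewrite Rabs_mult. replace (Rabs s2) with 1; [lra | ].
      symmetry. apply Rsqr_inj; [apply Rabs_pos | lra | ]. rewrite <- Rsqr_abs. unfold Rsqr. lra.
  - apply (is_derive_affine (fun x => u (x, s2 * snd p + t2))). exact H1.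
  - apply (is_derive_affine (fun x => u (s1 * fst p + t1, x))). exact H2.
  - replace (uxx (m p)) with (s1 * (s1 * uxx (m p))) by (rewrite <- Rmult_assoc, E1; ring).
    apply is_derive_scal.
    apply (is_derive_affine (fun x => ux (x, s2 * snd p + t2))). exact H3.
  - replace (uyy (m p)) with (s2 * (s2 * uyy (m p))) by (rewrite <- Rmult_assoc, E2; ring).
    apply is_derive_scal.
    apply (is_derive_affine (fun x => uy (s1 * fst p + t1, x))). exact H4.
  - exact H5.
Qed.

(** Allows the estimates to be proved for the first coordinate only. *)
Lemma harm_swap (D : pt -> Prop) u :
  harm D u -> harm (fun p => D (snd p, fst p)) (fun p => u (snd p, fst p)).
Proof.
  intros (ux & uy & uxx & uyy & H).
  exists (fun p => uy (snd p, fst p)), (fun p => ux (snd p, fst p)),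
    (fun p => uyy (snd p, fst p)), (fun p => uxx (snd p, fst p)).
  intros p Hp. destruct (H _ Hp) as (H0 & H1 & H2 & H3 & H4 & H5). simpl in *.
  split6; try assumption; [ | lra].
  apply continuous_box. intros e He.
  destruct (proj1 (continuous_box _ _) H0 e He) as [d [Hd K]].
  exists d. split; [exact Hd | ]. intros q [Q1 Q2]. apply K. split; assumption.
Qed.

(** * Compactness and extrema in one variable *)

Lemma bounded_seq_cluster (a : nat -> R) M :
  (forall n, Rabs (a n) <= M) ->
  exists l, forall d N, 0 < d -> exists n, (N <= n)%nat /\ Rabs (a n - l) < d.
Proof.
  intros H. destruct (Bolzano_Weierstrass a (fun x => - M <= x <= M)) as [l Hl].
  - apply compact_P3.
  - intros n. specialize (H n). apply Rabs_le_between in H. exact H.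
  - exists l. intros d N Hd. destruct (Hl (disc l (mkposreal d Hd)) N) as [n [Hn K]].
    +      exists (mkposreal d Hd); intros x Hx; exact Hx.
    + exists n. split; [exact Hn | exact K].
Qed.

Lemma bounded_seq_cluster2 (p : nat -> pt) M :
  (forall n, box (0, 0) M (p n)) ->
  exists l, forall d N, 0 < d -> exists n, (N <= n)%nat /\ box l d (p n).
Proof.
  intros H.
  destruct (bounded_seq_cluster (fun n => fst (p n)) M) as [x Hx].
  { intros n. destruct (H n) as [K _]. simpl in K. rewrite Rminus_0_r in K. lra. }
  (* Indices whose first coordinates are [1 / (n + 1)]-close to [x]. As [f n] is at least [n], a
     cluster value of the second coordinates along [f] completes a cluster point of the pairs. *)
  assert (C : forall n : nat, exists m, (n <= m)%nat /\ Rabs (fst (p m) - x) < / (INR n + 1)).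
  { intros n. apply Hx. apply Rinv_0_lt_compat. pose proof (pos_INR n). lra. }
  apply choice in C. destruct C as [f Hf].
  destruct (bounded_seq_cluster (fun n => snd (p (f n))) M) as [y Hy].
  { intros n. destruct (H (f n)) as [_ K]. simpl in K. rewrite Rminus_0_r in K. lra. }
  exists (x, y). intros d N Hd.
  destruct (INR_unbounded (/ d)) as [N' HN'].
  destruct (Hy d (max N N') Hd) as [n [Hn K]].
  destruct (Hf n) as [F1 F2].
  exists (f n). split; [lia | ]. split; [ | exact K]. simpl.
  apply Rlt_trans with (1 := F2).
  assert (L : INR N' <= INR n) by (apply le_INR; lia).
  rewrite <- (Rinv_inv d). apply Rinv_lt_contravar; [ | lra].
  pose proof (Rinv_0_lt_compat d Hd). apply Rmult_lt_0_compat; lra.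
Qed.

Lemma local_max_derivative (g : R -> R) t r l :
  0 < r -> (forall s, Rabs (s - t) < r -> g s <= g t) -> is_derive g t l -> l = 0.
Proof.
  intros Hr M H. apply is_derive_Reals in H.
  destruct (Rtotal_order l 0) as [L | [L | L]]; [exfalso | exact L | exfalso].
  - destruct (H (- l) ltac:(lra)) as [d Hd].
    set (h := - (Rmin d r / 2)).
    assert (0 < Rmin d r) by (apply Rmin_glb_lt; [apply cond_pos | lra]).
    pose proof (Rmin_l d r). pose proof (Rmin_r d r).
    assert (A : Rabs h < d) by (unfold h; rewrite Rabs_Ropp, Rabs_pos_eq; lra).
    specialize (Hd h (ltac:(unfold h; lra)) A).
    assert (K : g (t + h) <= g t).
    { apply M. replace (t + h - t) with h by ring. unfold h; rewrite Rabs_Ropp, Rabs_pos_eq; lra. }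
    apply Rabs_def2 in Hd. destruct Hd as [Hd _].
    assert (0 <= (g (t + h) - g t) / h).
    { replace ((g (t + h) - g t) / h) with ((g t - g (t + h)) / (- h)) by (field; unfold h; lra).
      apply Rdiv_le_0_compat; unfold h in *; lra. }
    lra.
  - destruct (H l L) as [d Hd].
    set (h := Rmin d r / 2).
    assert (0 < Rmin d r) by (apply Rmin_glb_lt; [apply cond_pos | lra]).
    pose proof (Rmin_l d r). pose proof (Rmin_r d r).
    assert (A : Rabs h < d) by (unfold h; rewrite Rabs_pos_eq; lra).
    specialize (Hd h (ltac:(unfold h; lra)) A).
    assert (K : g (t + h) <= g t).
    { apply M. replace (t + h - t) with h by ring. unfold h; rewrite Rabs_pos_eq; lra. }
    apply Rabs_def2 in Hd. destruct Hd as [_ Hd].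
    assert ((g (t + h) - g t) / h <= 0).
    { replace ((g (t + h) - g t) / h) with (- ((g t - g (t + h)) / h)) by (field; unfold h; lra).
      assert (0 <= (g t - g (t + h)) / h) by (apply Rdiv_le_0_compat; unfold h in *; lra). lra. }
    lra.
Qed.

(** If [a] were positive, [g1], which vanishes at [t], would be positive just to the right of [t],
    and the mean value theorem would push [g] above [g t]. Differentiability of [g1] at the single
    point [t] is enough, so second derivatives need not be continuous. *)
Lemma local_max_derivative2 (g g1 : R -> R) t r a :
  0 < r -> (forall s, Rabs (s - t) < r -> g s <= g t) ->
  (forall s, Rabs (s - t) < r -> is_derive g s (g1 s)) ->
  is_derive g1 t a -> a <= 0.
Proof.
  intros Hr M D1 D2.
  assert (Z : g1 t = 0).
  { apply (local_max_derivative g t r); [exact Hr | exact M | ].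
    apply D1. rewrite Rminus_diag, Rabs_R0. exact Hr. }
  apply Rnot_lt_le. intros L.
  apply is_derive_Reals in D2. destruct (D2 a L) as [d Hd].
  assert (0 < Rmin d r) by (apply Rmin_glb_lt; [apply cond_pos | lra]).
  pose proof (Rmin_l d r). pose proof (Rmin_r d r).
  set (h := Rmin d r / 2).
  assert (Hh : 0 < h) by (unfold h; lra).
  assert (MV : forall u v, t <= u < v -> v <= t + h ->
    exists c, u <= c <= v /\ g v - g u = g1 c * (v - u)).
  { intros u v Hu Hv. destruct (MVT_gen g u v g1) as [c [C E]].
    - intros s [B1 B2]. rewrite Rmin_left in B1 by lra. rewrite Rmax_right in B2 by lra.
      apply D1. rewrite Rabs_pos_eq; unfold h in *; lra.
    - intros s [B1 B2]. rewrite Rmin_left in B1 by lra. rewrite Rmax_right in B2 by lra.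
      apply continuity_pt_filterlim.
      apply (ex_derive_continuous (K := R_AbsRing) (V := R_NormedModule)).
      exists (g1 s). apply D1. rewrite Rabs_pos_eq; unfold h in *; lra.
    - rewrite Rmin_left, Rmax_right in C by lra. exists c. split; assumption. }
  assert (Pos : forall s, t < s <= t + h -> 0 < g1 s).
  { intros s Hs. assert (A : Rabs (s - t) < d) by (rewrite Rabs_pos_eq; unfold h in *; lra).
    specialize (Hd (s - t) ltac:(lra) A). apply Rabs_def2 in Hd. destruct Hd as [_ Hd].
    replace (t + (s - t)) with s in Hd by ring. rewrite Z, Rminus_0_r in Hd.
    replace (g1 s) with ((g1 s / (s - t)) * (s - t)) by (field; lra).
    apply Rmult_lt_0_compat; lra. }
  assert (K : g (t + h) <= g t).
  { apply M. replace (t + h - t) with h by ring. unfold h; rewrite Rabs_pos_eq; lra. }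
  (* The mean value point may be the left endpoint, where [g1] vanishes: hence the midpoint. *)
  destruct (MV t (t + h / 2)) as [b [B E1]]; [lra | lra | ].
  destruct (MV (t + h / 2) (t + h)) as [c [C E2]]; [lra | lra | ].
  assert (Q : 0 <= g1 b).
  { destruct (Req_dec b t) as [-> | Nb]; [lra | ]. apply Rlt_le, Pos. lra. }
  pose proof (Pos c ltac:(lra)).
  assert (0 < g1 c * (t + h - (t + h / 2))) by (apply Rmult_lt_0_compat; lra).
  assert (0 <= g1 b * (t + h / 2 - t)) by (apply Rmult_le_pos; lra).
  lra.
Qed.

Ltac continuous_polynomial :=
  simpl; repeat match goal with
  | |- continuous (fun q => @?f q + @?g q) _ =>
      apply (continuous_plus (V := R_NormedModule) f g)
  | |- continuous (fun q => @?f q - @?g q) _ =>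
      apply (continuous_minus (V := R_NormedModule) f g)
  | |- continuous (fun q => @?f q * @?g q) _ =>
      apply (continuous_mult (K := R_AbsRing) f g)
  | |- continuous (fun q => fst q) _ => apply continuous_fst
  | |- continuous (fun q => snd q) _ => apply continuous_snd
  | |- continuous (fun _ => ?c) _ => apply continuous_const
  end.

(** A substitute for attainment of the supremum that also covers unbounded
    [v]: hence the passage through [atan]. *)
Lemma sup_cluster (D : pt -> Prop) (v : pt -> R) :
  bounded2 D -> (exists p, D p) ->
  exists l, forall q c d, D q -> c < v q -> 0 < d ->
    exists p, D p /\ box l d p /\ c < v p.
Proof.
  intros [M HM] [p0 Hp0].
  destruct (completeness (fun y => exists q, D q /\ y = atan (v q))) as [m [Hm1 Hm2]].
  - exists (PI / 2). intros y [q [_ ->]]. pose proof (atan_bound (v q)). lra.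
  - exists (atan (v p0)), p0. split; [exact Hp0 | reflexivity].
  - assert (C : forall n : nat, exists p, D p /\ m - / (INR n + 1) < atan (v p)).
    { intros n. apply NNPP. intros Hn.
      assert (0 < / (INR n + 1)) by (apply Rinv_0_lt_compat; pose proof (pos_INR n); lra).
      assert (m <= m - / (INR n + 1)); [ | lra].
      apply Hm2. intros y [q [Hq ->]]. apply Rnot_lt_le. intros L. apply Hn.
      exists q. split; assumption. }
    apply choice in C. destruct C as [f Hf].
    destruct (bounded_seq_cluster2 f M) as [l Hl].
    { intros n. apply dist2_box. rewrite dist2_sym. apply HM, Hf. }
    exists l. intros q c d Hq Hc Hd.
    assert (A : atan c < atan (v q)) by (apply atan_increasing, Hc).
    destruct (INR_unbounded (/ (atan (v q) - atan c))) as [N HN].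
    destruct (Hl d N Hd) as [n [Hn Hb]].
    exists (f n). destruct (Hf n) as [F1 F2]. split; [exact F1 | split; [exact Hb | ]].
    apply Rnot_le_lt. intros L.
    assert (A1 : atan (v (f n)) <= atan c).
    { destruct L as [L | ->]; [apply Rlt_le, atan_increasing, L | apply Rle_refl]. }
    assert (A2 : atan (v q) <= m) by (apply Hm1; exists q; split; [exact Hq | reflexivity]).
    assert (A3 : / (INR n + 1) < atan (v q) - atan c).
    { apply le_INR in Hn. rewrite <- (Rinv_inv (atan (v q) - atan c)).
      apply Rinv_lt_contravar; [ | lra].
      apply Rmult_lt_0_compat; [apply Rinv_0_lt_compat; lra | ]. pose proof (pos_INR n). lra. }
    lra.
Qed.

Lemma is_derive_sqr c x : is_derive (fun t => t ^ 2 + c) x (2 * x).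
Proof. auto_derive; [trivial | ring]. Qed.

(** Adding [eta] times the squared norm makes the Laplacian strictly positive, which excludes an
    interior maximum. The boundary condition is a one-sided limit, so [u] need not be defined by
    continuity on the boundary. *)
Lemma max_principle (D : pt -> Prop) u B :
  open2 D -> bounded2 D -> harm D u ->
  (forall y0, bdry D y0 -> forall e, 0 < e ->
     exists d, 0 < d /\ forall y, D y -> dist2 y y0 < d -> u y < B + e) ->
  forall p, D p -> u p <= B.
Proof.
  intros O Bd Hu Hb p0 Hp0. apply Rnot_lt_le. intros L.
  assert (Bd' := Bd). destruct Bd' as [M HM].
  (* With this choice the excess of [u p0] over [B] is [2 * eta * (M ^ 2 + 1)]. The added term, at
     most [eta * M ^ 2] on [D], and the boundary tolerance [eta] together fall short of it. *)
  set (eta := (u p0 - B) / (2 * (M ^ 2 + 1))).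
  assert (M2 : 0 <= M ^ 2) by apply pow2_ge_0.
  assert (He : 0 < eta) by (apply Rdiv_lt_0_compat; lra).
  assert (E : u p0 = B + 2 * eta * (M ^ 2 + 1)) by (unfold eta; field; lra).
  set (N := fun q : pt => fst q ^ 2 + snd q ^ 2).
  assert (HN : forall q, D q -> 0 <= N q <= M ^ 2).
  { intros q Hq. specialize (HM q Hq). pose proof (dist2_sqr (0, 0) q) as Q. simpl in Q.
    pose proof (dist2_pos (0, 0) q). unfold N. split.
    - pose proof (pow2_ge_0 (fst q)). pose proof (pow2_ge_0 (snd q)). lra.
    - assert (dist2 (0, 0) q * dist2 (0, 0) q <= M * M) by (apply Rmult_le_compat; lra).
      simpl. lra. }
  set (v := fun q => u q + eta * N q).
  destruct (sup_cluster D v Bd (ex_intro _ p0 Hp0)) as [l Hl].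
  assert (V0 : B + eta * (2 * M ^ 2 + 1) < v p0).
  { unfold v. destruct (HN p0 Hp0). pose proof (Rmult_le_pos eta (N p0)). lra. }
  (* If [l] lies in [D], then [v] is maximal there and both second derivatives of [u] are at most
     [- 2 * eta], against harmonicity. Otherwise [l] is a boundary point, near which the boundary
     condition keeps [v] too small. *)
  destruct (classic (D l)) as [Dl | Dl].
  - destruct Hu as (ux & uy & uxx & uyy & Hu).
    destruct (open2_box D l O Dl) as [r [Hr HrD]].
    assert (Cv : continuous v l).
    { apply (continuous_plus (V := R_NormedModule)); [apply Hu, Dl | ].
      unfold N. continuous_polynomial. }
    assert (Mx : forall q, D q -> v q <= v l).
    { intros q Hq. apply Rnot_lt_le. intros Lq.
      destruct (proj1 (continuous_box _ _) Cv ((v q - v l) / 2)) as [d [Hd K]]; [lra | ].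
      destruct (Hl q ((v q + v l) / 2) d Hq) as [p [Hp1 [Hp2 Hp3]]]; [lra | lra | ].
      specialize (K p Hp2). apply Rabs_def2 in K. lra. }
    assert (X : uxx l + eta * 2 <= 0).
    { apply (local_max_derivative2 (fun t => v (t, snd l))
        (fun t => ux (t, snd l) + eta * (2 * t)) (fst l) r); [exact Hr | | | ].
      - intros s Hs. replace (fst l, snd l) with l by (destruct l; reflexivity).
        apply Mx, HrD. split; simpl; [exact Hs | rewrite Rminus_diag, Rabs_R0; lra].
      - intros s Hs. unfold v.
        apply (is_derive_plus (K := R_AbsRing) (V := R_NormedModule)
          (fun t => u (t, snd l)) (fun t => eta * N (t, snd l))).
        + apply (Hu (s, snd l)). apply HrD. split; simpl; [exact Hs | rewrite Rminus_diag, Rabs_R0; lra].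
        + apply is_derive_scal.
          apply (is_derive_ext (fun t => t ^ 2 + snd l ^ 2)); [reflexivity | apply is_derive_sqr].
      - apply (is_derive_plus (K := R_AbsRing) (V := R_NormedModule)
          (fun t => ux (t, snd l)) (fun t => eta * (2 * t))).
        + apply Hu, Dl.
        + auto_derive; [trivial | ring]. }
    assert (Y : uyy l + eta * 2 <= 0).
    { apply (local_max_derivative2 (fun t => v (fst l, t))
        (fun t => uy (fst l, t) + eta * (2 * t)) (snd l) r); [exact Hr | | | ].
      - intros s Hs. replace (fst l, snd l) with l by (destruct l; reflexivity).
        apply Mx, HrD. split; simpl; [rewrite Rminus_diag, Rabs_R0; lra | exact Hs].
      - intros s Hs. unfold v.
        apply (is_derive_plus (K := R_AbsRing) (V := R_NormedModule)
          (fun t => u (fst l, t)) (fun t => eta * N (fst l, t))).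
        + apply (Hu (fst l, s)). apply HrD. split; simpl; [rewrite Rminus_diag, Rabs_R0; lra | exact Hs].
        + apply is_derive_scal.
          apply (is_derive_ext (fun t => t ^ 2 + fst l ^ 2)); [ | apply is_derive_sqr].
          intros t. unfold N. simpl. ring.
      - apply (is_derive_plus (K := R_AbsRing) (V := R_NormedModule)
          (fun t => uy (fst l, t)) (fun t => eta * (2 * t))).
        + apply Hu, Dl.
        + auto_derive; [trivial | ring]. }
    destruct (Hu l Dl) as (_ & _ & _ & _ & _ & Z). lra.
  - assert (Bl : bdry D l).
    { split; [ | exact Dl]. intros r Hr.
      destruct (Hl p0 (v p0 - 1) (r / 2) Hp0) as [p [Hp1 [Hp2 _]]]; [lra | lra | ].
      exists p. split; [exact Hp1 | ]. apply box_dist2 in Hp2. rewrite dist2_sym. lra. }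
    destruct (Hb l Bl eta He) as [d [Hd K]].
    assert (M3 : 0 <= eta * M ^ 2) by (apply Rmult_le_pos; lra).
    destruct (Hl p0 (B + eta * (2 * M ^ 2 + 1)) (d / 2) Hp0) as [p [Hp1 [Hp2 Hp3]]]; [lra | lra | ].
    apply box_dist2 in Hp2. specialize (K p Hp1 ltac:(lra)). unfold v in Hp3.
    destruct (HN p Hp1) as [_ HN2].
    assert (eta * N p <= eta * M ^ 2) by (apply Rmult_le_compat_l; lra). lra.
Qed.

Lemma box_bounded c r : bounded2 (box c r).
Proof.
  exists (dist2 (0, 0) c + 2 * r). intros p Hp. apply box_dist2 in Hp.
  rewrite dist2_sym in Hp. pose proof (dist2_triangle (0, 0) c p). lra.
Qed.

(** The comparison function is (M / d^2) (x2^2 - x1^2 + 2 d x1), applied to the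
    part of [u] that is odd in x1, on the half square x1 > 0. *)
Lemma gradient_estimate_origin u M d (ux0 : R) :
  0 < d -> (exists d', d < d' /\ harm (box (0, 0) d') u) ->
  (forall p, Rabs (fst p) <= d -> Rabs (snd p) <= d -> Rabs (u p) <= M) ->
  is_derive (fun t => u (t, 0)) 0 ux0 -> Rabs ux0 <= 2 * M / d.
Proof.
  intros Hd [d' [Hd' Hu]] HM HD.
  assert (M0 : 0 <= M).
  { pose proof (HM (0, 0)) as K. simpl in K. rewrite Rabs_R0 in K.
    pose proof (Rabs_pos (u (0, 0))). lra. }
  set (D := fun p : pt => 0 < fst p < d /\ - d < snd p < d).
  set (psi := fun p : pt => M / d ^ 2 * (snd p ^ 2 - fst p ^ 2 + 2 * d * fst p)).
  set (phi := fun p : pt => / 2 * u p + - / 2 * u (- 1 * fst p + 0, 1 * snd p + 0)).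
  assert (Hphi : harm (box (0, 0) d') phi).
  { apply (harm_lin _ u (fun p => u (- 1 * fst p + 0, 1 * snd p + 0))); [exact Hu | ].
    apply (harm_affine (box (0, 0) d') _ u); [exact Hu | ring | ring | ].
    intros p [P1 P2]. split; simpl in *.
    - replace (- 1 * fst p + 0 - 0) with (- (fst p - 0)) by ring. rewrite Rabs_Ropp. exact P1.
    - replace (1 * snd p + 0 - 0) with (snd p - 0) by ring. exact P2. }
  assert (Hpsi : forall E, harm E psi).
  { intros E. exists (fun p => M / d ^ 2 * (2 * d - 2 * fst p)), (fun p => M / d ^ 2 * (2 * snd p)),
      (fun p => M / d ^ 2 * (- 2)), (fun p => M / d ^ 2 * 2).
    intros p _. unfold psi; simpl. split6; try (auto_derive; [trivial | ring]); [ | ring].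
    continuous_polynomial. }
  assert (Dbox : forall p, D p -> box (0, 0) d' p).
  { intros p [P1 P2]. split; simpl; rewrite Rminus_0_r; apply Rabs_def1; lra. }
  assert (OD : open2 D).
  { intros p [P1 P2].
    set (r := Rmin (Rmin (fst p) (d - fst p)) (Rmin (snd p + d) (d - snd p))).
    assert (r <= fst p /\ r <= d - fst p /\ r <= snd p + d /\ r <= d - snd p) as (R1 & R2 & R3 & R4).
    { unfold r. repeat split; eapply Rle_trans; 
        [apply Rmin_l | apply Rmin_l | apply Rmin_l | apply Rmin_r | 
         apply Rmin_r | apply Rmin_l | apply Rmin_r | apply Rmin_r]. }
    exists r. split.
    - unfold r. repeat apply Rmin_glb_lt; lra.
    - intros q Hq. pose proof (dist2_fst p q) as A1. pose proof (dist2_snd p q) as A2.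
      assert (A3 := Rle_lt_trans _ _ _ A1 Hq). assert (A4 := Rle_lt_trans _ _ _ A2 Hq).
      apply Rabs_def2 in A3. apply Rabs_def2 in A4. unfold D. lra. }
  assert (BD : bounded2 D).
  { destruct (box_bounded (0, 0) d') as [K HK]. exists K. intros p Hp. apply HK, Dbox, Hp. }
  (* On the closure of the half square phi is continuous, and its boundary is covered by the
     faces x1 = 0, x1 = d, |x2| = d. *)
  assert (Bnd : forall s, s * s = 1 -> forall p, D p -> s * phi p + -1 * psi p <= 0).
  { intros s Hs. apply max_principle; [exact OD | exact BD | | ].
    { apply (harm_lin D phi psi); [ | apply Hpsi]. apply (harm_subset (box (0, 0) d')); assumption. }
    intros y0 [Y1 Y2] e He.
    assert (C : 0 <= fst y0 <= d /\ - d <= snd y0 <= d).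
    { assert (F : forall r, 0 < r -> - r < fst y0 < d + r /\ - d - r < snd y0 < d + r).
      { intros r Hr. destruct (Y1 r Hr) as [q [[Q1 Q2] Q3]]. rewrite dist2_sym in Q3.
        pose proof (dist2_fst q y0) as A1. pose proof (dist2_snd q y0) as A2.
        assert (A3 := Rle_lt_trans _ _ _ A1 Q3). assert (A4 := Rle_lt_trans _ _ _ A2 Q3).
        apply Rabs_def2 in A3. apply Rabs_def2 in A4. lra. }
      repeat split; apply Rnot_lt_le; intros L.
      - specialize (F (- fst y0)). lra.
      - specialize (F (fst y0 - d)). lra.
      - specialize (F (- d - snd y0)). lra.
      - specialize (F (snd y0 - d)). lra. }
    assert (Cb : box (0, 0) d' y0) by (split; simpl; rewrite Rminus_0_r; apply Rabs_def1; lra).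
    assert (Cont : continuous (fun p => s * phi p + -1 * psi p) y0).
    { destruct (harm_lin _ phi psi s (-1) Hphi (Hpsi _)) as (wx & wy & wxx & wyy & K).
      apply (K y0 Cb). }
    assert (V : s * phi y0 + -1 * psi y0 <= 0).
    { assert (S1 : Rabs s = 1).
      { apply Rsqr_inj; [apply Rabs_pos | lra | ]. rewrite <- Rsqr_abs. unfold Rsqr. lra. }
      assert (Fac : fst y0 = 0 \/ fst y0 = d \/ snd y0 = d \/ snd y0 = - d).
      { apply NNPP. intros K. apply Y2. unfold D.
        assert (fst y0 <> 0) by tauto. assert (fst y0 <> d) by tauto.
        assert (snd y0 <> d) by tauto. assert (snd y0 <> - d) by tauto. lra. }
      assert (Md : 0 <= M / d ^ 2) by (apply Rdiv_le_0_compat; [lra | apply pow_lt, Hd]).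
      assert (PhiM : s * phi y0 <= M).
      { apply Rle_trans with (1 := Rle_abs _). rewrite Rabs_mult, S1, Rmult_1_l.
        unfold phi. apply Rle_trans with (1 := Rabs_triang _ _).
        rewrite !Rabs_mult. replace (Rabs (- / 2)) with (/ 2) by (rewrite Rabs_Ropp, Rabs_pos_eq; lra).
        rewrite (Rabs_pos_eq (/ 2)) by lra.
        assert (K1 : Rabs (u y0) <= M) by (apply HM; apply Rabs_le; lra).
        assert (K2 : Rabs (u (-1 * fst y0 + 0, 1 * snd y0 + 0)) <= M)
          by (apply HM; simpl; apply Rabs_le; lra).
        lra. }
      assert (PsiM : M / d ^ 2 * d ^ 2 = M) by (field; lra).
      assert (sq : 0 <= snd y0 ^ 2) by apply pow2_ge_0.
      unfold psi.
      (* On the face x1 = 0 oddness makes [phi] vanish while [psi] is nonnegative. On the other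
         three faces the bracket in [psi] is at least d^2, so [psi] is at least [M], which bounds
         [phi]. *)
      destruct Fac as [F | [F | F]].
      - assert (phi y0 = 0) as ->.
        { unfold phi. rewrite F. destruct y0 as [a b]; simpl in *. subst a.
          replace (-1 * 0 + 0) with 0 by ring. replace (1 * b + 0) with b by ring. field. }
        rewrite F. pose proof (Rmult_le_pos _ _ Md sq). simpl in *. lra.
      - rewrite F. pose proof (Rmult_le_pos _ _ Md sq). simpl in *. lra.
      - assert (snd y0 ^ 2 = d ^ 2) as -> by (destruct F as [-> | ->]; ring).
        assert (0 <= fst y0 * (2 * d - fst y0)) by (apply Rmult_le_pos; lra).
        pose proof (Rmult_le_pos _ _ Md H). simpl in *. lra. }
    destruct (proj1 (continuous_box _ _) Cont e He) as [r [Hr K]].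
    exists r. split; [exact Hr | ]. intros y Hy Hyr.
    specialize (K y (dist2_box _ _ _ Hyr)). apply Rabs_def2 in K. lra. }
  (* At the origin [phi] vanishes and has the same x1-derivative as [u]. Since [psi (h, 0)] is at
     most [2 * M / d * h], no difference quotient of [phi] can come closer to [ux0] than the assumed
     gap. *)
  apply Rnot_lt_le. intros L.
  assert (Hphi0 : is_derive (fun t => phi (t, 0)) 0 ux0).
  { unfold phi. simpl.
    replace ux0 with (/ 2 * ux0 + - / 2 * (- 1 * ux0)) by lra.
    apply (is_derive_lin (fun t => u (t, 0)) (fun t => u (-1 * t + 0, 1 * 0 + 0))); [exact HD | ].
    apply (is_derive_affine (fun x => u (x, 1 * 0 + 0))).
    replace (1 * 0 + 0) with 0 by ring. replace (-1 * 0 + 0) with 0 by ring. exact HD. }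
  apply is_derive_Reals in Hphi0.
  destruct (Hphi0 (Rabs ux0 - 2 * M / d)) as [r Hr]; [lra | ].
  assert (Hm : 0 < Rmin r d) by (apply Rmin_glb_lt; [apply cond_pos | lra]).
  pose proof (Rmin_l r d). pose proof (Rmin_r r d).
  set (h := Rmin r d / 2). assert (h0 : 0 < h) by (unfold h; lra).
  assert (Z : phi (0, 0) = 0).
  { unfold phi. simpl. replace (-1 * 0 + 0) with 0 by ring. replace (1 * 0 + 0) with 0 by ring. field. }
  specialize (Hr h). change (h <> 0 -> Rabs h < r -> Rabs ((phi (0 + h, 0) - phi (0, 0)) / h - ux0) < Rabs ux0 - 2 * M / d) in Hr.
  specialize (Hr (ltac:(lra))). rewrite Rplus_0_l, Z, Rminus_0_r in Hr.
  specialize (Hr ltac:(rewrite Rabs_pos_eq; unfold h; lra)).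
  assert (A : Rabs (phi (h, 0) / h) <= 2 * M / d).
  { assert (Dh : D (h, 0)) by (unfold D, h; simpl; lra).
    pose proof (Bnd 1 ltac:(ring) _ Dh) as B1. pose proof (Bnd (-1) ltac:(ring) _ Dh) as B2.
    assert (P : psi (h, 0) <= 2 * M / d * h).
    { unfold psi. simpl.
      replace (2 * M / d * h) with (M / (d * (d * 1)) * (2 * d * h)) by (field; lra).
      apply Rmult_le_compat_l; [ | nra].
      apply Rdiv_le_0_compat; [lra | ]. rewrite Rmult_1_r. apply Rmult_lt_0_compat; lra. }
    unfold Rdiv at 1. rewrite Rabs_mult, (Rabs_pos_eq (/ h)) by (apply Rlt_le, Rinv_0_lt_compat, h0).
    apply Rmult_le_reg_r with h; [exact h0 | ].
    rewrite Rmult_assoc, Rinv_l, Rmult_1_r by lra.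
    apply Rabs_le. lra. }
  pose proof (Rabs_triang_inv ux0 (phi (h, 0) / h)) as T.
  rewrite Rabs_minus_sym in Hr. lra.
Qed.

Definition shift2 (i : nat) (h : R) (p : pt) : pt :=
  match i with O => (fst p + h, snd p) | _ => (fst p, snd p + h) end.

Lemma gradient_estimate_fst c r rho u M :
  0 < rho -> harm (box c r) u -> (forall p, box c r p -> Rabs (u p) <= M) ->
  forall p, box c (r - rho) p ->
  exists l, is_derive (fun t => u (t, snd p)) (fst p) l /\ Rabs l <= 2 * M / rho.
Proof.
  intros Hrho Hu HM p [P1 P2].
  assert (Hu' := Hu). destruct Hu' as (ux & uy & uxx & uyy & K).
  assert (Bp : box c r p) by (split; lra).
  destruct (K p Bp) as (_ & Dx & _). exists (ux p). split; [exact Dx | ].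
  (* The sup-norm distance from [p] to the complement of the box. It strictly exceeds [rho], which
     leaves the open margin around the closed square of half-side [rho]. *)
  set (d' := Rmin (r - Rabs (fst p - fst c)) (r - Rabs (snd p - snd c))).
  pose proof (Rmin_l (r - Rabs (fst p - fst c)) (r - Rabs (snd p - snd c))) as L1.
  pose proof (Rmin_r (r - Rabs (fst p - fst c)) (r - Rabs (snd p - snd c))) as L2.
  fold d' in L1, L2.
  assert (Sub : forall q : pt, Rabs (fst q) < d' -> Rabs (snd q) < d' ->
    box c r (1 * fst q + fst p, 1 * snd q + snd p)).
  { intros q Q1 Q2. split; simpl.
    - replace (1 * fst q + fst p - fst c) with (fst q + (fst p - fst c)) by ring.
      apply Rle_lt_trans with (1 := Rabs_triang _ _). lra.
    - replace (1 * snd q + snd p - snd c) with (snd q + (snd p - snd c)) by ring.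
      apply Rle_lt_trans with (1 := Rabs_triang _ _). lra. }
  assert (rho < d') by (apply Rmin_glb_lt; lra).
  apply (gradient_estimate_origin (fun q => u (1 * fst q + fst p, 1 * snd q + snd p)));
    [exact Hrho | | | ].
  - exists d'. split; [assumption | ].
    apply (harm_affine (box c r) _ u); [exact Hu | ring | ring | ].
    intros q [Q1 Q2]. simpl in *. rewrite Rminus_0_r in Q1, Q2. apply Sub; assumption.
  - intros q Q1 Q2. apply HM, Sub; lra.
  - simpl. replace (ux p) with (1 * ux p) by ring.
    apply (is_derive_affine (fun x => u (x, 1 * 0 + snd p))).
    replace (1 * 0 + snd p) with (snd p) by ring. replace (1 * 0 + fst p) with (fst p) by ring.
    exact Dx.
Qed.

Lemma increment_bound (f : R -> R) x h L :
  (forall t, Rabs (t - x) <= Rabs h -> exists l, is_derive f t l /\ Rabs l <= L) ->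
  Rabs (f (x + h) - f x) <= L * Rabs h.
Proof.
  intros H.
  assert (Ab : forall t, Rmin x (x + h) <= t <= Rmax x (x + h) -> Rabs (t - x) <= Rabs h).
  { intros t [T1 T2]. destruct (Rle_or_lt 0 h) as [Hh | Hh].
    - rewrite Rmin_left in T1 by lra. rewrite Rmax_right in T2 by lra.
      rewrite !Rabs_pos_eq; lra.
    - rewrite Rmin_right in T1 by lra. rewrite Rmax_left in T2 by lra.
      rewrite !Rabs_left1; lra. }
  destruct (MVT_gen f x (x + h) (Derive f)) as [c [C1 C2]].
  - intros t T. apply Derive_correct. destruct (H t) as [l [Hl _]]; [apply Ab; lra | ].
    exists l. exact Hl.
  - intros t T. apply continuity_pt_filterlim.
    apply (ex_derive_continuous (K := R_AbsRing) (V := R_NormedModule)).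
    destruct (H t) as [l [Hl _]]; [apply Ab; lra | ]. exists l. exact Hl.
  - rewrite C2. destruct (H c (Ab c C1)) as [l [Hl Bl]].
    rewrite (is_derive_unique _ _ _ Hl). replace (x + h - x) with h by ring.
    rewrite Rabs_mult. apply Rmult_le_compat_r; [apply Rabs_pos | exact Bl].
Qed.

(** Of the margin [2 * rho], one [rho] is spent on the gradient estimate and the other on the
    segment from [p] to its translate. *)
Lemma harm_increment_fst c r rho u M :
  0 < rho -> harm (box c r) u -> (forall p, box c r p -> Rabs (u p) <= M) ->
  forall p h, box c (r - 2 * rho) p -> Rabs h < rho ->
  Rabs (u (fst p + h, snd p) - u p) <= 2 * M / rho * Rabs h.
Proof.
  intros Hrho Hu HM p h [P1 P2] Hh.
  replace (u p) with (u (fst p, snd p)) by (destruct p; reflexivity).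
  apply (increment_bound (fun t => u (t, snd p))). intros t Ht.
  apply (gradient_estimate_fst c r rho u M Hrho Hu HM (t, snd p)). split; simpl; [ | lra].
  replace (t - fst c) with (t - fst p + (fst p - fst c)) by ring.
  apply Rle_lt_trans with (1 := Rabs_triang _ _). lra.
Qed.

Lemma harm_increment c r rho u M i :
  0 < rho -> harm (box c r) u -> (forall p, box c r p -> Rabs (u p) <= M) ->
  forall p h, box c (r - 2 * rho) p -> Rabs h < rho ->
  Rabs (u (shift2 i h p) - u p) <= 2 * M / rho * Rabs h.
Proof.
  intros Hrho Hu HM p h Bp Hh. destruct i as [ | i]; simpl.
  - apply (harm_increment_fst c r); assumption.
  - pose proof (harm_increment_fst (snd c, fst c) r rho (fun q => u (snd q, fst q)) M Hrho) as K.
    assert (Sw : forall q s, box (snd c, fst c) s q <-> box c s (snd q, fst q)).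
    { intros q s. unfold box; simpl. tauto. }
    specialize (K (harm_subset _ _ _ (fun q => proj1 (Sw q r)) (harm_swap _ _ Hu))).
    specialize (K (fun q Hq => HM _ (proj1 (Sw q r) Hq)) (snd p, fst p) h).
    simpl in K. destruct p as [x y]; simpl in *. apply K; [ | exact Hh].
    apply Sw. exact Bp.
Qed.

Lemma shift2_box c r rho i h p : box c (r - rho) p -> Rabs h <= rho -> box c r (shift2 i h p).
Proof.
  intros [P1 P2] Hh. pose proof (Rabs_pos h).
  destruct i; split; simpl; try lra.
  - replace (fst p + h - fst c) with (h + (fst p - fst c)) by ring.
    apply Rle_lt_trans with (1 := Rabs_triang _ _). lra.
  - replace (snd p + h - snd c) with (h + (snd p - snd c)) by ring.
    apply Rle_lt_trans with (1 := Rabs_triang _ _). lra.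
Qed.

Lemma box_subset c r r' p : r <= r' -> box c r p -> box c r' p.
Proof. intros H [P1 P2]. split; lra. Qed.

Lemma harm_shift2 (D D' : pt -> Prop) u i h :
  harm D u -> (forall p, D' p -> D (shift2 i h p)) -> harm D' (fun p => u (shift2 i h p)).
Proof.
  intros Hu S.
  assert (E : exists t1 t2, forall p, shift2 i h p = (1 * fst p + t1, 1 * snd p + t2)).
  { destruct i; [exists h, 0 | exists 0, h]; intros p; simpl; f_equal; ring. }
  destruct E as [t1 [t2 E]].
  replace (fun p => u (shift2 i h p)) with (fun p : pt => u (1 * fst p + t1, 1 * snd p + t2))
    by (apply functional_extensionality; intros p; rewrite E; reflexivity).
  apply (harm_affine D _ u); [exact Hu | ring | ring | ].
  intros p Hp. rewrite <- E. apply S, Hp.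
Qed.

Lemma harm_difference c r rho i h u :
  0 < rho -> Rabs h < rho -> harm (box c r) u ->
  harm (box c (r - 2 * rho)) (fun p => u (shift2 i h p) - u p).
Proof.
  intros Hrho Hh Hu.
  replace (fun p => u (shift2 i h p) - u p) with (fun p => 1 * u (shift2 i h p) + -1 * u p)
    by (apply functional_extensionality; intros p; ring).
  apply (harm_lin _ (fun p => u (shift2 i h p)) u).
  - apply (harm_shift2 (box c r)); [exact Hu | ]. intros p Hp.
    apply (shift2_box c r rho); [ | lra]. apply (box_subset c (r - 2 * rho)); [lra | exact Hp].
  - apply (harm_subset (box c r)); [ | exact Hu].
    intros p Hp. apply (box_subset c (r - 2 * rho)); [lra | exact Hp].
Qed.

(** * Finite differences of kernels with dominated boundary data *)

(** The list stands for a finitely supported signed measure, against which [f] is integrated.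
    Repeated points are allowed, so that differencing is mere concatenation. *)
Definition comb (l : list (R * pt)) (f : pt -> R) : R :=
  fold_right (fun a s => fst a * f (snd a) + s) 0 l.

Lemma comb_minus l f g : comb l (fun x => f x - g x) = comb l f - comb l g.
Proof. induction l as [ | a l IH]; simpl; [ring | rewrite IH; ring]. Qed.

Lemma comb_harm (D : pt -> Prop) (l : list (R * pt)) (K : pt -> pt -> R) :
  List.Forall (fun e => harm D (K (snd e))) l -> harm D (fun y => comb l (fun x => K x y)).
Proof.
  induction 1 as [ | a l Ha _ IH]; simpl.
  - apply harm_const.
  - replace (fun y => fst a * K (snd a) y + comb l (fun x => K x y))
      with (fun y => fst a * K (snd a) y + 1 * comb l (fun x => K x y))
      by (apply functional_extensionality; intros y; ring).
    apply (harm_lin D (K (snd a)) (fun y => comb l (fun x => K x y))); assumption.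
Qed.

Definition difference_list (i : nat) (h : R) (l : list (R * pt)) : list (R * pt) :=
  map (fun e => (fst e, shift2 i h (snd e))) l ++ map (fun e => (- fst e, snd e)) l.

Lemma comb_app l l' f : comb (l ++ l') f = comb l f + comb l' f.
Proof. induction l as [ | a l IH]; simpl; [ring | rewrite IH; ring]. Qed.

(** [difference_list] is the adjoint of the difference operator. This turns a difference of the
    kernel in its first point into another combination of the same kernel. *)
Lemma comb_difference_list i h l f :
  comb (difference_list i h l) f = comb l (fun x => f (shift2 i h x) - f x).
Proof.
  unfold difference_list. rewrite comb_app, comb_minus. unfold Rminus. f_equal.
  - induction l as [ | a l IH]; simpl; [reflexivity | rewrite IH; ring].
  - induction l as [ | a l IH]; simpl; [ring | rewrite IH; ring].
Qed.

(** [K x] depends on [x] only through the boundary data [s _ x], linearly and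
    with operator norm at most [kappa].  The class is stable under difference
    operators in either variable, which yields bounds on differences of every
    order without knowing beforehand that [K] is differentiable in [x]. *)
Definition dominated {T : Type} (s : T -> pt -> R) (a b : pt) (r kappa M : R)
  (K : pt -> pt -> R) : Prop :=
  (forall x, box a r x -> harm (box b r) (K x)) /\
  (forall t, harm (box a r) (s t)) /\
  (forall t x, box a r x -> Rabs (s t x) <= M) /\
  (forall l B y, 0 <= B -> List.Forall (fun e => box a r (snd e)) l ->
     (forall t, Rabs (comb l (s t)) <= B) -> box b r y ->
     Rabs (comb l (fun x => K x y)) <= kappa * B).

(** A difference in x is moved onto the list by adjointness. The data become differences of [s], and
    the gradient estimate in x puts the factor [Rabs h] into [M], with [kappa] unchanged. *)
Lemma dominated_difference_fst T (s : T -> pt -> R) a b r kappa M K rho i h :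
  0 < rho -> Rabs h < rho -> dominated s a b r kappa M K ->
  dominated (fun t x => s t (shift2 i h x) - s t x) a b (r - 2 * rho) kappa
    (2 * M / rho * Rabs h) (fun x y => K (shift2 i h x) y - K x y).
Proof.
  intros Hrho Hh (H1 & H2 & H3 & H4).
  assert (Sub : forall c p, box c (r - 2 * rho) p -> box c r p)
    by (intros c p; apply box_subset; lra).
  assert (Sh : forall c p, box c (r - 2 * rho) p -> box c r (shift2 i h p)).
  { intros c p Hp. apply (shift2_box c r rho); [ | lra].
    apply (box_subset c (r - 2 * rho)); [lra | exact Hp]. }
  split; [ | split; [ | split]].
  - intros x Hx.
    replace (fun y => K (shift2 i h x) y - K x y)
      with (fun y => 1 * K (shift2 i h x) y + -1 * K x y)
      by (apply functional_extensionality; intros y; ring).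
    apply (harm_lin _ (K (shift2 i h x)) (K x)); (apply (harm_subset (box b r)); [apply Sub | ]);
      apply H1; [apply Sh, Hx | apply Sub, Hx].
  - intros t. apply harm_difference; [exact Hrho | exact Hh | apply H2].
  - intros t x Hx. apply (harm_increment a r); auto.
  - intros l B y HB Hl Hs Hy.
    rewrite <- (comb_difference_list i h l (fun x => K x y)). apply H4; [exact HB | | | apply Sub, Hy].
    + unfold difference_list. apply List.Forall_app. rewrite List.Forall_map, List.Forall_map. simpl.
      split; revert Hl; apply List.Forall_impl; intros e He; auto.
    + intros t. rewrite comb_difference_list. apply Hs.
Qed.

(** A difference in y leaves the data alone. Each combination of the [K x] is harmonic in y and at
    most [kappa * B], so the gradient estimate in y puts the factor [Rabs h] into [kappa]. *)
Lemma dominated_difference_snd T (s : T -> pt -> R) a b r kappa M K rho i h :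
  0 < rho -> Rabs h < rho -> dominated s a b r kappa M K ->
  dominated s a b (r - 2 * rho) (2 * kappa / rho * Rabs h) M
    (fun x y => K x (shift2 i h y) - K x y).
Proof.
  intros Hrho Hh (H1 & H2 & H3 & H4).
  assert (Sub : forall c p, box c (r - 2 * rho) p -> box c r p)
    by (intros c p; apply box_subset; lra).
  split; [ | split; [ | split]].
  - intros x Hx. apply harm_difference; [exact Hrho | exact Hh | apply H1, Sub, Hx].
  - intros t. apply (harm_subset (box a r)); [apply Sub | apply H2].
  - intros t x Hx. apply H3, Sub, Hx.
  - intros l B y HB Hl Hs Hy.
    assert (Hl' : List.Forall (fun e => box a r (snd e)) l)
      by (revert Hl; apply List.Forall_impl; intros e He; apply Sub, He).
    rewrite (comb_minus l (fun x => K x (shift2 i h y)) (fun x => K x y)).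
    replace (2 * kappa / rho * Rabs h * B) with (2 * (kappa * B) / rho * Rabs h)
      by (field; lra).
    apply (harm_increment b r rho (fun y => comb l (fun x => K x y)) (kappa * B) i);
      [exact Hrho | | | exact Hy | exact Hh].
    + apply comb_harm. revert Hl'. apply List.Forall_impl. intros e He. apply H1, He.
    + intros q Hq. apply H4; assumption.
Qed.

(** * Iterated differences in four variables *)

Definition box4 (c : pt * pt) (r : R) (z : pt * pt) : Prop :=
  box (fst c) r (fst z) /\ box (snd c) r (snd z).

Definition shift (i : nat) (h : R) (z : pt * pt) : pt * pt :=
  match i with
  | O | 1%nat => (shift2 i h (fst z), snd z)
  | Datatypes.S (Datatypes.S j) => (fst z, shift2 j h (snd z))
  end.

Lemma upd4_shift z i h : upd4 z i (coord4 z i + h) = shift i h z.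
Proof. destruct z as [[x1 x2] [y1 y2]]. destruct i as [ | [ | [ | i]]]; reflexivity. Qed.

(** Only the base points are confined to the box of radius [r]; the shifted points may leave it. *)
Fixpoint differences_le (c : pt * pt) (rho r : R) (k : nat) (C : R) (f : pt * pt -> R) : Prop :=
  match k with
  | O => forall z, box4 c r z -> Rabs (f z) <= C
  | Datatypes.S k => forall i h, Rabs h < rho ->
      differences_le c rho r k (C * Rabs h) (fun z => f (shift i h z) - f z)
  end.

Lemma differences_le_weaken c rho r r' k : forall C C' f, r' <= r -> C <= C' ->
  differences_le c rho r k C f -> differences_le c rho r' k C' f.
Proof.
  induction k as [ | k IH]; intros C C' f Hr HC H; simpl in *.
  - intros z [Z1 Z2]. apply Rle_trans with C; [ | exact HC]. apply H.
    split; [apply (box_subset _ r'); assumption | apply (box_subset _ r'); assumption].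
  - intros i h Hh. apply (IH (C * Rabs h)); [exact Hr | | apply H, Hh].
    apply Rmult_le_compat_r; [apply Rabs_pos | exact HC].
Qed.

(** Each difference costs [2 * rho] of radius and a factor [2 / rho * Rabs h], which falls on [M] or
    on [kappa] according to the variable. Only their product enters the bound, so the two cases
    agree. The family [s] must be general in the induction because differences in x change it. *)
Lemma dominated_differences (k : nat) rho a b :
  0 < rho -> forall T (s : T -> pt -> R) r kappa M K, 0 <= M ->
  dominated s a b r kappa M K ->
  differences_le (a, b) rho (r - 2 * rho * INR k) k (kappa * M * (2 / rho) ^ k)
    (fun z => K (fst z) (snd z)).
Proof.
  intros Hrho. induction k as [ | k IH]; intros T s r kappa M K HM HK.
  - simpl. intros z [Z1 Z2]. destruct HK as (_ & _ & H3 & H4). simpl in *.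
    rewrite Rmult_0_r, Rminus_0_r in Z1, Z2.
    (* The one-point list of weight 1 turns domination of combinations into a bound on the kernel
       itself. *)
    specialize (H4 ((1, fst z) :: nil) M (snd z) HM).
    simpl in H4. rewrite Rmult_1_l, Rplus_0_r in H4. rewrite Rmult_1_r. apply H4.
    + constructor; [exact Z1 | constructor].
    + intros t. rewrite Rmult_1_l, Rplus_0_r. apply H3, Z1.
    + exact Z2.
  - intros i h Hh. rewrite S_INR.
    assert (Cx : forall j, differences_le (a, b) rho (r - 2 * rho * (INR k + 1)) k
              (kappa * M * (2 / rho) ^ Datatypes.S k * Rabs h)
              (fun z => K (shift2 j h (fst z)) (snd z) - K (fst z) (snd z))).
    { intros j.
      pose proof (IH T _ _ _ (2 * M / rho * Rabs h) _ ltac:(apply Rmult_le_pos; [apply Rdiv_le_0_compat; [apply Rmult_le_pos; [lra | exact HM] | exact Hrho] | apply Rabs_pos])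
        (dominated_difference_fst T s a b r kappa M K rho j h Hrho Hh HK)) as Q.
      revert Q. apply differences_le_weaken; [lra | right; simpl; field; lra]. }
    assert (Cy : forall j, differences_le (a, b) rho (r - 2 * rho * (INR k + 1)) k
              (kappa * M * (2 / rho) ^ Datatypes.S k * Rabs h)
              (fun z => K (fst z) (shift2 j h (snd z)) - K (fst z) (snd z))).
    { intros j.
      pose proof (IH T _ _ _ _ _ HM
        (dominated_difference_snd T s a b r kappa M K rho j h Hrho Hh HK)) as Q.
      revert Q. apply differences_le_weaken; [lra | right; simpl; field; lra]. }
    destruct i as [ | [ | i]]; [apply (Cx 0%nat) | apply (Cx 1%nat) | apply (Cy i)].
Qed.

Lemma shift2_comm i j h k p : shift2 i h (shift2 j k p) = shift2 j k (shift2 i h p).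
Proof. destruct i, j; simpl; f_equal; ring. Qed.

Lemma shift_comm i j h k z : shift i h (shift j k z) = shift j k (shift i h z).
Proof.
  destruct i as [ | [ | i]], j as [ | [ | j]]; simpl; try reflexivity;
    f_equal; apply (shift2_comm 0 0) || apply (shift2_comm 0 1) || apply (shift2_comm 1 0) ||
    apply (shift2_comm 1 1) || apply shift2_comm.
Qed.

Lemma shift_box4 c r rho i h z :
  box4 c (r - rho) z -> Rabs h <= rho -> box4 c r (shift i h z).
Proof.
  intros [Z1 Z2] Hh. assert (S : forall a p, box a (r - rho) p -> box a r p).
  { intros a p. apply box_subset. pose proof (Rabs_pos h). lra. }
  destruct i as [ | [ | i]]; split; simpl; (apply S; assumption) || idtac.
  - apply (shift2_box _ r rho 0); assumption.
  - apply (shift2_box _ r rho 1); assumption.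
  - apply (shift2_box _ r rho i); assumption.
Qed.

Lemma differences_le_shift c rho r j h' k : Rabs h' < rho -> forall C f,
  differences_le c rho r k C f ->
  differences_le c rho (r - rho) k C (fun z => f (shift j h' z)).
Proof.
  intros Hh'. induction k as [ | k IH]; intros C f H; simpl in *.
  - intros z Hz. apply H. apply (shift_box4 c r rho); [exact Hz | lra].
  - intros i h Hh. specialize (IH _ _ (H i h Hh)).
    replace (fun z => f (shift j h' (shift i h z)) - f (shift j h' z))
      with (fun z => f (shift i h (shift j h' z)) - f (shift j h' z)); [exact IH | ].
    apply functional_extensionality. intros z. rewrite shift_comm. reflexivity.
Qed.

Lemma differences_le_lin c rho r k a b : forall C C' f g,
  differences_le c rho r k C f -> differences_le c rho r k C' g ->
  differences_le c rho r k (Rabs a * C + Rabs b * C') (fun z => a * f z + b * g z).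
Proof.
  induction k as [ | k IH]; intros C C' f g F G; simpl in *.
  - intros z Hz. apply Rle_trans with (1 := Rabs_triang _ _). rewrite !Rabs_mult.
    apply Rplus_le_compat; apply Rmult_le_compat_l; auto using Rabs_pos.
  - intros i h Hh. specialize (IH _ _ _ _ (F i h Hh) (G i h Hh)).
    replace (fun z => a * f (shift i h z) + b * g (shift i h z) - (a * f z + b * g z))
      with (fun z => a * (f (shift i h z) - f z) + b * (g (shift i h z) - g z))
      by (apply functional_extensionality; intros z; ring).
    replace ((Rabs a * C + Rabs b * C') * Rabs h) with (Rabs a * (C * Rabs h) + Rabs b * (C' * Rabs h))
      by ring. exact IH.
Qed.

Lemma differences_le_zero c rho r k C : 0 <= C -> differences_le c rho r k C (fun _ => 0).
Proof.
  revert C. induction k as [ | k IH]; intros C HC; simpl.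
  - intros. rewrite Rabs_R0. exact HC.
  - intros i h _. rewrite Rminus_diag. apply IH. apply Rmult_le_pos; [exact HC | apply Rabs_pos].
Qed.

(** Moving both entries by [h] is done one entry at a time: f(p+h, p+h) - f(p, p) is the difference
    in the first entry based at (p, p+h) plus the difference in the second based at (p, p). Each
    order thus doubles the constant and costs [rho] for the displaced base point. A shift that does
    not move [pr] gives zero. *)
Lemma differences_le_diagonal (pr : pt * pt -> pt) c rho k :
  (forall s z, box4 c s z -> box (pr c) s (pr z)) ->
  (forall i, (forall h z, pr (shift i h z) = pr z) \/
     exists j, (j < 2)%nat /\ forall h z, pr (shift i h z) = shift2 j h (pr z)) ->
  0 < rho -> forall r C f, 0 <= C ->
  differences_le (pr c, pr c) rho r k C f ->
  differences_le c rho (r - rho * INR k) k (2 ^ k * C) (fun z => f (pr z, pr z)).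
Proof.
  intros Hb Hs Hrho. induction k as [ | k IH]; intros r C f HC H.
  - simpl in *. rewrite Rmult_0_r, Rminus_0_r, Rmult_1_l. intros z Hz. apply H.
    split; apply Hb, Hz.
  - intros i h Hh. rewrite S_INR.
    assert (HCh : 0 <= C * Rabs h) by (apply Rmult_le_pos; [exact HC | apply Rabs_pos]).
    destruct (Hs i) as [E | [j [Hj E]]].
    + replace (fun z => f (pr (shift i h z), pr (shift i h z)) - f (pr z, pr z))
        with (fun _ : pt * pt => 0)
        by (apply functional_extensionality; intros z; rewrite E; ring).
      apply differences_le_zero. pose proof (pow_lt 2 (Datatypes.S k)).
      rewrite Rmult_assoc. apply Rmult_le_pos; lra.
    + pose proof (IH _ _ _ HCh (H (2 + j)%nat h Hh)) as A.
      pose proof (IH _ _ _ HCh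
        (differences_le_shift _ _ _ (2 + j) h k Hh _ _ (H j h Hh))) as B.
      cbv beta in A, B.
      apply (fun Hr => differences_le_weaken _ _ _ (r - rho * (INR k + 1)) _ _ _ _ Hr (Rle_refl _))
        in A; [ | lra].
      apply (fun Hr => differences_le_weaken _ _ _ (r - rho * (INR k + 1)) _ _ _ _ Hr (Rle_refl _))
        in B; [ | lra].
      pose proof (differences_le_lin _ _ _ _ 1 1 _ _ _ _ A B) as D. cbv beta in D.
      rewrite Rabs_R1 in D.
      replace (2 ^ Datatypes.S k * C * Rabs h)
        with (1 * (2 ^ k * (C * Rabs h)) + 1 * (2 ^ k * (C * Rabs h))) by (simpl; ring).
      refine (eq_ind _ _ D _ _). apply functional_extensionality. intros z.
      rewrite !E. destruct j as [ | [ | j]]; [simpl; ring | simpl; ring | lia].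
Qed.

Lemma differences_le_diagonal_fst c rho r k C f : 0 < rho -> 0 <= C ->
  differences_le (fst c, fst c) rho r k C f ->
  differences_le c rho (r - rho * INR k) k (2 ^ k * C) (fun z => f (fst z, fst z)).
Proof.
  intros Hrho. apply (differences_le_diagonal fst); [ | | exact Hrho].
  - intros s z [H _]. exact H.
  - intros [ | [ | i]]; [right; exists 0%nat | right; exists 1%nat | left]; simpl;
      try split; try lia; reflexivity.
Qed.

Lemma differences_le_diagonal_snd c rho r k C f : 0 < rho -> 0 <= C ->
  differences_le (snd c, snd c) rho r k C f ->
  differences_le c rho (r - rho * INR k) k (2 ^ k * C) (fun z => f (snd z, snd z)).
Proof.
  intros Hrho. apply (differences_le_diagonal snd); [ | | exact Hrho].
  - intros s z [_ H]. exact H.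
  - intros [ | [ | [ | i]]]; [left | left | right; exists 0%nat | right; exists 1%nat]; simpl;
      try split; try lia; reflexivity.
Qed.

(** * Differentiability from bounds on finite differences *)

(** Passing from [m] to [m + 1] steps adds an error [C * (INR m * k) * k], which is absorbed by the
    growth of the square. *)
Lemma quasi_additive_multiple (a : R -> R) rho C k m :
  (forall h k, Rabs h < rho -> Rabs k < rho -> Rabs (a (h + k) - a h - a k) <= C * Rabs h * Rabs k) ->
  a 0 = 0 -> 0 <= C -> 0 < k -> INR m * k < rho -> k < rho ->
  Rabs (a (INR m * k) - INR m * a k) <= C * (INR m * k) ^ 2.
Proof.
  intros Q A0 HC Hk Hm Hkr. induction m as [ | m IH].
  - simpl. rewrite !Rmult_0_l, A0, Rminus_0_r, Rabs_R0. lra.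
  - rewrite S_INR in *. pose proof (pos_INR m) as Pm.
    assert (Pk : 0 <= INR m * k) by (apply Rmult_le_pos; lra).
    specialize (IH ltac:(lra)).
    pose proof (Q (INR m * k) k) as Qm. rewrite !Rabs_pos_eq in Qm by lra.
    specialize (Qm ltac:(lra) ltac:(lra)).
    replace ((INR m + 1) * k) with (INR m * k + k) in * by ring.
    replace (a (INR m * k + k) - (INR m + 1) * a k)
      with ((a (INR m * k + k) - a (INR m * k) - a k) + (a (INR m * k) - INR m * a k)) by ring.
    apply Rle_trans with (1 := Rabs_triang _ _).
    apply Rle_trans with (C * (INR m * k) * k + C * (INR m * k) ^ 2); [lra | ].
    assert (0 <= C * (INR m * k) * k) by (repeat apply Rmult_le_pos; lra).
    assert (0 <= C * (k * k)) by (repeat apply Rmult_le_pos; lra).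
    simpl. lra.
Qed.

(** Write h = m k + r with 0 <= r < k. The multiple m k and the splitting off of r each cost at most
    [C * h ^ 2]. The terms in r cost [2 * C1 * k] by the Lipschitz bound, and this disappears as k
    tends to 0 with h fixed. *)
Lemma quasi_additive_quotients (a : R -> R) rho C C1 h k :
  (forall h k, Rabs h < rho -> Rabs k < rho -> Rabs (a (h + k) - a h - a k) <= C * Rabs h * Rabs k) ->
  (forall h, Rabs h < rho -> Rabs (a h) <= C1 * Rabs h) ->
  a 0 = 0 -> 0 <= C -> 0 <= C1 -> 0 < k < h -> h < rho ->
  Rabs (a h - h * (a k / k)) <= 2 * C * h ^ 2 + 2 * C1 * k.
Proof.
  intros Q Lip A0 HC HC1 [Hk Hkh] Hh.
  destruct (nfloor_ex (h / k)) as [m [M1 M2]]; [apply Rdiv_le_0_compat; lra | ].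
  assert (M1' : INR m * k <= h).
  { apply Rmult_le_compat_r with (r := k) in M1; [ | lra].
    replace (h / k * k) with h in M1 by (field; lra). exact M1. }
  assert (M2' : h < INR m * k + k).
  { apply Rmult_lt_compat_r with (r := k) in M2; [ | lra].
    replace (h / k * k) with h in M2 by (field; lra). lra. }
  pose proof (pos_INR m) as Pm. set (r := h - INR m * k).
  assert (Pk : 0 <= INR m * k) by (apply Rmult_le_pos; lra).
  pose proof (quasi_additive_multiple a rho C k m Q A0 HC Hk ltac:(lra) ltac:(lra)) as E1.
  pose proof (Q (INR m * k) r) as E2. rewrite !Rabs_pos_eq in E2 by (unfold r; lra).
  specialize (E2 ltac:(lra) ltac:(unfold r; lra)).
  replace (INR m * k + r) with h in E2 by (unfold r; ring).
  pose proof (Lip r) as E3. rewrite (Rabs_pos_eq r) in E3 by (unfold r; lra).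
  specialize (E3 ltac:(unfold r; lra)).
  pose proof (Lip k) as E4. rewrite (Rabs_pos_eq k) in E4 by lra. specialize (E4 ltac:(lra)).
  assert (E5 : Rabs (r * (a k / k)) <= C1 * k).
  { rewrite Rabs_mult. unfold Rdiv. rewrite Rabs_mult, (Rabs_pos_eq r) by (unfold r; lra).
    rewrite (Rabs_pos_eq (/ k)) by (apply Rlt_le, Rinv_0_lt_compat, Hk).
    assert (Rabs (a k) * / k <= C1).
    { apply Rmult_le_reg_r with k; [exact Hk | ]. rewrite Rmult_assoc, Rinv_l; lra. }
    rewrite Rmult_comm. apply Rmult_le_compat; try (unfold r; lra).
    apply Rmult_le_pos; [apply Rabs_pos | apply Rlt_le, Rinv_0_lt_compat, Hk]. }
  replace (a h - h * (a k / k)) with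
    ((a h - a (INR m * k) - a r) + (a (INR m * k) - INR m * a k) + a r - r * (a k / k))
    by (unfold r; field; lra).
  assert (E6 : C * (INR m * k) * r <= C * h * h).
  { rewrite (Rmult_assoc C h h), (Rmult_assoc C). apply Rmult_le_compat_l; [exact HC | ].
    apply Rmult_le_compat; unfold r; lra. }
  assert (E7 : C * (INR m * k) ^ 2 <= C * h ^ 2).
  { apply Rmult_le_compat_l; [exact HC | ]. apply pow_incr. lra. }
  assert (E8 : C1 * r <= C1 * k) by (apply Rmult_le_compat_l; unfold r; lra).
  assert (E9 : C * h ^ 2 = C * h * h) by ring.
  unfold Rminus at 1.
  apply Rle_trans with (1 := Rabs_triang _ _). rewrite Rabs_Ropp.
  pose proof (Rabs_triang (a h - a (INR m * k) - a r + (a (INR m * k) - INR m * a k)) (a r)).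
  pose proof (Rabs_triang (a h - a (INR m * k) - a r) (a (INR m * k) - INR m * a k)).
  lra.
Qed.

(** The candidate derivative is a cluster point of the difference quotients;
    no completeness argument is needed since all quotients are close to it. *)
Lemma quasi_additive_linear (a : R -> R) rho C C1 :
  0 < rho ->
  (forall h k, Rabs h < rho -> Rabs k < rho -> Rabs (a (h + k) - a h - a k) <= C * Rabs h * Rabs k) ->
  (forall h, Rabs h < rho -> Rabs (a h) <= C1 * Rabs h) ->
  exists l, forall h, Rabs h < rho -> Rabs (a h - h * l) <= 3 * C * h ^ 2.
Proof.
  intros Hrho Q Lip.
  assert (A0 : a 0 = 0).
  { pose proof (Lip 0) as E. rewrite Rabs_R0, Rmult_0_r in E. specialize (E Hrho).
    pose proof (Rabs_pos (a 0)). destruct (Req_dec (a 0) 0) as [ | N]; [assumption | ].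
    pose proof (Rabs_pos_lt _ N). lra. }
  assert (H2 : Rabs (rho / 2) = rho / 2) by (apply Rabs_pos_eq; lra).
  assert (HC : 0 <= C).
  { pose proof (Q (rho / 2) (rho / 2)) as E. rewrite H2 in E. specialize (E ltac:(lra) ltac:(lra)).
    pose proof (Rabs_pos (a (rho / 2 + rho / 2) - a (rho / 2) - a (rho / 2))).
    apply Rmult_le_reg_r with (rho / 2 * (rho / 2)); [apply Rmult_lt_0_compat; lra | lra]. }
  assert (HC1 : 0 <= C1).
  { pose proof (Lip (rho / 2)) as E. rewrite H2 in E. specialize (E ltac:(lra)).
    pose proof (Rabs_pos (a (rho / 2))). apply Rmult_le_reg_r with (rho / 2); lra. }
  (* A null sequence of steps; the summand 2 keeps every step strictly below [rho]. *)
  set (k := fun n : nat => rho / (INR n + 2)).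
  assert (Hk : forall n, 0 < k n < rho).
  { intros n. unfold k. pose proof (pos_INR n). split; [apply Rdiv_lt_0_compat; lra | ].
    apply Rmult_lt_reg_r with (INR n + 2); [lra | ].
    replace (rho / (INR n + 2) * (INR n + 2)) with rho by (field; lra).
    assert (0 <= rho * INR n) by (apply Rmult_le_pos; lra). lra. }
  destruct (bounded_seq_cluster (fun n => a (k n) / k n) C1) as [l Hl].
  { intros n. destruct (Hk n) as [K1 K2]. unfold Rdiv. rewrite Rabs_mult.
    rewrite (Rabs_pos_eq (/ k n)) by (apply Rlt_le, Rinv_0_lt_compat, K1).
    pose proof (Lip (k n)) as E. rewrite (Rabs_pos_eq (k n)) in E by lra. specialize (E K2).
    apply Rmult_le_reg_r with (k n); [exact K1 | ]. rewrite Rmult_assoc, Rinv_l; lra. }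
  assert (Pos : forall h, 0 < h < rho -> Rabs (a h - h * l) <= 2 * C * h ^ 2).
  { intros h [Hh1 Hh2]. apply le_epsilon. intros e He.
    (* Steps below [e1] are smaller than [h] and make [2 * C1 * k n] at most [e / 2]; the other half
       of [e] pays for the distance from the quotient to its cluster value. *)
    set (e1 := Rmin h (e / (2 * (2 * C1 + 1)))).
    assert (He1 : 0 < e1) by (apply Rmin_glb_lt; [lra | apply Rdiv_lt_0_compat; lra]).
    destruct (INR_unbounded (rho / e1)) as [N HN].
    destruct (Hl (e / (2 * h)) N) as [n [Hn Ln]]; [apply Rdiv_lt_0_compat; lra | ].
    assert (Kn : k n < e1).
    { apply le_INR in Hn. unfold k. apply Rmult_lt_reg_r with (INR n + 2); [pose proof (pos_INR n); lra | ].
      replace (rho / (INR n + 2) * (INR n + 2)) with rho by (field; pose proof (pos_INR n); lra).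
      apply Rmult_lt_compat_r with (r := e1) in HN; [ | lra].
      replace (rho / e1 * e1) with rho in HN by (field; lra).
      assert (INR N * e1 <= INR n * e1) by (apply Rmult_le_compat_r; lra). lra. }
    pose proof (Rmin_l h (e / (2 * (2 * C1 + 1)))). pose proof (Rmin_r h (e / (2 * (2 * C1 + 1)))).
    fold e1 in H, H0.
    pose proof (quasi_additive_quotients a rho C C1 h (k n) Q Lip A0 HC HC1
      ltac:(split; [apply Hk | lra]) Hh2) as E.
    assert (E1 : 2 * C1 * k n <= e / 2).
    { apply Rle_trans with ((2 * C1 + 1) * (e / (2 * (2 * C1 + 1)))).
      - apply Rmult_le_compat; try lra. apply Rlt_le, Hk.
      - right. field. lra. }
    assert (E2 : Rabs (h * (a (k n) / k n) - h * l) <= e / 2).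
    { rewrite <- Rmult_minus_distr_l, Rabs_mult, (Rabs_pos_eq h) by lra.
      apply Rle_trans with (h * (e / (2 * h))); [apply Rmult_le_compat_l; lra | right; field; lra]. }
    replace (a h - h * l) with ((a h - h * (a (k n) / k n)) + (h * (a (k n) / k n) - h * l)) by ring.
    apply Rle_trans with (1 := Rabs_triang _ _). lra. }
  exists l. intros h Hh.
  assert (Ch : 0 <= C * h ^ 2) by (apply Rmult_le_pos; [exact HC | apply pow2_ge_0]).
  destruct (Rtotal_order h 0) as [Hn | [-> | Hp]].
  (* For negative [h], quasi-additivity at [h] and [- h] compares [a h] with [- a (- h)] up to
     [C * h ^ 2]. This raises the constant from 2 to 3. *)
  - rewrite Rabs_left in Hh by exact Hn.
    pose proof (Pos (- h) ltac:(lra)) as E1.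
    pose proof (Q h (- h)) as E2. rewrite Rabs_Ropp, Rplus_opp_r, A0, (Rabs_left h Hn) in E2.
    specialize (E2 Hh Hh).
    replace (a h - h * l) with (- (0 - a h - a (- h)) - (a (- h) - - h * l)) by ring.
    unfold Rminus at 1. apply Rle_trans with (1 := Rabs_triang _ _). rewrite !Rabs_Ropp.
    replace ((- h) ^ 2) with (h ^ 2) in E1 by ring. replace (C * - h * - h) with (C * h ^ 2) in E2 by ring.
    lra.
  - rewrite A0, Rmult_0_l, Rminus_0_r, Rabs_R0. lra.
  - rewrite Rabs_pos_eq in Hh by lra. pose proof (Pos h ltac:(lra)). lra.
Qed.

Lemma is_derive_of_quadratic_error (g : R -> R) x l rho K :
  0 < rho -> (forall h, Rabs h < rho -> Rabs (g (x + h) - g x - h * l) <= K * h ^ 2) ->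
  is_derive g x l.
Proof.
  intros Hrho H. apply is_derive_Reals. intros e He.
  assert (P : 0 < Rmin rho (e / (Rabs K + 1))).
  { apply Rmin_glb_lt; [exact Hrho | apply Rdiv_lt_0_compat; pose proof (Rabs_pos K); lra]. }
  exists (mkposreal _ P). simpl. intros h Hh0 Hh.
  pose proof (Rmin_l rho (e / (Rabs K + 1))). pose proof (Rmin_r rho (e / (Rabs K + 1))).
  specialize (H h ltac:(lra)).
  replace ((g (x + h) - g x) / h - l) with ((g (x + h) - g x - h * l) / h) by (field; exact Hh0).
  pose proof (Rabs_pos_lt h Hh0) as Ph. unfold Rdiv. rewrite Rabs_mult, Rabs_inv.
  apply Rmult_lt_reg_r with (Rabs h); [exact Ph | ]. rewrite Rmult_assoc, Rinv_l, Rmult_1_r by lra.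
  apply Rle_lt_trans with (1 := H). rewrite <- pow2_abs. pose proof (Rabs_pos K).
  pose proof (Rle_abs K).
  assert ((Rabs K + 1) * Rabs h < e).
  { apply Rmult_lt_reg_r with (/ (Rabs K + 1)); [apply Rinv_0_lt_compat; lra | ].
    replace ((Rabs K + 1) * Rabs h * / (Rabs K + 1)) with (Rabs h) by (field; lra).
    unfold Rdiv in *. lra. }
  simpl. rewrite Rmult_1_r, <- Rmult_assoc. apply Rmult_lt_compat_r; [exact Ph | ].
  apply Rle_lt_trans with (2 := H4). apply Rmult_le_compat_r; lra.
Qed.

Lemma coord4_upd4 z i t : coord4 (upd4 z i t) i = t.
Proof. destruct i as [ | [ | [ | i]]]; reflexivity. Qed.

Lemma upd4_coord4 z i : upd4 z i (coord4 z i) = z.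
Proof. destruct z as [[? ?] [? ?]]. destruct i as [ | [ | [ | i]]]; reflexivity. Qed.

Lemma upd4_upd4 z i s t : upd4 (upd4 z i s) i t = upd4 z i t.
Proof. destruct i as [ | [ | [ | i]]]; reflexivity. Qed.

Lemma shift_plus i h k z : shift i h (shift i k z) = shift i (h + k) z.
Proof.
  rewrite <- !upd4_shift, upd4_upd4, coord4_upd4. f_equal. ring.
Qed.

(** For the increment in the variable [i], the bound on second differences is quasi-additivity and
    the bound on first differences is the Lipschitz condition. *)
Lemma differences_derive c rho r C1 C2 f i z :
  0 < rho -> differences_le c rho r 1 C1 f -> differences_le c rho r 2 C2 f -> box4 c r z ->
  is_derive (fun t => f (upd4 z i t)) (coord4 z i) (part4 f i z) /\
  forall h, Rabs h < rho -> Rabs (f (shift i h z) - f z - h * part4 f i z) <= 3 * C2 * h ^ 2.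
Proof.
  intros Hrho F1 F2 Hz.
  assert (S0 : shift i 0 z = z).
  { rewrite <- upd4_shift, Rplus_0_r. apply upd4_coord4. }
  destruct (quasi_additive_linear (fun h => f (shift i h z) - f z) rho C2 C1 Hrho) as [l Hl].
  - intros h k Hh Hk. pose proof (F2 i h Hh i k Hk z Hz) as E. cbv beta in E.
    rewrite shift_plus in E.
    replace (f (shift i (h + k) z) - f z - (f (shift i h z) - f z) - (f (shift i k z) - f z))
      with (f (shift i (h + k) z) - f (shift i k z) - (f (shift i h z) - f z)) by ring.
    exact E.
  - intros h Hh. exact (F1 i h Hh z Hz).
  - assert (Dl : is_derive (fun t => f (upd4 z i t)) (coord4 z i) l).
    { apply (is_derive_of_quadratic_error _ _ _ rho (3 * C2) Hrho). intros h Hh.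
      rewrite upd4_shift, upd4_coord4. exact (Hl h Hh). }
    assert (El : part4 f i z = l) by exact (is_derive_unique _ _ _ Dl).
    rewrite El. split; [exact Dl | exact Hl].
Qed.

(** A difference of order [k] based in the box of radius [r] samples points up to [INR k * rho]
    further out, hence the larger box of convergence. *)
Lemma differences_le_lim c rho k : forall r C (fn : nat -> pt * pt -> R) (g : pt * pt -> R),
  (forall z, box4 c (r + INR k * rho) z -> is_lim_seq (fun n => fn n z) (g z)) ->
  (forall n, differences_le c rho r k C (fn n)) -> differences_le c rho r k C g.
Proof.
  induction k as [ | k IH]; intros r C fn g L H; simpl in *.
  - intros z Hz. rewrite Rmult_0_l, Rplus_0_r in L.
    apply (is_lim_seq_le (fun n => Rabs (fn n z)) (fun _ => C) (Rabs (g z)) C).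
    + intros n. apply H, Hz.
    + apply (is_lim_seq_abs (fun n => fn n z) (g z)). apply L, Hz.
    + apply is_lim_seq_const.
  - intros i h Hh. apply (IH r (C * Rabs h) (fun n z => fn n (shift i h z) - fn n z)).
    + intros z Hz. change (match k with O => 1 | Datatypes.S _ => INR k + 1 end)
        with (INR (Datatypes.S k)) in L. rewrite S_INR in L.
      apply is_lim_seq_minus'; apply L.
      * apply (shift_box4 _ _ rho); [ | lra].
        replace (r + (INR k + 1) * rho - rho) with (r + INR k * rho) by ring. exact Hz.
      * pose proof (Rabs_pos h). destruct Hz. split; eapply box_subset; try eassumption; lra.
    + intros n. apply H, Hh.
Qed.

(** The partial derivative is a limit of first differences divided by their step. Differences of
    order [k] of such a quotient are differences of order [k + 1] of [f], and the division cancels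
    the factor [Rabs h] of the first step. *)
Lemma differences_le_partial c rho r C1 C2 C k f i :
  0 < rho -> differences_le c rho r 1 C1 f -> differences_le c rho r 2 C2 f ->
  differences_le c rho r (Datatypes.S k) C f ->
  differences_le c rho (r - INR k * rho) k C (part4 f i).
Proof.
  intros Hrho F1 F2 F.
  set (h := fun n : nat => rho / (INR n + 2)).
  assert (Hh : forall n, 0 < h n < rho).
  { intros n. unfold h. pose proof (pos_INR n). split; [apply Rdiv_lt_0_compat; lra | ].
    apply Rmult_lt_reg_r with (INR n + 2); [lra | ].
    replace (rho / (INR n + 2) * (INR n + 2)) with rho by (field; lra).
    assert (0 <= rho * INR n) by (apply Rmult_le_pos; lra). lra. }
  assert (Lh : is_lim_seq h 0).
  { apply (is_lim_seq_le_le (fun _ => 0) h (fun n => rho * / (INR (n + 1)))).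
    - intros n. pose proof (pos_INR n). split; [apply Rlt_le, Hh | ].
      unfold h, Rdiv. apply Rmult_le_compat_l; [lra | ]. rewrite plus_INR. simpl.
      apply Rinv_le_contravar; lra.
    - apply is_lim_seq_const.
    - replace (Finite 0) with (Rbar_mult rho 0) by (simpl; f_equal; ring).
      apply is_lim_seq_scal_l. apply (is_lim_seq_incr_n (fun n => / INR n) 1).
      replace (Finite 0) with (Rbar_inv p_infty) by reflexivity.
      apply is_lim_seq_inv; [apply is_lim_seq_INR | discriminate]. }
  (* The summand with coefficient 0 only gives the quotient the two-term shape of
     [differences_le_lin]. *)
  apply (differences_le_lim c rho k _ C
    (fun n z => / h n * (f (shift i (h n) z) - f z) + 0 * (f (shift i (h n) z) - f z))).
  - intros z Hz. replace (r - INR k * rho + INR k * rho) with r in Hz by ring.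
    destruct (differences_derive c rho r C1 C2 f i z Hrho F1 F2 Hz) as [_ E].
    apply (is_lim_seq_le_le
      (fun n => part4 f i z - 3 * C2 * h n) _ (fun n => part4 f i z + 3 * C2 * h n)).
    + intros n. destruct (Hh n) as [H0 H1].
      specialize (E (h n) ltac:(rewrite Rabs_pos_eq; lra)).
      apply Rabs_le_between in E. rewrite Rmult_0_l, Rplus_0_r.
      set (q := f (shift i (h n) z) - f z) in *.
      replace (/ h n * q) with (part4 f i z + / h n * (q - h n * part4 f i z)) by (field; lra).
      assert (Ih : 0 < / h n) by (apply Rinv_0_lt_compat, H0).
      assert (U : / h n * (q - h n * part4 f i z) <= / h n * (3 * C2 * h n ^ 2))
        by (apply Rmult_le_compat_l; lra).
      assert (V : / h n * (- (3 * C2 * h n ^ 2)) <= / h n * (q - h n * part4 f i z))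
        by (apply Rmult_le_compat_l; lra).
      replace (/ h n * (3 * C2 * h n ^ 2)) with (3 * C2 * h n) in U by (field; lra).
      replace (/ h n * (- (3 * C2 * h n ^ 2))) with (- (3 * C2 * h n)) in V by (field; lra).
      lra.
    + replace (Finite (part4 f i z)) with (Finite (part4 f i z - 3 * C2 * 0)) by (f_equal; ring).
      apply is_lim_seq_minus'; [apply is_lim_seq_const | ].
      apply (is_lim_seq_scal_l h (3 * C2) 0 Lh).
    + replace (Finite (part4 f i z)) with (Finite (part4 f i z + 3 * C2 * 0)) by (f_equal; ring).
      apply is_lim_seq_plus'; [apply is_lim_seq_const | ].
      apply (is_lim_seq_scal_l h (3 * C2) 0 Lh).
  - intros n. destruct (Hh n) as [H0 H1].
    pose proof (F i (h n) ltac:(rewrite Rabs_pos_eq; lra)) as G.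
    pose proof (differences_le_lin _ _ _ _ (/ h n) 0 _ _ _ _ G G) as G'. cbv beta in G'.
    revert G'. apply differences_le_weaken.
    + pose proof (pos_INR k). assert (0 <= INR k * rho) by (apply Rmult_le_pos; lra). lra.
    + rewrite Rabs_R0, (Rabs_pos_eq (h n)), (Rabs_pos_eq (/ h n)) by
        (try apply Rlt_le, Rinv_0_lt_compat; lra).
      right. field. lra.
Qed.

(** A finite-difference substitute for bounded C^{2,1} norm, with one constant for the function and
    for its differences up to order three. *)
Definition smooth3 (c : pt * pt) (rho r C : R) (f : pt * pt -> R) : Prop :=
  forall k, (k <= 3)%nat -> differences_le c rho r k C f.

Lemma smooth3_lin c rho r C C' f g a b :
  smooth3 c rho r C f -> smooth3 c rho r C' g ->
  smooth3 c rho r (Rabs a * C + Rabs b * C') (fun z => a * f z + b * g z).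
Proof. intros F G k Hk. apply differences_le_lin; [apply F, Hk | apply G, Hk]. Qed.

Lemma smooth3_weaken c rho r r' C C' f : r' <= r -> C <= C' ->
  smooth3 c rho r C f -> smooth3 c rho r' C' f.
Proof. intros Hr HC F k Hk. apply (differences_le_weaken c rho r r' k C); auto. Qed.

Lemma smooth3_derive c rho r C f i z : 0 < rho -> smooth3 c rho r C f ->
  box4 c r z ->
  is_derive (fun t => f (upd4 z i t)) (coord4 z i) (part4 f i z).
Proof.
  intros Hrho Hf Hz. apply (differences_derive c rho r C C f i z Hrho); [ | | exact Hz]; apply Hf; lia.
Qed.

Lemma smooth3_part4_le c rho r C f i z : 0 < rho -> smooth3 c rho r C f ->
  box4 c r z -> Rabs (part4 f i z) <= C.
Proof.
  intros Hrho Hf Hz.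
  pose proof (differences_le_partial c rho r C C C 0 f i Hrho (Hf 1%nat ltac:(lia)) (Hf 2%nat ltac:(lia))
    (Hf 1%nat ltac:(lia))) as E. simpl in E. rewrite Rmult_0_l, Rminus_0_r in E. apply E, Hz.
Qed.

Lemma smooth3_part4_differences c rho r C f j : 0 < rho -> smooth3 c rho r C f ->
  differences_le c rho (r - 2 * rho) 1 C (part4 f j) /\
  differences_le c rho (r - 2 * rho) 2 C (part4 f j).
Proof.
  intros Hrho Hf. split.
  - pose proof (differences_le_partial c rho r C C C 1 f j Hrho (Hf 1%nat ltac:(lia)) (Hf 2%nat ltac:(lia))
      (Hf 2%nat ltac:(lia))) as E. revert E. apply differences_le_weaken; simpl; lra.
  - pose proof (differences_le_partial c rho r C C C 2 f j Hrho (Hf 1%nat ltac:(lia)) (Hf 2%nat ltac:(lia))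
      (Hf 3%nat ltac:(lia))) as E. revert E. apply differences_le_weaken; simpl; lra.
Qed.

Lemma smooth3_derive2 c rho r C f i j z : 0 < rho -> smooth3 c rho r C f ->
  box4 c (r - 2 * rho) z ->
  is_derive (fun t => part4 f j (upd4 z i t)) (coord4 z i) (part4 (part4 f j) i z).
Proof.
  intros Hrho Hf Hz. destruct (smooth3_part4_differences c rho r C f j Hrho Hf) as [E1 E2].
  apply (differences_derive c rho (r - 2 * rho) C C (part4 f j) i z Hrho E1 E2 Hz).
Qed.

Lemma smooth3_part4_part4_le c rho r C f i j z : 0 < rho -> smooth3 c rho r C f ->
  box4 c (r - 2 * rho) z -> Rabs (part4 (part4 f j) i z) <= C.
Proof.
  intros Hrho Hf Hz. destruct (smooth3_part4_differences c rho r C f j Hrho Hf) as [E1 E2].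
  pose proof (differences_le_partial c rho (r - 2 * rho) C C C 0 (part4 f j) i Hrho E1 E2 E1) as E.
  simpl in E. rewrite Rmult_0_l, Rminus_0_r in E. apply E, Hz.
Qed.

Lemma smooth3_part4_part4_lipschitz c rho r C f i j l h z : 0 < rho -> smooth3 c rho r C f ->
  box4 c (r - 3 * rho) z -> Rabs h < rho ->
  Rabs (part4 (part4 f j) i (shift l h z) - part4 (part4 f j) i z) <= C * Rabs h.
Proof.
  intros Hrho Hf Hz Hh. destruct (smooth3_part4_differences c rho r C f j Hrho Hf) as [E1 E2].
  pose proof (differences_le_partial c rho (r - 2 * rho) C C C 1 (part4 f j) i Hrho E1 E2 E2) as E.
  refine (E l h Hh z _). simpl. rewrite Rmult_1_l.
  replace (r - 2 * rho - rho) with (r - 3 * rho) by ring. exact Hz.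
Qed.

(** * Regular parts on a domain and on the punctured domain *)

Lemma S_sym x y : S x y = S y x.
Proof. unfold S. rewrite dist2_sym. reflexivity. Qed.

Lemma dist2_self p : dist2 p p = 0.
Proof.
  unfold dist2. replace ((fst p - fst p) ^ 2 + (snd p - snd p) ^ 2) with 0 by ring. apply sqrt_0.
Qed.

(* At [x = y] both sides vanish because [ln 0 = 0]. *)
Lemma S_ln_sqr x y :
  S x y = - (1 / (4 * PI)) * ln ((fst x - fst y) ^ 2 + (snd x - snd y) ^ 2).
Proof.
  unfold S. pose proof PI_RGT_0 as HPI.
  destruct (classic (x = y)) as [-> | N].
  - rewrite dist2_self.
    replace ((fst y - fst y) ^ 2 + (snd y - snd y) ^ 2) with 0 by ring.
    assert (Z : ln 0 = 0). { unfold ln. destruct (Rlt_dec 0 0); [exfalso; lra | reflexivity]. }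
    rewrite Z. ring.
  - apply dist2_pos_neq in N. rewrite <- dist2_sqr, ln_mult by exact N. field. lra.
Qed.

Lemma sqr_dist_pos x y : x <> y -> 0 < (fst x - fst y) ^ 2 + (snd x - snd y) ^ 2.
Proof.
  intros N. apply dist2_pos_neq in N. rewrite <- dist2_sqr. apply Rmult_lt_0_compat; exact N.
Qed.

(** [S1] and [S2] form the gradient of [S x] at [y]. The squared distance makes them rational
    functions, within reach of [field]. *)
Definition S1 (x y : pt) : R :=
  - (1 / (2 * PI)) * ((fst y - fst x) / ((fst x - fst y) ^ 2 + (snd x - snd y) ^ 2)).
Definition S2 (x y : pt) : R :=
  - (1 / (2 * PI)) * ((snd y - snd x) / ((fst x - fst y) ^ 2 + (snd x - snd y) ^ 2)).

Lemma S_derive_fst x y : x <> y -> is_derive (fun t => S x (t, snd y)) (fst y) (S1 x y).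
Proof.
  intros N. apply sqr_dist_pos in N. pose proof PI_RGT_0.
  apply (is_derive_ext (fun t => - (1 / (4 * PI)) * ln ((fst x - t) ^ 2 + (snd x - snd y) ^ 2))).
  { intros t. rewrite S_ln_sqr. reflexivity. }
  auto_derive; [simpl in *; lra | ]. unfold S1. field. simpl in *. lra.
Qed.

Lemma S_derive_snd x y : x <> y -> is_derive (fun t => S x (fst y, t)) (snd y) (S2 x y).
Proof.
  intros N. apply sqr_dist_pos in N. pose proof PI_RGT_0.
  apply (is_derive_ext (fun t => - (1 / (4 * PI)) * ln ((fst x - fst y) ^ 2 + (snd x - t) ^ 2))).
  { intros t. rewrite S_ln_sqr. reflexivity. }
  auto_derive; [simpl in *; lra | ]. unfold S2. field. simpl in *. lra.
Qed.

Lemma S_continuous x y : x <> y -> continuous (S x) y.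
Proof.
  intros N. apply sqr_dist_pos in N.
  replace (S x) with (fun y : pt => - (1 / (4 * PI)) * ln ((fst x - fst y) ^ 2 + (snd x - snd y) ^ 2))
    by (apply functional_extensionality; intros q; symmetry; apply S_ln_sqr).
  apply (continuous_mult (K := R_AbsRing)); [apply continuous_const | ].
  apply (continuous_comp (fun y : pt => (fst x - fst y) ^ 2 + (snd x - snd y) ^ 2) ln).
  - continuous_polynomial.
  - apply continuity_pt_filterlim. apply derivable_continuous_pt.
    exists (/ ((fst x - fst y) ^ 2 + (snd x - snd y) ^ 2)). apply derivable_pt_lim_ln, N.
Qed.

Lemma S_harm x D : (forall y, D y -> x <> y) -> harm D (S x).
Proof.
  intros HD.
  set (q := fun y : pt => (fst x - fst y) ^ 2 + (snd x - snd y) ^ 2).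
  exists (S1 x), (S2 x),
    (fun y => - (1 / (2 * PI)) * ((q y - 2 * (fst y - fst x) ^ 2) / q y ^ 2)),
    (fun y => - (1 / (2 * PI)) * ((q y - 2 * (snd y - snd x) ^ 2) / q y ^ 2)).
  intros y Hy. specialize (HD y Hy).
  assert (Q := sqr_dist_pos _ _ HD). pose proof PI_RGT_0.
  split6.
  - apply S_continuous, HD.
  - apply S_derive_fst, HD.
  - apply S_derive_snd, HD.
  - unfold S1, q. simpl in *. auto_derive; [lra | ]. field. lra.
  - unfold S2, q. simpl in *. auto_derive; [lra | ]. field. lra.
  - unfold q. simpl in *. field. lra.
Qed.

Lemma S_bound x z d R0 : 0 < d -> d <= dist2 x z <= R0 ->
  Rabs (S x z) <= 1 / (2 * PI) * (Rabs (ln d) + Rabs (ln R0)).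
Proof.
  intros Hd [H1 H2]. pose proof PI_RGT_0. unfold S.
  assert (K : 0 < 1 / (2 * PI)) by (apply Rdiv_lt_0_compat; lra).
  rewrite Rabs_mult, Rabs_Ropp, (Rabs_pos_eq (1 / (2 * PI))) by lra.
  apply Rmult_le_compat_l; [lra | ].
  assert (A : ln d <= ln (dist2 x z)) by (apply ln_le; lra).
  assert (B : ln (dist2 x z) <= ln R0) by (apply ln_le; lra).
  pose proof (Rle_abs (ln R0)). pose proof (Rle_abs (- ln d)). rewrite Rabs_Ropp in *.
  pose proof (Rabs_pos (ln R0)). pose proof (Rabs_pos (ln d)).
  apply Rabs_le. lra.
Qed.

Lemma comb_boundary_limit D H l y0 : green_regular_part D H -> bdry D y0 ->
  List.Forall (fun e : R * pt => D (snd e)) l ->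
  forall e, 0 < e -> exists d, 0 < d /\ forall y, D y -> dist2 y y0 < d ->
    Rabs (comb l (fun x => H x y) - comb l (fun x => S x y0)) < e.
Proof.
  intros G Hy0. induction 1 as [ | [a x] l Hx _ IH]; intros e He; simpl.
  - exists 1. split; [lra | ]. intros y _ _. rewrite Rminus_diag, Rabs_R0. exact He.
  - destruct (IH (e / 2)) as [d1 [Hd1 K1]]; [lra | ].
    destruct (G x Hx) as [_ G2].
    destruct (G2 y0 Hy0 (e / (2 * (Rabs a + 1)))) as [d2 [Hd2 K2]].
    { apply Rdiv_lt_0_compat; pose proof (Rabs_pos a); lra. }
    exists (Rmin d1 d2). split; [apply Rmin_glb_lt; assumption | ]. intros y Hy Hd.
    pose proof (Rmin_l d1 d2). pose proof (Rmin_r d1 d2).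
    specialize (K1 y Hy ltac:(lra)). specialize (K2 y Hy ltac:(lra)).
    replace (a * H x y + comb l (fun x => H x y) - (a * S x y0 + comb l (fun x => S x y0)))
      with (a * (H x y - S x y0) + (comb l (fun x => H x y) - comb l (fun x => S x y0))) by ring.
    apply Rle_lt_trans with (1 := Rabs_triang _ _). rewrite Rabs_mult.
    assert (Rabs a * Rabs (H x y - S x y0) <= e / 2); [ | lra].
    apply Rle_trans with ((Rabs a + 1) * (e / (2 * (Rabs a + 1)))).
    + pose proof (Rabs_pos a). apply Rmult_le_compat; try lra. apply Rabs_pos.
    + right. field. pose proof (Rabs_pos a). lra.
Qed.

Lemma comb_regular_part_harm D H l : green_regular_part D H ->
  List.Forall (fun e : R * pt => D (snd e)) l -> harm D (fun y => comb l (fun x => H x y)).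
Proof.
  intros G Hl. apply comb_harm. revert Hl. apply List.Forall_impl. intros e He.
  apply harm_of_harmonic_on, G, He.
Qed.

(** The maximum principle applied to the combination and to its negative. The points of the list
    enter only through their boundary data, which is what replaces regularity in x. *)
Lemma comb_regular_part_bound D H l B : open2 D -> bounded2 D -> green_regular_part D H ->
  List.Forall (fun e : R * pt => D (snd e)) l ->
  (forall z, bdry D z -> Rabs (comb l (fun x => S x z)) <= B) ->
  forall y, D y -> Rabs (comb l (fun x => H x y)) <= B.
Proof.
  intros O Bd G Hl HB y Hy.
  (* The summand [0 * 0] gives the function the form required by [harm_lin]. *)
  assert (K : forall s, s = 1 \/ s = - 1 -> forall p, D p ->
    s * comb l (fun x => H x p) + 0 * 0 <= B).
  { intros s Hs. apply max_principle; [exact O | exact Bd | | ].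
    - apply (harm_lin D _ (fun _ => 0)); [ | apply harm_const].
      apply comb_regular_part_harm; assumption.
    - intros y0 Hy0 e He.
      destruct (comb_boundary_limit D H l y0 G Hy0 Hl e He) as [d [Hd L]].
      exists d. split; [exact Hd | ]. intros q Hq Hqd. specialize (L q Hq Hqd).
      specialize (HB y0 Hy0). apply Rabs_le_between in HB. apply Rabs_def2 in L.
      destruct Hs as [-> | ->]; lra. }
  pose proof (K 1 (or_introl eq_refl) y Hy). pose proof (K (- 1) (or_intror eq_refl) y Hy).
  apply Rabs_le. lra.
Qed.

(** * Comparison with the punctured domain *)

Lemma punctured_open Om P eps : open2 Om -> open2 (punctured Om P eps).
Proof.
  intros O p [Hp1 Hp2]. destruct (O p Hp1) as [r [Hr H]].
  exists (Rmin r (dist2 P p - eps)). split; [apply Rmin_glb_lt; lra | ].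
  intros q Hq. pose proof (Rmin_l r (dist2 P p - eps)). pose proof (Rmin_r r (dist2 P p - eps)).
  split; [apply H; lra | ]. pose proof (dist2_triangle P q p).
  rewrite (dist2_sym q p) in *. lra.
Qed.

Lemma punctured_bounded Om P eps : bounded2 Om -> bounded2 (punctured Om P eps).
Proof. intros [M H]. exists M. intros p [Hp _]. apply H, Hp. Qed.

Lemma punctured_bdry Om P eps z : bdry (punctured Om P eps) z ->
  bdry Om z \/ (Om z /\ dist2 P z = eps).
Proof.
  intros [H1 H2]. destruct (classic (Om z)) as [Hz | Hz].
  - right. split; [exact Hz | ]. apply Rle_antisym.
    + apply Rnot_lt_le. intros L. apply H2. split; assumption.
    + apply Rnot_lt_le. intros L. destruct (H1 (eps - dist2 P z)) as [q [[_ Q1] Q2]]; [lra | ].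
      pose proof (dist2_triangle P z q). lra.
  - left. split; [ | exact Hz]. intros r Hr. destruct (H1 r Hr) as [q [[Q1 _] Q2]].
    exists q. split; assumption.
Qed.

Definition barrier (P : pt) (R0 eps : R) (y : pt) : R :=
  (ln R0 - ln (dist2 P y)) / (ln R0 - ln eps).

Lemma barrier_harm P R0 eps D : 0 < eps < R0 -> (forall y, D y -> P <> y) ->
  harm D (barrier P R0 eps).
Proof.
  intros [He HR] HD. pose proof (ln_increasing eps R0 He HR) as L. pose proof PI_RGT_0.
  replace (barrier P R0 eps) with
    (fun y => / (ln R0 - ln eps) * ln R0 + (2 * PI / (ln R0 - ln eps)) * S P y).
  - apply (harm_lin D (fun _ => ln R0) (S P)); [apply harm_const | apply S_harm, HD].
  - apply functional_extensionality. intros y. unfold barrier, S. field. lra.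
Qed.

(** At the outer boundary both combinations tend to the same data, so their difference tends to 0
    while the barrier is nonnegative. On the circle the one for [He] is at most [B] by its data and
    the one for [H] is at most [B] by the maximum principle in [Om], whence the factor 2 in front of
    a barrier equal to 1. *)
Lemma comb_punctured_bound Om P eps R0 H He l B :
  open2 Om -> bounded2 Om -> (forall p, Om p -> dist2 P p < R0) -> 0 < eps < R0 ->
  green_regular_part Om H -> green_regular_part (punctured Om P eps) He ->
  List.Forall (fun e : R * pt => punctured Om P eps (snd e)) l -> 0 <= B ->
  (forall z, bdry Om z \/ dist2 P z = eps -> Rabs (comb l (fun x => S x z)) <= B) ->
  forall y, punctured Om P eps y ->
  Rabs (comb l (fun x => He x y - H x y)) <= 2 * B * barrier P R0 eps y.
Proof.
  intros O Bd HR Heps G Ge Hl B0 HB y Hy.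
  assert (Hl' : List.Forall (fun e : R * pt => Om (snd e)) l).
  { revert Hl. apply List.Forall_impl. intros e E. apply E. }
  pose proof (ln_increasing eps R0 ltac:(lra) ltac:(lra)) as Ln.
  set (D := punctured Om P eps) in *.
  assert (Bpos : forall p, D p -> 0 <= barrier P R0 eps p).
  { intros p [P1 P2]. apply Rdiv_le_0_compat; [ | lra].
    assert (ln (dist2 P p) <= ln R0); [ | lra]. apply ln_le; [lra | ]. apply Rlt_le, HR, P1. }
  assert (NP : forall p, eps <= dist2 P p -> P <> p).
  { intros p Hp <-. rewrite dist2_self in Hp. lra. }
  assert (K : forall s, s = 1 \/ s = - 1 -> forall p, D p ->
    s * (1 * comb l (fun x => He x p) + -1 * comb l (fun x => H x p))
      + (- (2 * B)) * barrier P R0 eps p <= 0).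
  { intros s Hs. apply max_principle.
    - apply punctured_open, O.
    - apply punctured_bounded, Bd.
    - apply (harm_lin D (fun p => 1 * comb l (fun x => He x p) + -1 * comb l (fun x => H x p))).
      + apply (harm_lin D (fun p => comb l (fun x => He x p)) (fun p => comb l (fun x => H x p))).
        * apply comb_regular_part_harm; assumption.
        * apply (harm_subset Om); [intros p Hp; apply Hp | apply comb_regular_part_harm; assumption].
      + apply barrier_harm; [exact Heps | ]. intros p [_ Hp]. apply NP. lra.
    - intros y0 Hy0 e He0.
      destruct (comb_boundary_limit D He l y0 Ge Hy0 Hl (e / 3) ltac:(lra)) as [d1 [Hd1 K1]].
      destruct (punctured_bdry Om P eps y0 Hy0) as [By | [Oy Ey]].
      + destruct (comb_boundary_limit Om H l y0 G By Hl' (e / 3) ltac:(lra)) as [d2 [Hd2 K2]].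
        exists (Rmin d1 d2). split; [apply Rmin_glb_lt; assumption | ]. intros q Hq Hqd.
        pose proof (Rmin_l d1 d2). pose proof (Rmin_r d1 d2).
        specialize (K1 q Hq ltac:(lra)). specialize (K2 q (proj1 Hq) ltac:(lra)).
        apply Rabs_def2 in K1. apply Rabs_def2 in K2.
        pose proof (Rmult_le_pos (2 * B) _ ltac:(lra) (Bpos q Hq)).
        destruct Hs as [-> | ->]; lra.
      + destruct (comb_regular_part_harm Om H l G Hl') as (ux & uy & uxx & uyy & Hc).
        destruct (Hc y0 Oy) as [Cy _]. clear Hc.
        destruct (proj1 (continuous_box _ _) Cy (e / 3) ltac:(lra)) as [d2 [Hd2 K2]].
        destruct (barrier_harm P R0 eps (fun q => P <> q) Heps ltac:(auto)) as (vx & vy & vxx & vyy & Hc).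
        destruct (Hc y0 (NP y0 ltac:(lra))) as [Cb _]. clear Hc.
        (* After multiplication by [2 * B] this tolerance is at most [e / 3], the third share of
           [e]; the summand 1 covers [B = 0]. *)
        destruct (proj1 (continuous_box _ _) Cb (e / (3 * (2 * B + 1)))) as [d3 [Hd3 K3]].
        { apply Rdiv_lt_0_compat; lra. }
        assert (B1 : barrier P R0 eps y0 = 1) by (unfold barrier; rewrite Ey; field; lra).
        pose proof (comb_regular_part_bound Om H l B O Bd G Hl' ltac:(auto) y0 Oy) as A1.
        pose proof (HB y0 (or_intror Ey)) as A2.
        apply Rabs_le_between in A1. apply Rabs_le_between in A2.
        exists (Rmin d1 (Rmin d2 d3)). split; [repeat apply Rmin_glb_lt; assumption | ].
        intros q Hq Hqd.
        pose proof (Rmin_l d1 (Rmin d2 d3)). pose proof (Rmin_r d1 (Rmin d2 d3)).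
        pose proof (Rmin_l d2 d3). pose proof (Rmin_r d2 d3).
        specialize (K1 q Hq ltac:(lra)).
        specialize (K2 q (dist2_box y0 d2 q ltac:(lra))).
        specialize (K3 q (dist2_box y0 d3 q ltac:(lra))).
        rewrite B1 in K3.
        apply Rabs_def2 in K1. apply Rabs_def2 in K2. apply Rabs_def2 in K3.
        assert (E : 2 * B * (1 - e / (3 * (2 * B + 1))) <= 2 * B * barrier P R0 eps q)
          by (apply Rmult_le_compat_l; lra).
        assert (E' : 2 * B * (e / (3 * (2 * B + 1))) <= e / 3).
        { apply Rle_trans with ((2 * B + 1) * (e / (3 * (2 * B + 1)))).
          - apply Rmult_le_compat_r; [apply Rlt_le, Rdiv_lt_0_compat; lra | lra].
          - right. field. lra. }
        destruct Hs as [-> | ->]; lra. }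
  pose proof (K 1 (or_introl eq_refl) y Hy). pose proof (K (- 1) (or_intror eq_refl) y Hy).
  rewrite (comb_minus l (fun x => He x y) (fun x => H x y)). apply Rabs_le. lra.
Qed.

(** One number serves as size of the box and as distance to [P] and to the boundary, so that all
    later bounds depend on [r] alone. *)
Definition safe_box (Om : pt -> Prop) (P : pt) (r : R) (a : pt) : Prop :=
  forall x, box a r x -> Om x /\ r < dist2 P x /\ forall z, bdry Om z -> r <= dist2 x z.

Lemma safe_box_exists Om P a : open2 Om -> Om a -> a <> P ->
  exists r0, 0 < r0 /\ forall r, 0 < r <= r0 -> safe_box Om P r a.
Proof.
  intros O Ha N. destruct (O a Ha) as [r1 [Hr1 H1]]. apply dist2_pos_neq in N.
  (* A box of radius r lies in the disc of radius 2 r. With 4 r at most the distance to [P] and at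
     most [r1], a further r is left over in both directions. *)
  exists (Rmin r1 (dist2 a P) / 4).
  pose proof (Rmin_l r1 (dist2 a P)). pose proof (Rmin_r r1 (dist2 a P)).
  assert (0 < Rmin r1 (dist2 a P)) by (apply Rmin_glb_lt; assumption).
  split; [lra | ]. intros r Hr x Hx. apply box_dist2 in Hx.
  split; [ | split].
  - apply H1. rewrite dist2_sym. lra.
  - pose proof (dist2_triangle a x P). rewrite (dist2_sym P x). rewrite dist2_sym in Hx. lra.
  - intros z [_ Hz]. apply Rnot_lt_le. intros L. apply Hz, H1.
    pose proof (dist2_triangle a x z). rewrite (dist2_sym x a) in Hx. lra.
Qed.

(** The factor [(1 + 2 / rho) ^ 3] dominates [(2 / rho) ^ k] for all orders up to three, and
    [6 * rho] is the radius spent by three differences. *)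
Lemma dominated_smooth3 T (s : T -> pt -> R) a b rho r kappa M K :
  0 < rho -> 0 <= kappa -> 0 <= M -> dominated s a b r kappa M K ->
  smooth3 (a, b) rho (r - 6 * rho) (kappa * M * (1 + 2 / rho) ^ 3) (fun z => K (fst z) (snd z)).
Proof.
  intros Hrho Hk HM HK k Hk3.
  pose proof (dominated_differences k rho a b Hrho T s r kappa M K HM HK) as D.
  revert D. apply differences_le_weaken.
  - apply le_INR in Hk3. simpl in Hk3.
    assert (2 * rho * INR k <= 2 * rho * 3) by (apply Rmult_le_compat_l; lra). lra.
  - apply Rmult_le_compat_l; [apply Rmult_le_pos; assumption | ].
    assert (Q : 0 < 2 / rho) by (apply Rdiv_lt_0_compat; lra).
    apply Rle_trans with ((1 + 2 / rho) ^ k).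
    + apply pow_incr. lra.
    + apply Rle_pow; [lra | exact Hk3].
Qed.

(** The index set contains the whole closed disc of radius [r / 2] about [P] instead of the circle
    of radius eps. One family of data thus serves [Om] and all punctured domains with eps at most
    [r / 2]. *)
Definition boundary_data (Om : pt -> Prop) (P : pt) (r : R)
  (t : {z : pt | bdry Om z \/ dist2 P z <= r / 2}) (x : pt) : R := S x (proj1_sig t).

Lemma boundary_data_bound Om P r a R1 :
  0 < r -> safe_box Om P r a -> (forall p, Om p -> dist2 P p < R1) ->
  (forall t, harm (box a r) (boundary_data Om P r t)) /\
  (forall t x, box a r x -> Rabs (boundary_data Om P r t x) <=
      1 / (2 * PI) * (Rabs (ln (r / 2)) + Rabs (ln (3 * R1)))).
Proof.
  intros Hr Ha HR.
  (* A boundary point is within [R1] of some point of [Om], hence within [2 * R1] of [P] and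
     [3 * R1] of [x]. The lower bound [r / 2] is attained in the worst case by the disc, since [x]
     is further than [r] from [P]. *)
  assert (Dist : forall z x, bdry Om z \/ dist2 P z <= r / 2 -> box a r x ->
    r / 2 <= dist2 x z <= 3 * R1).
  { intros z x Hz Hx. destruct (Ha x Hx) as [A1 [A2 A3]]. pose proof (HR x A1).
    pose proof (dist2_triangle P z x). pose proof (dist2_triangle x P z).
    rewrite (dist2_sym z x) in *. rewrite (dist2_sym x P) in *.
    destruct Hz as [Hz | Hz]; [ | lra]. specialize (A3 z Hz).
    destruct (proj1 Hz R1) as [q [Q1 Q2]]; [pose proof (dist2_pos P x); lra | ].
    pose proof (HR q Q1). pose proof (dist2_triangle P q z). rewrite (dist2_sym q z) in *. lra. }
  split.
  - intros [z Hz]. unfold boundary_data. simpl.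
    replace (fun x => S x z) with (S z) by (apply functional_extensionality; intros x; apply S_sym).
    apply S_harm. intros y Hy <-. specialize (Dist z z Hz Hy). rewrite dist2_self in Dist. lra.
  - intros [z Hz] x Hx. apply S_bound; [lra | ]. apply (Dist z x Hz Hx).
Qed.

Lemma regular_part_dominated Om P r a b R1 H :
  open2 Om -> bounded2 Om -> green_regular_part Om H -> (forall p, Om p -> dist2 P p < R1) ->
  0 < r -> safe_box Om P r a -> safe_box Om P r b ->
  dominated (boundary_data Om P r) a b r 1
    (1 / (2 * PI) * (Rabs (ln (r / 2)) + Rabs (ln (3 * R1)))) H.
Proof.
  intros O Bd G HR Hr Ha Hb. destruct (boundary_data_bound Om P r a R1 Hr Ha HR) as [D1 D2].
  split; [ | split; [exact D1 | split; [exact D2 | ]]].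
  - intros x Hx. apply (harm_subset Om); [intros y Hy; apply Hb, Hy | ].
    apply harm_of_harmonic_on, G, Ha, Hx.
  - intros l B y HB Hl Hs Hy. rewrite Rmult_1_l.
    apply (comb_regular_part_bound Om); try assumption.
    + revert Hl. apply List.Forall_impl. intros e He. apply Ha, He.
    + intros z Hz. apply (Hs (exist _ z (or_introl Hz))).
    + apply Hb, Hy.
Qed.

(** The value of [kappa] is twice an upper bound of the barrier at distance at least [r] from [P].
    It tends to 0 with eps, while the data and their bound [M] are those used for [H]. *)
Lemma punctured_dominated Om P r a b R1 eps H He :
  open2 Om -> bounded2 Om -> green_regular_part Om H -> (forall p, Om p -> dist2 P p < R1) ->
  green_regular_part (punctured Om P eps) He -> 0 < eps <= r / 2 -> r < R1 ->
  safe_box Om P r a -> safe_box Om P r b ->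
  dominated (boundary_data Om P r) a b r (2 * ((ln R1 - ln r) / (ln R1 - ln eps)))
    (1 / (2 * PI) * (Rabs (ln (r / 2)) + Rabs (ln (3 * R1)))) (fun x y => He x y - H x y).
Proof.
  intros O Bd G HR Ge Heps HrR Ha Hb.
  destruct (boundary_data_bound Om P r a R1 ltac:(lra) Ha HR) as [D1 D2].
  assert (Pu : forall c x, safe_box Om P r c -> box c r x -> punctured Om P eps x).
  { intros c x Hc Hx. destruct (Hc x Hx) as [A1 [A2 _]]. split; [exact A1 | lra]. }
  split; [ | split; [exact D1 | split; [exact D2 | ]]].
  - intros x Hx.
    replace (fun y => He x y - H x y) with (fun y => 1 * He x y + -1 * H x y)
      by (apply functional_extensionality; intros y; ring).
    apply (harm_lin _ (He x) (H x)).
    + apply (harm_subset (punctured Om P eps)); [intros y; apply Pu, Hb | ].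
      apply harm_of_harmonic_on, Ge, (Pu a), Hx. exact Ha.
    + apply (harm_subset Om); [intros y Hy; apply Hb, Hy | ].
      apply harm_of_harmonic_on, G, Ha, Hx.
  - intros l B y HB Hl Hs Hy.
    apply Rle_trans with (2 * B * barrier P R1 eps y).
    + apply (comb_punctured_bound Om); try assumption; try lra.
      * revert Hl. apply List.Forall_impl. intros e E. apply (Pu a); assumption.
      * intros z Hz.
        assert (Hz' : bdry Om z \/ dist2 P z <= r / 2) by (destruct Hz; [left | right]; [ | lra]; assumption).
        apply (Hs (exist _ z Hz')).
      * apply (Pu b); assumption.
    + pose proof (ln_increasing eps R1 ltac:(lra) ltac:(lra)) as Ln.
      destruct (Hb y Hy) as [_ [Q _]].
      assert (ln r <= ln (dist2 P y)) by (apply ln_le; lra).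
      replace (2 * ((ln R1 - ln r) / (ln R1 - ln eps)) * B)
        with (2 * B * ((ln R1 - ln r) / (ln R1 - ln eps))) by ring.
      apply Rmult_le_compat_l; [lra | ]. unfold barrier.
      apply Rmult_le_compat_r; [apply Rlt_le, Rinv_0_lt_compat; lra | lra].
Qed.

(** What remains of KR without S. It is linear in [H], is meaningful on the diagonal x = y, and
    changes by the same amount as KR when [H] is replaced. *)
Definition KR_regular (L1 L2 : R) (H : pt -> pt -> R) (z : pt * pt) : R :=
  L1 ^ 2 * H (fst z) (fst z) + L2 ^ 2 * H (snd z) (snd z) + 2 * L1 * L2 * H (fst z) (snd z).

Lemma KR_regular_eq H L1 L2 z :
  KR H L1 L2 (fst z) (snd z) = KR_regular L1 L2 H z - 2 * L1 * L2 * S (fst z) (snd z).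
Proof. unfold KR, KR_regular, robin, green. ring. Qed.

Lemma smooth3_diagonal_fst c rho r C (K : pt -> pt -> R) : 0 < rho -> 0 <= C ->
  smooth3 (fst c, fst c) rho r C (fun z => K (fst z) (snd z)) ->
  smooth3 c rho (r - 3 * rho) (8 * C) (fun z => K (fst z) (fst z)).
Proof.
  intros Hrho HC F k Hk.
  pose proof (differences_le_diagonal_fst c rho r k C _ Hrho HC (F k Hk)) as E.
  revert E. apply differences_le_weaken.
  - apply le_INR in Hk. simpl in Hk.
    assert (rho * INR k <= rho * 3) by (apply Rmult_le_compat_l; lra). lra.
  - apply Rmult_le_compat_r; [exact HC | ]. replace 8 with (2 ^ 3) by ring.
    apply Rle_pow; [lra | exact Hk].
Qed.

Lemma smooth3_diagonal_snd c rho r C (K : pt -> pt -> R) : 0 < rho -> 0 <= C ->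
  smooth3 (snd c, snd c) rho r C (fun z => K (fst z) (snd z)) ->
  smooth3 c rho (r - 3 * rho) (8 * C) (fun z => K (snd z) (snd z)).
Proof.
  intros Hrho HC F k Hk.
  pose proof (differences_le_diagonal_snd c rho r k C _ Hrho HC (F k Hk)) as E.
  revert E. apply differences_le_weaken.
  - apply le_INR in Hk. simpl in Hk.
    assert (rho * INR k <= rho * 3) by (apply Rmult_le_compat_l; lra). lra.
  - apply Rmult_le_compat_r; [exact HC | ]. replace 8 with (2 ^ 3) by ring.
    apply Rle_pow; [lra | exact Hk].
Qed.

(** The two Robin terms need the kernel near (x0, x0) and (y0, y0), the mixed term near (x0, y0).
    Restriction to a diagonal costs [3 * rho] and a factor 8 = 2^3. *)
Lemma KR_regular_smooth3 L1 L2 x0 y0 rho r C K : 0 < rho -> 0 <= C ->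
  (forall a b, (a = x0 \/ a = y0) -> (b = x0 \/ b = y0) ->
     smooth3 (a, b) rho r C (fun z => K (fst z) (snd z))) ->
  smooth3 (x0, y0) rho (r - 3 * rho)
    ((8 * Rabs (L1 ^ 2) + 8 * Rabs (L2 ^ 2) + Rabs (2 * L1 * L2)) * C) (KR_regular L1 L2 K).
Proof.
  intros Hrho HC F.
  pose proof (smooth3_diagonal_fst (x0, y0) rho r C K Hrho HC (F _ _ (or_introl eq_refl) (or_introl eq_refl))) as A.
  pose proof (smooth3_diagonal_snd (x0, y0) rho r C K Hrho HC (F _ _ (or_intror eq_refl) (or_intror eq_refl))) as B.
  pose proof (F _ _ (or_introl eq_refl) (or_intror eq_refl)) as D.
  apply (smooth3_weaken _ _ r (r - 3 * rho) C C) in D; [ | lra | lra].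
  pose proof (smooth3_lin _ _ _ _ _ _ _ 1 (2 * L1 * L2)
    (smooth3_lin _ _ _ _ _ _ _ (L1 ^ 2) (L2 ^ 2) A B) D) as E. cbv beta in E.
  rewrite Rabs_R1 in E.
  replace (KR_regular L1 L2 K) with
    (fun z : pt * pt => 1 * (L1 ^ 2 * K (fst z) (fst z) + L2 ^ 2 * K (snd z) (snd z))
      + 2 * L1 * L2 * K (fst z) (snd z))
    by (apply functional_extensionality; intros z; unfold KR_regular; ring).
  revert E. apply smooth3_weaken; [lra | right; ring].
Qed.

Lemma log_ratio_small A R1 eta : 0 <= A -> 0 < R1 -> 0 < eta ->
  exists d, 0 < d /\ forall eps, 0 < eps < d -> eps < R1 /\ 0 <= A / (ln R1 - ln eps) < eta.
Proof.
  intros HA HR Heta. pose proof (Rdiv_le_0_compat A eta HA Heta) as Q.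
  pose proof (exp_pos (- (A / eta + 1))) as E.
  (* Below this threshold the denominator exceeds [A / eta + 1]. *)
  exists (R1 * exp (- (A / eta + 1))). split; [apply Rmult_lt_0_compat; assumption | ].
  intros eps [H1 H2]. apply ln_increasing in H2; [ | exact H1].
  rewrite ln_mult, ln_exp in H2 by assumption.
  split; [apply ln_lt_inv; lra | ]. split; [apply Rdiv_le_0_compat; lra | ].
  apply Rmult_lt_reg_r with (ln R1 - ln eps); [lra | ].
  replace (A / (ln R1 - ln eps) * (ln R1 - ln eps)) with A by (field; lra).
  replace A with (eta * (A / eta)) at 1 by (field; lra).
  apply Rmult_lt_compat_l; lra.
Qed.

Ltac nonneg_product :=
  repeat match goal with |- 0 <= _ * _ => apply Rmult_le_pos end; lra.

(** Of the radius [20 * rho], three kernel differences spend [6 * rho] and the diagonals [3 * rho],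
    which leaves [11 * rho]. The points x0 and y0 may coincide, as (a) demands, and [rho] stays free
    below [r0] so that it can be matched with the one for S. *)
Lemma KR_regular_convergence Om P L1 L2 HOm Heps x0 y0 :
  open2 Om -> bounded2 Om -> Om P -> green_regular_part Om HOm ->
  (forall eps, 0 < eps -> (forall q, dist2 P q <= eps -> Om q) ->
     green_regular_part (punctured Om P eps) (Heps eps)) ->
  Om x0 -> x0 <> P -> Om y0 -> y0 <> P ->
  exists r0, 0 < r0 /\ forall rho, 0 < 20 * rho <= r0 ->
    exists C eps1 eta, 0 <= C /\ 0 < eps1 /\
      (forall e, 0 < e -> exists d, 0 < d /\ forall eps, 0 < eps < d -> 0 <= eta eps < e) /\
      smooth3 (x0, y0) rho (11 * rho) C (KR_regular L1 L2 HOm) /\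
      (forall eps, 0 < eps < eps1 -> smooth3 (x0, y0) rho (11 * rho) (eta eps)
         (fun z => KR_regular L1 L2 (Heps eps) z - KR_regular L1 L2 HOm z)) /\
      (forall z, box4 (x0, y0) (11 * rho) z ->
         Om (fst z) /\ eps1 < dist2 P (fst z) /\ Om (snd z) /\ eps1 < dist2 P (snd z)).
Proof.
  intros O Bd HP G Ge Hx Nx Hy Ny.
  destruct (safe_box_exists Om P x0 O Hx Nx) as [rx [Hrx Sx]].
  destruct (safe_box_exists Om P y0 O Hy Ny) as [ry [Hry Sy]].
  destruct (O P HP) as [rP [HrP SP]].
  assert (HB := Bd). destruct HB as [M0 HM0].
  set (R1 := dist2 P (0, 0) + M0).
  assert (HR : forall p, Om p -> dist2 P p < R1).
  { intros p Hp. specialize (HM0 p Hp). pose proof (dist2_triangle P (0, 0) p). unfold R1. lra. }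
  assert (HR1 : 0 < R1) by (pose proof (HR P HP) as E; rewrite dist2_self in E; exact E).
  exists (Rmin rx ry). split; [apply Rmin_glb_lt; assumption | ].
  intros rho Hrho. set (r := 20 * rho) in *.
  pose proof (Rmin_l rx ry). pose proof (Rmin_r rx ry).
  assert (Sa : forall a, a = x0 \/ a = y0 -> safe_box Om P r a).
  { intros a [-> | ->]; [apply Sx | apply Sy]; lra. }
  assert (HrR : r < R1).
  { destruct (Sa x0 (or_introl eq_refl) x0) as [A1 [A2 _]].
    - split; rewrite Rminus_diag, Rabs_R0; lra.
    - specialize (HR x0 A1). lra. }
  set (M := 1 / (2 * PI) * (Rabs (ln (r / 2)) + Rabs (ln (3 * R1)))).
  assert (HM : 0 <= M).
  { pose proof PI_RGT_0. apply Rmult_le_pos; [apply Rlt_le, Rdiv_lt_0_compat; lra | ].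
    pose proof (Rabs_pos (ln (r / 2))). pose proof (Rabs_pos (ln (3 * R1))). lra. }
  set (Lc := 8 * Rabs (L1 ^ 2) + 8 * Rabs (L2 ^ 2) + Rabs (2 * L1 * L2)).
  assert (HLc : 0 <= Lc).
  { unfold Lc. pose proof (Rabs_pos (L1 ^ 2)). pose proof (Rabs_pos (L2 ^ 2)).
    pose proof (Rabs_pos (2 * L1 * L2)). lra. }
  set (q := (1 + 2 / rho) ^ 3).
  assert (Hq : 0 <= q).
  { apply pow_le. assert (0 < 2 / rho) by (apply Rdiv_lt_0_compat; unfold r in *; lra). lra. }
  assert (Lnr : ln r < ln R1) by (apply ln_increasing; lra).
  assert (Hlr : 0 < rho) by (unfold r in *; lra).
  (* Below [r / 2] the circle lies in the index disc of the data; below [rP] the closed disc lies in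
     [Om], which is when [Heps eps] is known to be a regular part. *)
  exists (Lc * (1 * M * q)), (Rmin (r / 2) rP),
    (fun eps => Lc * (2 * ((ln R1 - ln r) / (ln R1 - ln eps)) * M * q)).
  pose proof (Rmin_l (r / 2) rP). pose proof (Rmin_r (r / 2) rP).
  split; [ | split; [ | split; [ | split; [ | split]]]].
  - nonneg_product.
  - apply Rmin_glb_lt; lra.
  - intros e He.
    destruct (log_ratio_small (Lc * (2 * (ln R1 - ln r) * M * q)) R1 e) as [d [Hd K]];
      [ | lra | lra | ].
    { nonneg_product. }
    exists d. split; [exact Hd | ]. intros eps Heps'. specialize (K eps Heps').
    replace (Lc * (2 * ((ln R1 - ln r) / (ln R1 - ln eps)) * M * q))
      with (Lc * (2 * (ln R1 - ln r) * M * q) / (ln R1 - ln eps)); [apply K | ].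
    field. pose proof (ln_increasing eps R1 ltac:(lra) ltac:(lra)). lra.
  - replace (11 * rho) with ((r - 6 * rho) - 3 * rho) by (unfold r; ring).
    apply KR_regular_smooth3; [exact Hlr | nonneg_product | ].
    intros a b Ha Hb. apply (dominated_smooth3 _ (boundary_data Om P r)); [lra | lra | lra | ].
    apply regular_part_dominated; auto. lra.
  - intros eps Heps'.
    assert (Lne : ln eps < ln R1) by (apply ln_increasing; lra).
    replace (fun z => KR_regular L1 L2 (Heps eps) z - KR_regular L1 L2 HOm z)
      with (KR_regular L1 L2 (fun x y => Heps eps x y - HOm x y))
      by (apply functional_extensionality; intros z; unfold KR_regular; ring).
    replace (11 * rho) with ((r - 6 * rho) - 3 * rho) by (unfold r; ring).
    assert (Q : 0 <= 2 * ((ln R1 - ln r) / (ln R1 - ln eps))).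
    { apply Rmult_le_pos; [lra | ]. apply Rdiv_le_0_compat; lra. }
    apply KR_regular_smooth3; [exact Hlr | nonneg_product | ].
    intros a b Ha Hb.
    apply (dominated_smooth3 _ (boundary_data Om P r) _ _ _ _ _ _ (fun x y => Heps eps x y - HOm x y));
      [lra | exact Q | lra | ].
    apply punctured_dominated; auto; [ | lra].
    apply Ge; [lra | ]. intros p Hp. apply SP. lra.
  - intros z [Z1 Z2]. simpl in Z1, Z2.
    destruct (Sa x0 (or_introl eq_refl) (fst z)) as [A1 [A2 _]].
    { revert Z1. apply box_subset. unfold r. lra. }
    destruct (Sa y0 (or_intror eq_refl) (snd z)) as [B1 [B2 _]].
    { revert Z2. apply box_subset. unfold r. lra. }
    repeat split; try assumption; lra.
Qed.

(** Off the diagonal S is itself a dominated kernel, with its own values on the second box as data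
    and [kappa] equal to 1. No third derivative of the logarithm has to be computed. *)
Lemma S_smooth3 x0 y0 : x0 <> y0 ->
  exists r0, 0 < r0 /\ forall rho, 0 < 20 * rho <= r0 ->
    exists C, 0 <= C /\ smooth3 (x0, y0) rho (11 * rho) C (fun z => S (fst z) (snd z)) /\
      forall z, box4 (x0, y0) (11 * rho) z -> fst z <> snd z.
Proof.
  (* The centres are at least 6 r apart and each box stays within 2 r of its centre, so the boxes
     keep a distance 2 r. *)
  intros N. apply dist2_pos_neq in N. exists (dist2 x0 y0 / 6). split; [lra | ].
  intros rho Hrho. set (r := 20 * rho) in *.
  assert (Dist : forall x y, box x0 r x -> box y0 r y -> 2 * r <= dist2 x y <= dist2 x0 y0 + 4 * r).
  { intros x y Hx Hy. apply box_dist2 in Hx. apply box_dist2 in Hy.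
    pose proof (dist2_triangle x0 x y0). pose proof (dist2_triangle x y y0).
    pose proof (dist2_triangle x x0 y). pose proof (dist2_triangle x0 y0 y).
    rewrite (dist2_sym x0 x), (dist2_sym y0 y) in *. lra. }
  set (M := 1 / (2 * PI) * (Rabs (ln (2 * r)) + Rabs (ln (dist2 x0 y0 + 4 * r)))).
  assert (HM : 0 <= M).
  { pose proof PI_RGT_0. apply Rmult_le_pos; [apply Rlt_le, Rdiv_lt_0_compat; lra | ].
    pose proof (Rabs_pos (ln (2 * r))). pose proof (Rabs_pos (ln (dist2 x0 y0 + 4 * r))). lra. }
  assert (Hrho' : 0 < rho) by (unfold r in Hrho; lra).
  assert (Dom : dominated (fun (t : {y | box y0 r y}) x => S x (proj1_sig t)) x0 y0 r 1 M S).
  { split; [ | split; [ | split]].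
    - intros x Hx. apply S_harm. intros y Hy <-. specialize (Dist x x Hx Hy).
      rewrite dist2_self in Dist. lra.
    - intros [y Hy]. simpl.
      replace (fun x => S x y) with (S y) by (apply functional_extensionality; intros x; apply S_sym).
      apply S_harm. intros x Hx <-. specialize (Dist y y Hx Hy).
      rewrite dist2_self in Dist. lra.
    - intros [y Hy] x Hx. apply S_bound; [lra | ]. apply Dist; assumption.
    - intros l B y HB _ Hs Hy. rewrite Rmult_1_l. apply (Hs (exist _ y Hy)). }
  exists (1 * M * (1 + 2 / rho) ^ 3). split; [ | split].
  - apply Rmult_le_pos; [lra | ]. apply pow_le.
    assert (0 < 2 / rho) by (apply Rdiv_lt_0_compat; lra). lra.
  - pose proof (dominated_smooth3 _ _ _ _ rho _ _ _ _ Hrho' Rle_0_1 HM Dom) as E.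
    revert E. apply smooth3_weaken; [unfold r; lra | lra].
  - intros [x y] [Z1 Z2] E. simpl in *. subst y.
    specialize (Dist x x). rewrite dist2_self in Dist.
    assert (2 * r <= 0); [ | lra]. apply Dist; eapply box_subset; try eassumption; unfold r; lra.
Qed.

(** * Newton's method in four variables *)

Definition sum4 (f : nat -> R) : R := f 0%nat + f 1%nat + f 2%nat + f 3%nat.

Definition delta (i k : nat) : R := if Nat.eqb i k then 1 else 0.

(** Both products are used: [f] times [b] recovers a displacement from its image, and [b] times [f]
    shows that fixed points of Newton's map are zeros. Functions on [nat] keep the algebra open to
    [ring] and [lra]. *)
Definition inverse4 (f b : nat -> nat -> R) : Prop :=
  forall i k, (i < 4)%nat -> (k < 4)%nat ->
    sum4 (fun j => f i j * b j k) = delta i k /\ sum4 (fun j => b i j * f j k) = delta i k.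

(* The imports stay confined to this module: MathComp redefines the order notations on [nat]. *)
Module Matrix4.
Import all_boot all_order all_algebra Rstruct.
Import Order.TTheory GRing.Theory Num.Theory.

Lemma sum_ord4 (f : nat -> R) : (\sum_(i < 4) f (nat_of_ord i))%R = sum4 f.
Proof. by rewrite !big_ord_recr big_ord0 /= add0r. Qed.

Lemma deltaE (i k : nat) : delta i k = ((i == k)%:R)%R.
Proof. by rewrite /delta; case: Nat.eqb_spec => [->|/eqP/negbTE ->]; rewrite ?eqxx. Qed.

Lemma matrix4_inverse (f : nat -> nat -> R) :
  (\det (\matrix_(i < 4, j < 4) f i j : 'M[R]_4) != 0)%R ->
  exists b : nat -> nat -> R, inverse4 f b.
Proof.
set A := (\matrix_(i < 4, j < 4) f i j)%R => dA.
have uA : A \in unitmx by rewrite unitmxE unitfE.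
exists (fun i j => invmx A (inord i) (inord j)) => i k /ssrnat.ltP Hi /ssrnat.ltP Hk; split.
- move: (congr1 (fun B : 'M[R]_4 => B (inord i) (inord k)) (mulmxV uA)).
  rewrite deltaE !mxE -val_eqE /= !inordK // => <-.
  rewrite -sum_ord4; apply: eq_bigr => j _.
  by rewrite !mxE inordK // inord_val.
- move: (congr1 (fun B : 'M[R]_4 => B (inord i) (inord k)) (mulVmx uA)).
  rewrite deltaE !mxE -val_eqE /= !inordK // => <-.
  rewrite -sum_ord4; apply: eq_bigr => j _.
  by rewrite !mxE inordK // inord_val.
Qed.

Lemma matrix4_det_neq0 (g : nat -> nat -> R) :
  (forall v : nat -> R, (forall j, (j < 4)%coq_nat -> sum4 (fun i => v i * g i j)%R = 0%R) ->
     forall i, (i < 4)%coq_nat -> v i = 0%R) ->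
  is_true (\det (\matrix_(i < 4, j < 4) g i j : 'M[R]_4) != 0)%R.
Proof.
move=> H; apply/negP => /det0P [v v0 vg]; move/negP: v0; apply; apply/eqP/rowP => i.
rewrite mxE -(inord_val i).
apply: (H (fun i => v ord0 (inord i)) _ i (ssrnat.ltP (ltn_ord i))) => j /ssrnat.ltP Hj.
move/rowP: vg => /(_ (inord j)); rewrite !mxE => <-.
rewrite -sum_ord4; apply: eq_bigr => k _.
by rewrite !mxE inordK // inord_val.
Qed.

Lemma nondegenerate_inverse U F z : nondegenerate_critical4 U F z ->
  exists b, inverse4 (fun i j => part4 (part4 F j) i z) b.
Proof. by case=> _; exact: (@matrix4_inverse (fun i j => part4 (part4 F j) i z)). Qed.

Lemma nondegenerate_intro U F z : critical4 U F z ->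
  (forall v : nat -> R,
     (forall j, (j < 4)%coq_nat -> sum4 (fun i => v i * part4 (part4 F j) i z)%R = 0%R) ->
     forall i, (i < 4)%coq_nat -> v i = 0%R) ->
  nondegenerate_critical4 U F z.
Proof. by move=> C H; split=> //; exact: (@matrix4_det_neq0 (fun i j => part4 (part4 F j) i z)). Qed.

End Matrix4.

(** A bound for the norm of [b] from the sup norm, which measures residuals, to the l^1 norm, which
    measures displacements. *)
Definition sum44 (b : nat -> nat -> R) : R := sum4 (fun j => sum4 (fun k => Rabs (b j k))).

Lemma sum4_le f g : (forall i, f i <= g i) -> sum4 f <= sum4 g.
Proof. intros H. unfold sum4. pose proof (H 0%nat). pose proof (H 1%nat). pose proof (H 2%nat). pose proof (H 3%nat). lra. Qed.

Lemma sum4_nonneg f : (forall i, 0 <= f i) -> 0 <= sum4 f.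
Proof. intros H. unfold sum4. pose proof (H 0%nat). pose proof (H 1%nat). pose proof (H 2%nat). pose proof (H 3%nat). lra. Qed.

Lemma sum4_Rabs f : Rabs (sum4 f) <= sum4 (fun i => Rabs (f i)).
Proof.
  unfold sum4. pose proof (Rabs_triang (f 0%nat + f 1%nat + f 2%nat) (f 3%nat)).
  pose proof (Rabs_triang (f 0%nat + f 1%nat) (f 2%nat)).
  pose proof (Rabs_triang (f 0%nat) (f 1%nat)). lra.
Qed.

Lemma sum4_apply_le (b : nat -> nat -> R) (x : nat -> R) e :
  (forall j, (j < 4)%nat -> Rabs (x j) <= e) ->
  sum4 (fun k => Rabs (sum4 (fun j => x j * b j k))) <= e * sum44 b.
Proof.
  intros H.
  assert (K : forall j k, (j < 4)%nat -> Rabs (x j * b j k) <= e * Rabs (b j k)).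
  { intros j k Hj. rewrite Rabs_mult. apply Rmult_le_compat_r; [apply Rabs_pos | apply H, Hj]. }
  assert (L : forall k, Rabs (sum4 (fun j => x j * b j k)) <=
    e * sum4 (fun j => Rabs (b j k))).
  { intros k. apply Rle_trans with (1 := sum4_Rabs _). unfold sum4.
    pose proof (K 0%nat k ltac:(lia)). pose proof (K 1%nat k ltac:(lia)).
    pose proof (K 2%nat k ltac:(lia)). pose proof (K 3%nat k ltac:(lia)). lra. }
  apply Rle_trans with (1 := sum4_le _ _ L). unfold sum44, sum4. right. ring.
Qed.

Lemma sum4_delta (x : nat -> R) k : (k < 4)%nat -> sum4 (fun i => x i * delta i k) = x k.
Proof.
  intros Hk. destruct k as [ | [ | [ | [ | k]]]]; try lia; unfold sum4, delta; simpl; ring.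
Qed.

Lemma sum4_eq0 f : sum4 (fun i => Rabs (f i)) <= 0 -> forall i, (i < 4)%nat -> f i = 0.
Proof.
  unfold sum4. intros H i Hi.
  pose proof (Rabs_pos (f 0%nat)). pose proof (Rabs_pos (f 1%nat)).
  pose proof (Rabs_pos (f 2%nat)). pose proof (Rabs_pos (f 3%nat)).
  destruct (Req_dec (f i) 0) as [E | N]; [exact E | ]. apply Rabs_pos_lt in N.
  destruct i as [ | [ | [ | [ | i]]]]; lia || lra.
Qed.

Lemma inverse4_perturbed_kernel f b g e v :
  inverse4 f b -> e * sum44 b < 1 ->
  (forall i j, (i < 4)%nat -> (j < 4)%nat -> Rabs (g i j - f i j) <= e) ->
  (forall j, (j < 4)%nat -> sum4 (fun i => v i * g i j) = 0) ->
  forall i, (i < 4)%nat -> v i = 0.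
Proof.
  intros Hb He Hg Hv. apply sum4_eq0.
  set (w := fun j => sum4 (fun i => v i * (f i j - g i j))).
  set (n := sum4 (fun i => Rabs (v i))).
  assert (E1 : forall j, (j < 4)%nat -> Rabs (w j) <= e * n).
  { intros j Hj. unfold w. apply Rle_trans with (1 := sum4_Rabs _).
    assert (K : forall i, (i < 4)%nat -> Rabs (v i * (f i j - g i j)) <= e * Rabs (v i)).
    { intros i Hi. rewrite Rabs_mult, Rmult_comm. apply Rmult_le_compat_r; [apply Rabs_pos | ].
      rewrite Rabs_minus_sym. apply Hg; assumption. }
    unfold n, sum4. pose proof (K 0%nat ltac:(lia)). pose proof (K 1%nat ltac:(lia)).
    pose proof (K 2%nat ltac:(lia)). pose proof (K 3%nat ltac:(lia)). lra. }
  assert (E2 : forall k, (k < 4)%nat -> v k = sum4 (fun j => w j * b j k)).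
  { intros k Hk. rewrite <- (sum4_delta v k Hk).
    transitivity (sum4 (fun i => v i * sum4 (fun j => f i j * b j k))).
    - unfold sum4 at 1 2. rewrite !(fun i Hi => proj1 (Hb i k Hi Hk)) by lia. reflexivity.
    - assert (W : forall j, (j < 4)%nat -> w j = sum4 (fun i => v i * f i j)).
      { intros j Hj. transitivity (sum4 (fun i => v i * f i j) - sum4 (fun i => v i * g i j)).
        - unfold w, sum4. ring.
        - rewrite (Hv j Hj). ring. }
      unfold sum4 at 3. rewrite !W by lia. unfold sum4. ring. }
  pose proof (sum4_apply_le b w (e * n) E1) as E3.
  assert (E4 : n = sum4 (fun k => Rabs (sum4 (fun j => w j * b j k)))).
  { unfold n. unfold sum4 at 1 2. rewrite <- !E2 by lia. reflexivity. }
  rewrite <- E4 in E3.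
  assert (N0 : 0 <= n) by (apply sum4_nonneg; intros i; apply Rabs_pos).
  destruct (Rle_lt_or_eq_dec 0 n N0) as [Hn | Hn]; [ | lra].
  assert (e * sum44 b * n < 1 * n) by (apply Rmult_lt_compat_r; lra). lra.
Qed.

(** * The l^1 metric and coordinate paths *)

Definition dist4 (z z' : pt * pt) : R := sum4 (fun i => Rabs (coord4 z' i - coord4 z i)).

Lemma dist4_zero z z' : dist4 z z' <= 0 -> z' = z.
Proof.
  intros H. pose proof (sum4_eq0 (fun i => coord4 z' i - coord4 z i) H) as E. cbv beta in E.
  pose proof (E 0%nat ltac:(lia)). pose proof (E 1%nat ltac:(lia)).
  pose proof (E 2%nat ltac:(lia)). pose proof (E 3%nat ltac:(lia)).
  destruct z as [[? ?] [? ?]], z' as [[? ?] [? ?]]; simpl in *. repeat f_equal; lra.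
Qed.

Lemma dist4_box4 z z' r : dist4 z z' < r -> box4 z r z'.
Proof.
  unfold dist4, sum4. intros H.
  pose proof (Rabs_pos (coord4 z' 0%nat - coord4 z 0%nat)).
  pose proof (Rabs_pos (coord4 z' 1%nat - coord4 z 1%nat)).
  pose proof (Rabs_pos (coord4 z' 2%nat - coord4 z 2%nat)).
  pose proof (Rabs_pos (coord4 z' 3%nat - coord4 z 3%nat)).
  simpl in *. repeat split; lra.
Qed.

Lemma box4_dist4 z z' r : box4 z r z' -> dist4 z z' <= 4 * r.
Proof. intros [[H1 H2] [H3 H4]]. unfold dist4, sum4; simpl. lra. Qed.

Lemma dist4_dist2 z z' :
  dist2 (fst z') (fst z) <= dist4 z z' /\ dist2 (snd z') (snd z) <= dist4 z z'.
Proof.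
  pose proof (dist2_le (fst z') (fst z)). pose proof (dist2_le (snd z') (snd z)).
  unfold dist4, sum4; simpl.
  pose proof (Rabs_pos (fst (fst z') - fst (fst z))). pose proof (Rabs_pos (snd (fst z') - snd (fst z))).
  pose proof (Rabs_pos (fst (snd z') - fst (snd z))). pose proof (Rabs_pos (snd (snd z') - snd (snd z))).
  lra.
Qed.

Lemma dist4_triangle z z' z'' : dist4 z z'' <= dist4 z z' + dist4 z' z''.
Proof.
  unfold dist4. apply Rle_trans with (sum4 (fun i => Rabs (coord4 z' i - coord4 z i)
     + Rabs (coord4 z'' i - coord4 z' i))); [ | unfold sum4; lra].
  apply sum4_le. intros i.
  replace (coord4 z'' i - coord4 z i) with (coord4 z' i - coord4 z i + (coord4 z'' i - coord4 z' i)) by ring.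
  apply Rabs_triang.
Qed.

Lemma dist4_sym z z' : dist4 z z' = dist4 z' z.
Proof. unfold dist4, sum4. rewrite !(Rabs_minus_sym (coord4 z' _)). reflexivity. Qed.

Lemma dist4_self z : dist4 z z = 0.
Proof. unfold dist4, sum4. rewrite !Rminus_diag, Rabs_R0. ring. Qed.

Lemma shift_coord z i t : upd4 z i t = shift i (t - coord4 z i) z.
Proof. rewrite <- upd4_shift. f_equal. ring. Qed.

(** Change the coordinates one at a time: the corners stay in the box because it is a product, and
    the four errors add up to the l^1 distance. With [A] zero this is a Lipschitz estimate. *)
Lemma path4 (g : pt * pt -> R) (A : nat -> R) c r e :
  (forall i w h, (i < 4)%nat -> box4 c r w -> box4 c r (shift i h w) ->
     Rabs (g (shift i h w) - g w - h * A i) <= e * Rabs h) ->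
  forall z z', box4 c r z -> box4 c r z' ->
  Rabs (g z' - g z - sum4 (fun i => (coord4 z' i - coord4 z i) * A i)) <= e * dist4 z z'.
Proof.
  intros H [[x1 x2] [y1 y2]] [[x1' x2'] [y1' y2']] [[Z1 Z2] [Z3 Z4]] [[Z1' Z2'] [Z3' Z4']].
  simpl in *.
  set (w0 := ((x1, x2), (y1, y2))). set (w1 := ((x1', x2), (y1, y2))).
  set (w2 := ((x1', x2'), (y1, y2))). set (w3 := ((x1', x2'), (y1', y2))).
  set (w4 := ((x1', x2'), (y1', y2'))).
  pose proof (H 0%nat w0 (x1' - x1) ltac:(lia)) as H0.
  pose proof (H 1%nat w1 (x2' - x2) ltac:(lia)) as H1.
  pose proof (H 2%nat w2 (y1' - y1) ltac:(lia)) as H2.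
  pose proof (H 3%nat w3 (y2' - y2) ltac:(lia)) as H3.
  assert (S0 : shift 0 (x1' - x1) w0 = w1) by (unfold w0, w1; simpl; repeat f_equal; ring).
  assert (S1 : shift 1 (x2' - x2) w1 = w2) by (unfold w1, w2; simpl; repeat f_equal; ring).
  assert (S2 : shift 2 (y1' - y1) w2 = w3) by (unfold w2, w3; simpl; repeat f_equal; ring).
  assert (S3 : shift 3 (y2' - y2) w3 = w4) by (unfold w3, w4; simpl; repeat f_equal; ring).
  rewrite S0 in H0. rewrite S1 in H1. rewrite S2 in H2. rewrite S3 in H3.
  specialize (H0 ltac:(repeat split; assumption) ltac:(repeat split; assumption)).
  specialize (H1 ltac:(repeat split; assumption) ltac:(repeat split; assumption)).
  specialize (H2 ltac:(repeat split; assumption) ltac:(repeat split; assumption)).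
  specialize (H3 ltac:(repeat split; assumption) ltac:(repeat split; assumption)).
  unfold dist4, sum4, w0, w1, w2, w3, w4, pt in *. simpl in *.
  apply Rabs_le_between in H0, H1, H2, H3. apply Rabs_le. lra.
Qed.

Definition point4 (f : nat -> R) : pt * pt := ((f 0%nat, f 1%nat), (f 2%nat, f 3%nat)).

Lemma coord4_point4 f i : (i < 4)%nat -> coord4 (point4 f) i = f i.
Proof. intros Hi. destruct i as [ | [ | [ | [ | i]]]]; lia || reflexivity. Qed.

Lemma geometric_increments_limit (u : nat -> R) K :
  (forall n, Rabs (u (Datatypes.S n) - u n) <= K * (/ 2) ^ n) -> exists l : R, is_lim_seq u l.
Proof.
  intros H.
  assert (E : ex_series (fun n => u (Datatypes.S n) - u n)).
  { apply (ex_series_le (K := R_AbsRing) (V := R_CompleteNormedModule) _ (fun n => K * (/ 2) ^ n)).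
    - exact H.
    - apply (ex_series_scal_l (K := R_AbsRing) K (fun n => (/ 2) ^ n)).
      apply ex_series_geom. rewrite Rabs_pos_eq; lra. }
  destruct E as [l Hl]. exists (l + u 0%nat).
  apply is_lim_seq_incr_1.
  apply (is_lim_seq_ext (fun n => sum_n (fun n => u (Datatypes.S n) - u n) n + u 0%nat)).
  - intros n. induction n as [ | n IH].
    + rewrite sum_O. ring.
    + rewrite sum_Sn. unfold plus; simpl. lra.
  - apply is_lim_seq_plus'; [exact Hl | apply is_lim_seq_const].
Qed.

(** Newton's map [z |-> z - b (G z)] with the frozen inverse [b] of the derivative
    at [z0] contracts [dist4] by 1/2. *)
Lemma newton4 (G : nat -> pt * pt -> R) (f b : nat -> nat -> R) z0 s e e0 :
  inverse4 f b -> e * sum44 b <= / 2 ->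
  (forall j z z', (j < 4)%nat -> box4 z0 s z -> box4 z0 s z' ->
     Rabs (G j z' - G j z - sum4 (fun i => (coord4 z' i - coord4 z i) * f i j)) <= e * dist4 z z') ->
  (forall j, (j < 4)%nat -> Rabs (G j z0) <= e0) -> 0 <= e0 -> 2 * (e0 * sum44 b) < s ->
  exists z, dist4 z0 z <= 2 * (e0 * sum44 b) /\ (forall j, (j < 4)%nat -> G j z = 0) /\
    (forall w, box4 z0 s w -> (forall j, (j < 4)%nat -> G j w = 0) -> w = z).
Proof.
  intros Hb He HG H0 He0 Hs.
  set (N := fun z => point4 (fun k => coord4 z k - sum4 (fun j => G j z * b j k))).
  set (K := e0 * sum44 b).
  assert (Sb : 0 <= sum44 b).
  { apply sum4_nonneg. intros j. apply sum4_nonneg. intros k. apply Rabs_pos. }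
  assert (HK : 0 <= K) by (apply Rmult_le_pos; assumption).
  assert (Contr : forall z z', box4 z0 s z -> box4 z0 s z' -> dist4 (N z) (N z') <= / 2 * dist4 z z').
  { intros z z' Hz Hz'.
    assert (D0 : 0 <= dist4 z z') by (apply sum4_nonneg; intros i; apply Rabs_pos).
    (* The linearization defect. As [f] times [b] is the identity, the increment of Newton's map is
       exactly this defect times [b]. *)
    set (x := fun j => sum4 (fun i => (coord4 z' i - coord4 z i) * f i j) - (G j z' - G j z)).
    assert (Hx : forall j, (j < 4)%nat -> Rabs (x j) <= e * dist4 z z').
    { intros j Hj. unfold x. rewrite Rabs_minus_sym. apply HG; assumption. }
    assert (Ek : forall k, (k < 4)%nat ->
      coord4 (N z') k - coord4 (N z) k = sum4 (fun j => x j * b j k)).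
    { intros k Hk. unfold N. rewrite !coord4_point4 by exact Hk.
      set (h := fun i => coord4 z' i - coord4 z i).
      assert (Hh : h k = sum4 (fun i => h i * sum4 (fun j => f i j * b j k))).
      { rewrite <- (sum4_delta h k Hk) at 1. unfold sum4 at 1 2.
        rewrite !(fun i Hi => proj1 (Hb i k Hi Hk)) by lia. reflexivity. }
      transitivity (h k - sum4 (fun j => (G j z' - G j z) * b j k)).
      { unfold h, sum4. ring. }
      rewrite Hh. unfold x, h, sum4. ring. }
    unfold dist4 at 1. unfold sum4 at 1. rewrite !Ek by lia.
    pose proof (sum4_apply_le b x _ Hx) as E.
    apply Rle_trans with (e * dist4 z z' * sum44 b); [exact E | ].
    replace (e * dist4 z z' * sum44 b) with (e * sum44 b * dist4 z z') by ring.
    apply Rmult_le_compat_r; assumption. }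
  assert (Fix : forall z, (forall j, (j < 4)%nat -> G j z = 0) <-> N z = z).
  { intros z. split.
    - intros Hz. destruct z as [[z1 z2] [z3 z4]]. unfold N, point4, sum4.
      rewrite !Hz by lia. simpl. repeat f_equal; ring.
    - intros Hz j Hj.
      assert (Q : forall k, (k < 4)%nat -> sum4 (fun j => G j z * b j k) = 0).
      { intros k Hk. assert (E : coord4 (N z) k = coord4 z k) by (rewrite Hz; reflexivity).
        unfold N in E. rewrite coord4_point4 in E by exact Hk. lra. }
      rewrite <- (sum4_delta (fun j => G j z) j Hj).
      transitivity (sum4 (fun i => G i z * sum4 (fun k => b i k * f k j))).
      + unfold sum4 at 1 2. rewrite !(fun i Hi => proj2 (Hb i j Hi Hj)) by lia. reflexivity.
      + transitivity (sum4 (fun k => sum4 (fun j => G j z * b j k) * f k j)).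
        * unfold sum4. ring.
        * unfold sum4 at 1. rewrite !Q by lia. ring. }
  assert (B0 : box4 z0 s z0) by (apply dist4_box4; rewrite dist4_self; unfold K in HK; lra).
  set (u := fix u n := match n with O => z0 | Datatypes.S n => N (u n) end).
  assert (First : dist4 z0 (N z0) <= K).
  { unfold dist4, sum4, N. rewrite !coord4_point4 by lia.
    pose proof (sum4_apply_le b (fun j => - G j z0) e0
      (fun j Hj => eq_ind_r (fun t => t <= e0) (H0 j Hj) (Rabs_Ropp (G j z0)))) as E.
    apply Rle_trans with (2 := E). right. unfold sum4 at 5.
    assert (forall k, coord4 z0 k - sum4 (fun j => G j z0 * b j k) - coord4 z0 k
       = sum4 (fun j => - G j z0 * b j k)) as Q by (intros k; unfold sum4; ring).
    rewrite !Q. reflexivity. }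
  (* The steps are at most K, K / 2, K / 4 and so on, with sum below 2 K; hence the iterates never
     leave the box on which the contraction holds. *)
  assert (Iter : forall n, dist4 z0 (u n) <= 2 * K * (1 - (/ 2) ^ n) /\
    dist4 (u n) (u (Datatypes.S n)) <= K * (/ 2) ^ n).
  { assert (Inb : forall n t, dist4 z0 t <= 2 * K * (1 - (/ 2) ^ n) -> box4 z0 s t).
    { intros n t Ht. apply dist4_box4. apply Rle_lt_trans with (1 := Ht).
      assert (0 < (/ 2) ^ n) by (apply pow_lt; lra).
      assert (0 <= 2 * K * (/ 2) ^ n) by (apply Rmult_le_pos; lra). unfold K in *. lra. }
    induction n as [ | n [I1 I2]].
    - simpl. rewrite dist4_self. split; lra.
    - assert (I3 : dist4 z0 (u (Datatypes.S n)) <= 2 * K * (1 - (/ 2) ^ Datatypes.S n)).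
      { apply Rle_trans with (1 := dist4_triangle _ (u n) _).
        replace ((/ 2) ^ Datatypes.S n) with (/ 2 * (/ 2) ^ n) by reflexivity. lra. }
      split; [exact I3 | ].
      apply Rle_trans with (/ 2 * dist4 (u n) (u (Datatypes.S n))).
      + apply (Contr (u n) (u (Datatypes.S n))); [exact (Inb n _ I1) | exact (Inb _ _ I3)].
      + replace ((/ 2) ^ Datatypes.S n) with (/ 2 * (/ 2) ^ n) by reflexivity. lra. }
  assert (Lim : forall i, exists l : R, is_lim_seq (fun n => coord4 (u n) i) l).
  { assert (L : forall i, (i < 4)%nat -> exists l : R, is_lim_seq (fun n => coord4 (u n) i) l).
    { intros i Hi. apply (geometric_increments_limit _ K). intros n. destruct (Iter n) as [_ I2].
      apply Rle_trans with (2 := I2). unfold dist4, sum4.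
      pose proof (fun i => Rabs_pos (coord4 (u (Datatypes.S n)) i - coord4 (u n) i)) as Ps.
      pose proof (Ps 0%nat). pose proof (Ps 1%nat). pose proof (Ps 2%nat). pose proof (Ps 3%nat).
      destruct i as [ | [ | [ | [ | i]]]]; lia || lra. }
    (* [choice] asks for a limit at every index, and [coord4] returns the last coordinate from 3
       on. *)
    intros i. destruct (Nat.lt_ge_cases i 4) as [Hi | Hi]; [apply L, Hi | ].
    destruct (L 3%nat ltac:(lia)) as [l Hl]. exists l.
    destruct i as [ | [ | [ | [ | i]]]]; lia || exact Hl. }
  apply choice in Lim. destruct Lim as [l Hl].
  set (z := point4 l).
  assert (Lz : forall w : pt * pt, is_lim_seq (fun n => dist4 w (u n)) (dist4 w z)).
  { intros w. unfold dist4, sum4.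
    assert (Q : forall i, (i < 4)%nat ->
      is_lim_seq (fun n => Rabs (coord4 (u n) i - coord4 w i)) (Rabs (coord4 z i - coord4 w i))).
    { intros i Hi. apply (is_lim_seq_abs (fun n => coord4 (u n) i - coord4 w i) (coord4 z i - coord4 w i)).
      apply is_lim_seq_minus'; [ | apply is_lim_seq_const].
      unfold z. rewrite coord4_point4 by exact Hi. apply Hl. }
    repeat apply is_lim_seq_plus'; apply Q; lia. }
  assert (Dz : dist4 z0 z <= 2 * K).
  { apply (is_lim_seq_le (fun n => dist4 z0 (u n)) (fun _ => 2 * K) (dist4 z0 z) (2 * K)); 
      [ | apply Lz | apply is_lim_seq_const].
    intros n. destruct (Iter n) as [I1 _]. apply Rle_trans with (1 := I1).
    assert (0 < (/ 2) ^ n) by (apply pow_lt; lra).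
    assert (0 <= 2 * K * (/ 2) ^ n) by (apply Rmult_le_pos; lra). lra. }
  assert (Bz : box4 z0 s z) by (apply dist4_box4; unfold K in Dz; lra).
  assert (Uz : forall n, box4 z0 s (u n)).
  { intros n. apply dist4_box4. destruct (Iter n) as [I1 _]. apply Rle_lt_trans with (1 := I1).
    assert (0 < (/ 2) ^ n) by (apply pow_lt; lra).
    assert (0 <= 2 * K * (/ 2) ^ n) by (apply Rmult_le_pos; lra). unfold K in *. lra. }
  (* The contraction bound stands in for continuity of [N]: the image of [z] is close to
     [u (n + 1)], which tends to [z]. *)
  assert (Nz : N z = z).
  { symmetry. apply dist4_zero.
    apply (is_lim_seq_le (fun _ => dist4 (N z) z)
      (fun n => / 2 * dist4 z (u n) + dist4 z (u (Datatypes.S n))) (dist4 (N z) z) 0).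
    - intros n. apply Rle_trans with (1 := dist4_triangle _ (u (Datatypes.S n)) _).
      rewrite (dist4_sym (u (Datatypes.S n)) z). apply Rplus_le_compat_r.
      apply (Contr z (u n)); [exact Bz | apply Uz].
    - apply is_lim_seq_const.
    - replace (Finite 0) with (Finite (/ 2 * dist4 z z + dist4 z z))
        by (rewrite dist4_self; f_equal; ring).
      apply is_lim_seq_plus'.
      + apply (is_lim_seq_scal_l (fun n => dist4 z (u n)) (/ 2) (dist4 z z)). apply Lz.
      + apply (is_lim_seq_incr_1 (fun n => dist4 z (u n))). apply Lz. }
  exists z. split; [exact Dz | split; [apply Fix, Nz | ]].
  intros w Bw Hw. apply Fix in Hw. apply dist4_zero.
  pose proof (Contr z w Bz Bw) as E. rewrite Nz, Hw in E. lra.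
Qed.

(** * Critical points *)

Lemma box4_center c r : 0 < r -> box4 c r c.
Proof. intros Hr. apply dist4_box4. rewrite dist4_self. exact Hr. Qed.

Lemma box4_subset c r r' z : r <= r' -> box4 c r z -> box4 c r' z.
Proof. intros H [H1 H2]. split; eapply box_subset; eassumption. Qed.

Lemma box4_step c r i h w : box4 c r w -> box4 c r (shift i h w) -> Rabs h < 2 * r.
Proof.
  destruct w as [[x1 x2] [y1 y2]]. intros [[A1 A2] [A3 A4]] [[B1 B2] [B3 B4]].
  assert (K : forall x a, Rabs (x - a) < r -> Rabs (x + h - a) < r -> Rabs h < 2 * r).
  { intros x a H1 H2. replace h with ((x + h - a) - (x - a)) by ring.
    apply Rle_lt_trans with (1 := Rabs_triang _ _). rewrite Rabs_Ropp. lra. }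
  destruct i as [ | [ | [ | i]]]; simpl in *; eauto.
Qed.

Lemma smooth3_perturbed c rho r C eta (f g : pt * pt -> R) : 0 < rho ->
  smooth3 c rho r C f -> smooth3 c rho r eta (fun z => g z - f z) ->
  smooth3 c rho r (C + eta) g /\
  (forall i z, box4 c r z -> Rabs (part4 g i z - part4 f i z) <= eta) /\
  (forall i j z, box4 c (r - 2 * rho) z ->
     Rabs (part4 (part4 g j) i z - part4 (part4 f j) i z) <= eta).
Proof.
  intros Hrho F W. set (w := fun z => g z - f z) in *.
  assert (G : smooth3 c rho r (C + eta) g).
  { pose proof (smooth3_lin c rho r C eta f w 1 1 F W) as E. rewrite Rabs_R1 in E.
    replace g with (fun z => 1 * f z + 1 * w z)
      by (apply functional_extensionality; intros z; unfold w; ring).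
    revert E. apply smooth3_weaken; lra. }
  assert (E1 : forall i z, box4 c r z -> part4 w i z = part4 g i z - part4 f i z).
  { intros i z Hz. apply is_derive_unique. unfold w.
    apply (is_derive_minus (K := R_AbsRing) (V := R_NormedModule)
      (fun t => g (upd4 z i t)) (fun t => f (upd4 z i t))).
    - apply (smooth3_derive c rho r (C + eta)); assumption.
    - apply (smooth3_derive c rho r C); assumption. }
  split; [exact G | split].
  - intros i z Hz. rewrite <- E1 by exact Hz. apply (smooth3_part4_le c rho r eta); assumption.
  - intros i j z Hz.
    assert (E2 : part4 (part4 w j) i z = part4 (part4 g j) i z - part4 (part4 f j) i z).
    { apply is_derive_unique.
      (* The identity [E1] holds only inside the box, so the two functions agree near the point and
         not everywhere. *)
      apply (is_derive_ext_loc (fun t => part4 g j (upd4 z i t) - part4 f j (upd4 z i t))).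
      - exists (mkposreal rho Hrho). intros t Ht. symmetry. apply E1.
        assert (Ht' : Rabs (t - coord4 z i) < rho) by exact Ht.
        rewrite shift_coord. apply (shift_box4 c r rho); [ | lra].
        apply (box4_subset c (r - 2 * rho)); [lra | exact Hz].
      - apply (is_derive_minus (K := R_AbsRing) (V := R_NormedModule)
          (fun t => part4 g j (upd4 z i t)) (fun t => part4 f j (upd4 z i t))).
        + apply (smooth3_derive2 c rho r (C + eta)); assumption.
        + apply (smooth3_derive2 c rho r C); assumption. }
    rewrite <- E2. apply (smooth3_part4_part4_le c rho r eta); assumption.
Qed.

(** In the box of radius [rho / 2] every coordinate step of a path is shorter than [rho], where the
    difference bounds apply. *)
Lemma smooth3_part4_lipschitz c rho r C f j z : 0 < rho -> 3 * rho <= r ->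
  smooth3 c rho r C f -> box4 c (rho / 2) z ->
  Rabs (part4 f j z - part4 f j c) <= C * dist4 c z.
Proof.
  intros Hrho Hr F Hz.
  destruct (smooth3_part4_differences c rho r C f j Hrho F) as [D1 _].
  pose proof (path4 (part4 f j) (fun _ => 0) c (rho / 2) C) as Pt.
  replace (part4 f j z - part4 f j c)
    with (part4 f j z - part4 f j c - sum4 (fun i => (coord4 z i - coord4 c i) * 0))
    by (unfold sum4; ring).
  apply Pt; [ | apply box4_center; lra | exact Hz].
  intros i w h Hi H1 H2. rewrite Rmult_0_r, Rminus_0_r.
  apply (D1 i h); [pose proof (box4_step _ _ _ _ _ H1 H2); lra | ].
  apply (box4_subset c (rho / 2)); [lra | exact H1].
Qed.

Lemma smooth3_part4_part4_near c rho r C f i j z : 0 < rho -> 4 * rho <= r ->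
  smooth3 c rho r C f -> box4 c (rho / 2) z ->
  Rabs (part4 (part4 f j) i z - part4 (part4 f j) i c) <= C * dist4 c z.
Proof.
  intros Hrho Hr F Hz.
  pose proof (path4 (part4 (part4 f j) i) (fun _ => 0) c (rho / 2) C) as Pt.
  replace (part4 (part4 f j) i z - part4 (part4 f j) i c)
    with (part4 (part4 f j) i z - part4 (part4 f j) i c - sum4 (fun i => (coord4 z i - coord4 c i) * 0))
    by (unfold sum4; ring).
  apply Pt; [ | apply box4_center; lra | exact Hz].
  intros k w h Hk H1 H2. rewrite Rmult_0_r, Rminus_0_r.
  apply (smooth3_part4_part4_lipschitz c rho r); [exact Hrho | exact F | | ].
  - apply (box4_subset c (rho / 2)); [lra | exact H1].
  - pose proof (box4_step _ _ _ _ _ H1 H2). lra.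
Qed.

Lemma critical4_part4 U F z i : critical4 U F z -> (i < 4)%nat -> part4 F i z = 0.
Proof.
  intros [_ H] Hi. apply is_derive_unique, H.
  (* The index bound inside [critical4] is MathComp's boolean comparison, here it is the one of
     Stdlib; the four cases bridge them. *)
  destruct i as [ | [ | [ | [ | i]]]]; lia || reflexivity.
Qed.

Lemma critical4_intro (U : pt * pt -> Prop) F z c rho r C : 0 < rho ->
  smooth3 c rho r C F -> box4 c r z -> U z -> (forall i, (i < 4)%nat -> part4 F i z = 0) ->
  critical4 U F z.
Proof.
  intros Hrho HF Hz Uz H0. split; [exact Uz | ]. intros i Hi.
  rewrite <- (H0 i); [apply (smooth3_derive c rho r C); assumption | ].
  destruct i as [ | [ | [ | [ | i]]]]; lia || discriminate Hi.
Qed.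

Lemma KR_regular_KR H L1 L2 x y :
  1 * KR H L1 L2 x y + 2 * L1 * L2 * S y x = KR_regular L1 L2 H (x, y).
Proof. rewrite (S_sym y x). pose proof (KR_regular_eq H L1 L2 (x, y)) as E. simpl in E. rewrite E. ring. Qed.

(** Pairing the critical point equation in [x] with [x - y] makes the singular term constant. *)
Lemma KR_critical_pairing D H L1 L2 z : KRcrit D H L1 L2 z ->
  (fst (fst z) - fst (snd z)) * part4 (KR_regular L1 L2 H) 0 z +
  (snd (fst z) - snd (snd z)) * part4 (KR_regular L1 L2 H) 1 z = - (L1 * L2 / PI).
Proof.
  intros [(_ & _ & N) Hc].
  assert (N' : snd z <> fst z) by (intros E; apply N; symmetry; exact E).
  assert (E0 : part4 (KR_regular L1 L2 H) 0 z = 2 * L1 * L2 * S1 (snd z) (fst z)).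
  { apply is_derive_unique.
    replace (2 * L1 * L2 * S1 (snd z) (fst z)) with (1 * 0 + 2 * L1 * L2 * S1 (snd z) (fst z)) by ring.
    apply (is_derive_ext (fun t => 1 * KR H L1 L2 (t, snd (fst z)) (snd z)
      + 2 * L1 * L2 * S (snd z) (t, snd (fst z)))).
    - intros t. exact (KR_regular_KR H L1 L2 (t, snd (fst z)) (snd z)).
    - apply (is_derive_lin (fun t => KR H L1 L2 (t, snd (fst z)) (snd z))
        (fun t => S (snd z) (t, snd (fst z)))).
      + apply (Hc 0%nat). reflexivity.
      + apply S_derive_fst, N'. }
  assert (E1 : part4 (KR_regular L1 L2 H) 1 z = 2 * L1 * L2 * S2 (snd z) (fst z)).
  { apply is_derive_unique.
    replace (2 * L1 * L2 * S2 (snd z) (fst z)) with (1 * 0 + 2 * L1 * L2 * S2 (snd z) (fst z)) by ring.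
    apply (is_derive_ext (fun t => 1 * KR H L1 L2 (fst (fst z), t) (snd z)
      + 2 * L1 * L2 * S (snd z) (fst (fst z), t))).
    - intros t. exact (KR_regular_KR H L1 L2 (fst (fst z), t) (snd z)).
    - apply (is_derive_lin (fun t => KR H L1 L2 (fst (fst z), t) (snd z))
        (fun t => S (snd z) (fst (fst z), t))).
      + apply (Hc 1%nat). reflexivity.
      + apply S_derive_snd, N'. }
  rewrite E0, E1. apply sqr_dist_pos in N'. pose proof PI_RGT_0.
  unfold S1, S2. field. simpl in *. lra.
Qed.

(** For distinct x0 and y0 the singular term joins as a fixed smooth kernel and cancels from the
    difference of the two functions. *)
Lemma KR_convergence Om P L1 L2 HOm Heps x0 y0 :
  open2 Om -> bounded2 Om -> Om P -> green_regular_part Om HOm ->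
  (forall eps, 0 < eps -> (forall q, dist2 P q <= eps -> Om q) ->
     green_regular_part (punctured Om P eps) (Heps eps)) ->
  Om x0 -> x0 <> P -> Om y0 -> y0 <> P -> x0 <> y0 ->
  exists rho C eps1 eta, 0 < rho /\ 0 <= C /\ 0 < eps1 /\
    (forall e, 0 < e -> exists d, 0 < d /\ forall eps, 0 < eps < d -> 0 <= eta eps < e) /\
    smooth3 (x0, y0) rho (11 * rho) C (fun z => KR HOm L1 L2 (fst z) (snd z)) /\
    (forall eps, 0 < eps < eps1 -> smooth3 (x0, y0) rho (11 * rho) (eta eps)
       (fun z => KR (Heps eps) L1 L2 (fst z) (snd z) - KR HOm L1 L2 (fst z) (snd z))) /\
    (forall z, box4 (x0, y0) (11 * rho) z ->
       KRdom Om z /\ forall eps, eps < eps1 -> KRdom (punctured Om P eps) z).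
Proof.
  intros O Bd HP G Ge Hx Nx Hy Ny N.
  destruct (KR_regular_convergence Om P L1 L2 HOm Heps x0 y0 O Bd HP G Ge Hx Nx Hy Ny)
    as [r1 [Hr1 K1]].
  destruct (S_smooth3 x0 y0 N) as [r2 [Hr2 K2]].
  pose proof (Rmin_l r1 r2). pose proof (Rmin_r r1 r2).
  assert (0 < Rmin r1 r2) by (apply Rmin_glb_lt; assumption).
  set (rho := Rmin r1 r2 / 20).
  destruct (K1 rho ltac:(unfold rho; lra)) as (C & eps1 & eta & HC & He1 & Heta & F & W & B).
  destruct (K2 rho ltac:(unfold rho; lra)) as (C' & HC' & FS & BS).
  exists rho, (Rabs 1 * C + Rabs (- (2 * L1 * L2)) * C'), eps1, eta.
  split; [unfold rho; lra | split; [ | split; [exact He1 | split; [exact Heta | split; [ | split]]]]].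
  - pose proof (Rabs_pos 1). pose proof (Rabs_pos (- (2 * L1 * L2))). 
    apply Rplus_le_le_0_compat; apply Rmult_le_pos; assumption.
  - replace (fun z => KR HOm L1 L2 (fst z) (snd z))
      with (fun z : pt * pt => 1 * KR_regular L1 L2 HOm z + - (2 * L1 * L2) * S (fst z) (snd z))
      by (apply functional_extensionality; intros z; rewrite KR_regular_eq; ring).
    apply (smooth3_lin _ _ _ C C' (KR_regular L1 L2 HOm) (fun z => S (fst z) (snd z))); assumption.
  - intros eps Heps'.
    replace (fun z => KR (Heps eps) L1 L2 (fst z) (snd z) - KR HOm L1 L2 (fst z) (snd z))
      with (fun z : pt * pt => KR_regular L1 L2 (Heps eps) z - KR_regular L1 L2 HOm z)
      by (apply functional_extensionality; intros z; rewrite !KR_regular_eq; ring).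
    apply W, Heps'.
  - intros z Hz. destruct (B z Hz) as (B1 & B2 & B3 & B4). specialize (BS z Hz).
    split; [repeat split; assumption | ]. intros eps Heps'.
    repeat split; assumption || lra.
Qed.

Lemma is_lim_seq_eventually (u : nat -> R) (l e : R) : is_lim_seq u l -> 0 < e ->
  exists N, forall n, (N <= n)%nat -> Rabs (u n - l) < e.
Proof.
  intros H He. apply is_lim_seq_spec in H. simpl in H. destruct (H (mkposreal e He)) as [N HN].
  exists N. exact HN.
Qed.

Lemma convergent_subsequence_point (epsn : nat -> R) (zn : nat -> pt * pt) (z0 : pt * pt) d r :
  (forall n, 0 < epsn n) -> is_lim_seq epsn 0 ->
  is_lim_seq (fun n => fst (fst (zn n))) (fst (fst z0)) ->
  is_lim_seq (fun n => snd (fst (zn n))) (snd (fst z0)) ->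
  is_lim_seq (fun n => fst (snd (zn n))) (fst (snd z0)) ->
  is_lim_seq (fun n => snd (snd (zn n))) (snd (snd z0)) ->
  0 < d -> 0 < r -> exists n, 0 < epsn n < d /\ dist4 z0 (zn n) < r.
Proof.
  intros He L0 L1 L2 L3 L4 Hd Hr.
  destruct (is_lim_seq_eventually _ _ d L0 Hd) as [N0 H0].
  destruct (is_lim_seq_eventually _ _ (r / 4) L1 ltac:(lra)) as [N1 H1].
  destruct (is_lim_seq_eventually _ _ (r / 4) L2 ltac:(lra)) as [N2 H2].
  destruct (is_lim_seq_eventually _ _ (r / 4) L3 ltac:(lra)) as [N3 H3].
  destruct (is_lim_seq_eventually _ _ (r / 4) L4 ltac:(lra)) as [N4 H4].
  set (n := (N0 + N1 + N2 + N3 + N4)%nat). exists n.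
  specialize (H0 n ltac:(unfold n; lia)). specialize (H1 n ltac:(unfold n; lia)).
  specialize (H2 n ltac:(unfold n; lia)). specialize (H3 n ltac:(unfold n; lia)).
  specialize (H4 n ltac:(unfold n; lia)). specialize (He n).
  apply Rabs_def2 in H0. split; [lra | ]. unfold dist4, sum4; simpl. lra.
Qed.

Lemma KR_critical_limit (Om : pt -> Prop) (P : pt) (L1 L2 : R)
  (HOm : pt -> pt -> R) (Heps : R -> pt -> pt -> R)
  (epsn : nat -> R) (zn : nat -> pt * pt) (x0 y0 : pt) :
  open2 Om -> bounded2 Om -> Om P -> 0 < L1 -> 0 < L2 ->
  green_regular_part Om HOm ->
  (forall eps, 0 < eps -> (forall q, dist2 P q <= eps -> Om q) ->
     green_regular_part (punctured Om P eps) (Heps eps)) ->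
  (forall n, 0 < epsn n) -> is_lim_seq epsn 0 ->
  (forall n, KRcrit (punctured Om P (epsn n)) (Heps (epsn n)) L1 L2 (zn n)) ->
  is_lim_seq (fun n => fst (fst (zn n))) (fst x0) ->
  is_lim_seq (fun n => snd (fst (zn n))) (snd x0) ->
  is_lim_seq (fun n => fst (snd (zn n))) (fst y0) ->
  is_lim_seq (fun n => snd (snd (zn n))) (snd y0) ->
  Om x0 -> x0 <> P -> Om y0 -> y0 <> P ->
  x0 <> y0 /\ KRcrit Om HOm L1 L2 (x0, y0).
Proof.
  intros O Bd HP HL1 HL2 G Ge He L0 Hc Lx1 Lx2 Ly1 Ly2 Hx Nx Hy Ny.
  pose proof (convergent_subsequence_point epsn zn (x0, y0)) as Pick. simpl in Pick.
  assert (N : x0 <> y0).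
  (* If the limits coincided, the gradient of the regular part would stay below [C + 1] once the
     perturbation is below 1, and x - y would tend to 0; but their pairing has the fixed absolute
     value [L1 * L2 / PI]. *)
  { intros Exy.
    destruct (KR_regular_convergence Om P L1 L2 HOm Heps x0 y0 O Bd HP G Ge Hx Nx Hy Ny)
      as [r1 [Hr1 K1]].
    set (rho := r1 / 20).
    destruct (K1 rho ltac:(unfold rho; lra)) as (C & eps1 & eta & HC & He1 & Heta & F & W & B).
    destruct (Heta 1 Rlt_0_1) as [d1 [Hd1 Eta1]].
    pose proof PI_RGT_0.
    assert (Hk : 0 < L1 * L2 / PI) by (apply Rdiv_lt_0_compat; [apply Rmult_lt_0_compat | ]; lra).
    (* At distance below [k] the pairing is at most half of the value it must have. *)
    set (k := L1 * L2 / PI / (2 * (C + 1))).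
    assert (Hk' : 0 < k) by (apply Rdiv_lt_0_compat; lra).
    destruct (Pick (Rmin eps1 d1) (Rmin rho k)) as [n [En Dn]]; try assumption.
    { apply Rmin_glb_lt; assumption. }
    { apply Rmin_glb_lt; [unfold rho; lra | assumption]. }
    pose proof (Rmin_l eps1 d1). pose proof (Rmin_r eps1 d1).
    pose proof (Rmin_l rho k). pose proof (Rmin_r rho k).
    assert (Bz : box4 (x0, y0) (11 * rho) (zn n)).
    { apply dist4_box4. unfold rho in *. lra. }
    pose proof (KR_critical_pairing _ _ _ _ _ (Hc n)) as Pr.
    specialize (Eta1 (epsn n) ltac:(lra)).
    destruct (smooth3_perturbed _ rho _ _ _ _ _ ltac:(unfold rho; lra) F (W (epsn n) ltac:(lra))) as [_ [D1 _]].
    assert (Bound : forall i, Rabs (part4 (KR_regular L1 L2 (Heps (epsn n))) i (zn n)) <= C + 1).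
    { intros i. specialize (D1 i (zn n) Bz).
      pose proof (smooth3_part4_le _ rho _ _ _ i (zn n) ltac:(unfold rho; lra) F Bz) as D0.
      apply Rabs_le_between in D0. apply Rabs_le_between in D1. apply Rabs_le. lra. }
    assert (Close : Rabs (fst (fst (zn n)) - fst (snd (zn n))) + Rabs (snd (fst (zn n)) - snd (snd (zn n)))
      <= dist4 (x0, y0) (zn n)).
    { rewrite <- Exy. unfold dist4, sum4. simpl.
      pose proof (Rabs_triang (fst (fst (zn n)) - fst x0) (- (fst (snd (zn n)) - fst x0))) as T1.
      pose proof (Rabs_triang (snd (fst (zn n)) - snd x0) (- (snd (snd (zn n)) - snd x0))) as T2.
      rewrite Rabs_Ropp in T1, T2.
      replace (fst (fst (zn n)) - fst (snd (zn n)))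
        with (fst (fst (zn n)) - fst x0 + - (fst (snd (zn n)) - fst x0)) by ring.
      replace (snd (fst (zn n)) - snd (snd (zn n)))
        with (snd (fst (zn n)) - snd x0 + - (snd (snd (zn n)) - snd x0)) by ring.
      lra. }
    apply (f_equal Rabs) in Pr. rewrite Rabs_Ropp, (Rabs_pos_eq (L1 * L2 / PI)) in Pr by lra.
    pose proof (Rabs_triang
      ((fst (fst (zn n)) - fst (snd (zn n))) * part4 (KR_regular L1 L2 (Heps (epsn n))) 0 (zn n))
      ((snd (fst (zn n)) - snd (snd (zn n))) * part4 (KR_regular L1 L2 (Heps (epsn n))) 1 (zn n))) as T.
    rewrite Pr, !Rabs_mult in T.
    assert (U : L1 * L2 / PI <= dist4 (x0, y0) (zn n) * (C + 1)).
    { apply Rle_trans with (1 := T).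
      apply Rle_trans with ((Rabs (fst (fst (zn n)) - fst (snd (zn n)))
        + Rabs (snd (fst (zn n)) - snd (snd (zn n)))) * (C + 1)).
      - rewrite Rmult_plus_distr_r.
        apply Rplus_le_compat; apply Rmult_le_compat_l; auto using Rabs_pos.
      - apply Rmult_le_compat_r; lra. }
    assert (V : dist4 (x0, y0) (zn n) * (C + 1) <= k * (C + 1)) by (apply Rmult_le_compat_r; lra).
    replace (k * (C + 1)) with (L1 * L2 / PI / 2) in V by (unfold k; field; lra). lra. }
  split; [exact N | ].
  destruct (KR_convergence Om P L1 L2 HOm Heps x0 y0 O Bd HP G Ge Hx Nx Hy Ny N)
    as (rho & C & eps1 & eta & Hrho & HC & He1 & Heta & F & W & B).
  apply (critical4_intro _ _ _ (x0, y0) rho (11 * rho) C); [exact Hrho | exact F | | | ].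
  - apply box4_center. lra.
  - apply (B (x0, y0)). apply box4_center. lra.
  (* At [zn n] the perturbed derivative is 0, so the limiting one is at most [eta] there; the
     Lipschitz bound carries this to (x0, y0). Each of the two errors receives [e / 2]. *)
  - intros i Hi. apply Rabs_eq_0, Rle_antisym; [ | apply Rabs_pos].
    apply le_epsilon. intros e He0. rewrite Rplus_0_l.
    destruct (Heta (e / 2) ltac:(lra)) as [d1 [Hd1 Eta1]].
    set (k := e / (2 * (C + 1))).
    assert (Hk : 0 < k) by (apply Rdiv_lt_0_compat; lra).
    destruct (Pick (Rmin eps1 d1) (Rmin (rho / 2) k)) as [n [En Dn]]; try assumption.
    { apply Rmin_glb_lt; assumption. }
    { apply Rmin_glb_lt; [lra | assumption]. }
    pose proof (Rmin_l eps1 d1). pose proof (Rmin_r eps1 d1).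
    pose proof (Rmin_l (rho / 2) k). pose proof (Rmin_r (rho / 2) k).
    specialize (Eta1 (epsn n) ltac:(lra)).
    assert (Bz : box4 (x0, y0) (rho / 2) (zn n)) by (apply dist4_box4; lra).
    destruct (smooth3_perturbed _ rho _ _ _ _ _ Hrho F (W (epsn n) ltac:(lra))) as [_ [D1 _]].
    specialize (D1 i (zn n) (box4_subset _ (rho / 2) (11 * rho) _ ltac:(lra) Bz)).
    rewrite (critical4_part4 _ _ _ _ (Hc n) Hi) in D1.
    pose proof (smooth3_part4_lipschitz _ rho (11 * rho) C _ i (zn n) Hrho ltac:(lra) F Bz) as D2.
    assert (V : C * dist4 (x0, y0) (zn n) <= e / 2).
    { apply Rle_trans with ((C + 1) * k); [ | right; unfold k; field; lra].
      apply Rmult_le_compat; try lra. apply sum4_nonneg. intros j. apply Rabs_pos. }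
    apply Rabs_le_between in D1. apply Rabs_le_between in D2. apply Rabs_le. lra.
Qed.

(** The Hessian of [g] is within [eta] of that of [f], which varies by at most [C * (12 * s)] on the
    box of radius [3 * s], as 12 s = 4 (3 s) bounds the l^1 distance there. Integration along
    coordinate paths then linearizes the gradient with the Hessian frozen at [c]. *)
Lemma gradient_increment c rho r C C' eta (f g : pt * pt -> R) s e :
  0 < rho -> 11 * rho <= r -> 0 <= C -> 0 < s -> 3 * s <= rho / 2 ->
  smooth3 c rho r C f -> smooth3 c rho r C' g ->
  (forall i j z, box4 c (r - 2 * rho) z ->
     Rabs (part4 (part4 g j) i z - part4 (part4 f j) i z) <= eta) ->
  C * (12 * s) + eta <= e ->
  (forall i j z, box4 c s z -> Rabs (part4 (part4 g j) i z - part4 (part4 f j) i c) <= e) /\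
  (forall j z z', box4 c s z -> box4 c s z' ->
     Rabs (part4 g j z' - part4 g j z
       - sum4 (fun i => (coord4 z' i - coord4 z i) * part4 (part4 f j) i c)) <= e * dist4 z z').
Proof.
  intros Hrho Hr HC Hs Hs3 F G W He.
  (* Steps inside the box of radius [s] are shorter than [2 * s], and [increment_bound] asks for
     derivatives on both sides of the base point; hence the radius [3 * s]. *)
  assert (Near : forall i j z, box4 c (3 * s) z ->
    Rabs (part4 (part4 g j) i z - part4 (part4 f j) i c) <= e).
  { intros i j z Hz.
    pose proof (W i j z (box4_subset c (3 * s) (r - 2 * rho) z ltac:(lra) Hz)) as E1.
    pose proof (smooth3_part4_part4_near c rho r C f i j z Hrho ltac:(lra) F
      (box4_subset c (3 * s) (rho / 2) z ltac:(lra) Hz)) as E2.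
    pose proof (box4_dist4 c z _ Hz) as E3.
    assert (C * dist4 c z <= C * (12 * s)) by (apply Rmult_le_compat_l; lra).
    replace (part4 (part4 g j) i z - part4 (part4 f j) i c)
      with ((part4 (part4 g j) i z - part4 (part4 f j) i z)
        + (part4 (part4 f j) i z - part4 (part4 f j) i c)) by ring.
    apply Rle_trans with (1 := Rabs_triang _ _). lra. }
  split.
  - intros i j z Hz. apply Near. apply (box4_subset c s); [lra | exact Hz].
  - intros j. apply (path4 (part4 g j) (fun i => part4 (part4 f j) i c)).
    intros i w h Hi H1 H2. pose proof (box4_step _ _ _ _ _ H1 H2) as Hh.
    set (a := part4 (part4 f j) i c).
    (* Subtracting the linear function of slope [a] makes the derivative small before the mean value
       inequality is used. *)
    pose proof (increment_bound (fun t => 1 * part4 g j (upd4 w i t) + - a * t) (coord4 w i) h e) as I.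
    cbv beta in I. rewrite upd4_shift, upd4_coord4 in I.
    replace (part4 g j (shift i h w) - part4 g j w - h * a)
      with (1 * part4 g j (shift i h w) + - a * (coord4 w i + h)
        - (1 * part4 g j w + - a * coord4 w i)) by ring.
    apply I. intros t Ht.
    assert (Bt : box4 c (3 * s) (upd4 w i t)).
    { rewrite shift_coord. apply (shift_box4 c (3 * s) (2 * s)); [ | lra].
      replace (3 * s - 2 * s) with s by ring. exact H1. }
    exists (1 * part4 (part4 g j) i (upd4 w i t) + - a * 1). split.
    + apply (is_derive_lin (fun t => part4 g j (upd4 w i t)) (fun t => t)); [ | exact (is_derive_id (K := R_AbsRing) t)].
      pose proof (smooth3_derive2 c rho r C' g i j (upd4 w i t) Hrho G) as D.
      rewrite coord4_upd4 in D.
      apply (is_derive_ext (fun t' => part4 g j (upd4 (upd4 w i t) i t'))).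
      * intros t'. rewrite upd4_upd4. reflexivity.
      * apply D. apply (box4_subset c (3 * s)); [lra | exact Bt].
    + replace (1 * part4 (part4 g j) i (upd4 w i t) + - a * 1)
        with (part4 (part4 g j) i (upd4 w i t) - a) by ring.
      apply Near, Bt.
Qed.

Lemma sum44_nonneg b : 0 <= sum44 b.
Proof. apply sum4_nonneg. intros j. apply sum4_nonneg. intros k. apply Rabs_pos. Qed.

(** The modulus [mu] is the error bound of Newton's method. It both locates the zero inside the box
    and yields convergence, so the choice of [z] for different eps need not be related. *)
Lemma KR_critical_persistence (Om : pt -> Prop) (P : pt) (L1 L2 : R)
  (HOm : pt -> pt -> R) (Heps : R -> pt -> pt -> R) x0 y0 :
  open2 Om -> bounded2 Om -> Om P -> green_regular_part Om HOm ->
  (forall eps, 0 < eps -> (forall q, dist2 P q <= eps -> Om q) ->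
     green_regular_part (punctured Om P eps) (Heps eps)) ->
  Om x0 -> x0 <> P -> Om y0 -> y0 <> P -> x0 <> y0 ->
  KRnondeg Om HOm L1 L2 (x0, y0) ->
  exists s eps0 (mu : R -> R), 0 < s /\ 0 < eps0 /\
    (forall e, 0 < e -> exists d, 0 < d /\ forall eps, 0 < eps < d -> mu eps < e) /\
    forall eps, 0 < eps < eps0 -> exists z,
      dist4 (x0, y0) z <= mu eps /\ mu eps < s /\
      KRnondeg (punctured Om P eps) (Heps eps) L1 L2 z /\
      forall w, box4 (x0, y0) s w ->
        KRcrit (punctured Om P eps) (Heps eps) L1 L2 w -> w = z.
Proof.
  intros O Bd HP G Ge Hx Nx Hy Ny N Nd.
  destruct (KR_convergence Om P L1 L2 HOm Heps x0 y0 O Bd HP G Ge Hx Nx Hy Ny N)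
    as (rho & C & eps1 & eta & Hrho & HC & He1 & Heta & F & W & B).
  set (z0 := (x0, y0)) in *.
  destruct (Matrix4.nondegenerate_inverse _ _ _ Nd) as [b Hb].
  pose proof (sum44_nonneg b) as Sb.
  set (f := fun w : pt * pt => KR HOm L1 L2 (fst w) (snd w)) in *.
  (* The tolerance that gives contraction by 1/2; the summand 1 makes the quotient safe without a
     positive lower bound on [sum44 b]. *)
  set (e := / (2 * (sum44 b + 1))).
  assert (He : 0 < e) by (apply Rinv_0_lt_compat; lra).
  assert (Heb : e * sum44 b <= / 2).
  { apply Rle_trans with (e * (sum44 b + 1)); [apply Rmult_le_compat_l; lra | ].
    right. unfold e. field. lra. }
  (* The first bound gives [3 * s <= rho / 2]; the second makes the variation of the Hessian at most
     [e / 2]. *)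
  set (s := Rmin (rho / 6) (e / (24 * (C + 1)))).
  assert (Hs : 0 < s) by (apply Rmin_glb_lt; [lra | apply Rdiv_lt_0_compat; lra]).
  pose proof (Rmin_l (rho / 6) (e / (24 * (C + 1)))) as Hs1.
  pose proof (Rmin_r (rho / 6) (e / (24 * (C + 1)))) as Hs2. fold s in Hs1, Hs2.
  assert (HsC : C * (12 * s) <= e / 2).
  { apply Rle_trans with ((C + 1) * (12 * (e / (24 * (C + 1))))).
    - apply Rmult_le_compat; lra.
    - right. field. lra. }
  (* A perturbation below [m] takes the other half of [e] and keeps the total Newton displacement
     below [s]. *)
  set (m := Rmin (e / 2) (s / (2 * (sum44 b + 1)))).
  assert (Hm : 0 < m) by (apply Rmin_glb_lt; [lra | apply Rdiv_lt_0_compat; lra]).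
  pose proof (Rmin_l (e / 2) (s / (2 * (sum44 b + 1)))) as Hm1.
  pose proof (Rmin_r (e / 2) (s / (2 * (sum44 b + 1)))) as Hm2. fold m in Hm1, Hm2.
  destruct (Heta m Hm) as [d0 [Hd0 Eta0]].
  exists s, (Rmin eps1 d0), (fun eps => 2 * (eta eps * sum44 b)).
  split; [exact Hs | split; [apply Rmin_glb_lt; assumption | split]].
  - intros e' He'. destruct (Heta (e' / (2 * (sum44 b + 1)))) as [d [Hd K]].
    { apply Rdiv_lt_0_compat; lra. }
    exists d. split; [exact Hd | ]. intros eps Heps'. specialize (K eps Heps').
    apply Rle_lt_trans with (2 * (eta eps * (sum44 b + 1))).
    + apply Rmult_le_compat_l; [lra | ]. apply Rmult_le_compat_l; lra.
    + apply Rlt_le_trans with (2 * (e' / (2 * (sum44 b + 1)) * (sum44 b + 1))); [ | right; field; lra].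
      apply Rmult_lt_compat_l; [lra | ]. apply Rmult_lt_compat_r; lra.
  - intros eps Heps'. pose proof (Rmin_l eps1 d0). pose proof (Rmin_r eps1 d0).
    specialize (Eta0 eps ltac:(lra)). specialize (W eps ltac:(lra)).
    set (g := fun w : pt * pt => KR (Heps eps) L1 L2 (fst w) (snd w)).
    destruct (smooth3_perturbed z0 rho (11 * rho) C (eta eps) f g Hrho F W) as (Gs & D1 & D2).
    destruct (gradient_increment z0 rho (11 * rho) C _ (eta eps) f g s e Hrho ltac:(lra) HC Hs
      ltac:(lra) F Gs D2 ltac:(lra)) as [Hess Incr].
    assert (Smu : 2 * (eta eps * sum44 b) < s).
    { apply Rle_lt_trans with (2 * (eta eps * (sum44 b + 1))).
      - apply Rmult_le_compat_l; [lra | ]. apply Rmult_le_compat_l; lra.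
      - apply Rlt_le_trans with (2 * (s / (2 * (sum44 b + 1)) * (sum44 b + 1))); [ | right; field; lra].
        apply Rmult_lt_compat_l; [lra | ]. apply Rmult_lt_compat_r; lra. }
    destruct (newton4 (part4 g) (fun i j => part4 (part4 f j) i z0) b z0 s e (eta eps) Hb Heb)
      as [z [Z1 [Z2 Z3]]].
    + intros j z z' _. apply Incr.
    + intros j Hj. specialize (D1 j z0 (box4_center z0 (11 * rho) ltac:(lra))).
      assert (Z : part4 f j z0 = 0) by exact (critical4_part4 _ _ _ _ (proj1 Nd) Hj).
      rewrite Z, Rminus_0_r in D1. exact D1.
    + lra.
    + exact Smu.
    + assert (Bz : box4 z0 s z) by (apply dist4_box4; lra).
      assert (Bz' : box4 z0 (11 * rho) z) by (apply (box4_subset z0 s); [lra | exact Bz]).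
      exists z. split; [exact Z1 | split; [exact Smu | split]].
      * apply Matrix4.nondegenerate_intro.
        -- apply (critical4_intro _ _ _ z0 rho (11 * rho) (C + eta eps)); try assumption.
           apply B; [exact Bz' | lra].
        -- intros v Hv.
           (* The Hessian at [z] is within [e] of the invertible one at [z0], and [e * sum44 b] is
              at most 1/2. *)
           apply (inverse4_perturbed_kernel (fun i j => part4 (part4 f j) i z0) b
             (fun i j => part4 (part4 g j) i z) e v Hb); [lra | | exact Hv].
           intros i j _ _. apply Hess, Bz.
      * intros w Bw Hw. apply Z3; [exact Bw | ]. intros j Hj.
        exact (critical4_part4 _ _ _ _ Hw Hj).
Qed.

Theorem theorem1p4
  (Om : pt -> Prop) (P : pt) (L1 L2 : R)
  (HOm : pt -> pt -> R) (Heps : R -> pt -> pt -> R) :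
  smooth_domain Om -> Om P -> 0 < L1 -> 0 < L2 ->
  green_regular_part Om HOm ->
  (forall eps, 0 < eps -> (forall q, dist2 P q <= eps -> Om q) ->
     green_regular_part (punctured Om P eps) (Heps eps)) ->
  (* (a) *)
  (forall (epsn : nat -> R) (zn : nat -> pt * pt) (x0 y0 : pt),
     (forall n, 0 < epsn n) -> is_lim_seq epsn 0 ->
     (forall n, KRcrit (punctured Om P (epsn n)) (Heps (epsn n)) L1 L2 (zn n)) ->
     is_lim_seq (fun n => fst (fst (zn n))) (fst x0) ->
     is_lim_seq (fun n => snd (fst (zn n))) (snd x0) ->
     is_lim_seq (fun n => fst (snd (zn n))) (fst y0) ->
     is_lim_seq (fun n => snd (snd (zn n))) (snd y0) ->
     Om x0 -> x0 <> P -> Om y0 -> y0 <> P ->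
     x0 <> y0 /\ KRcrit Om HOm L1 L2 (x0, y0))
  /\
  (* (b) *)
  (forall x0 y0 : pt,
     Om x0 -> x0 <> P -> Om y0 -> y0 <> P -> x0 <> y0 ->
     KRnondeg Om HOm L1 L2 (x0, y0) ->
     exists d eps0 (z : R -> pt * pt), 0 < d /\ 0 < eps0 /\
       (forall eps, 0 < eps < eps0 ->
          dist2 (fst (z eps)) x0 < d /\ dist2 (snd (z eps)) y0 < d /\
          KRnondeg (punctured Om P eps) (Heps eps) L1 L2 (z eps) /\
          (forall w : pt * pt, dist2 (fst w) x0 < d -> dist2 (snd w) y0 < d ->
             KRcrit (punctured Om P eps) (Heps eps) L1 L2 w -> w = z eps)) /\
       (forall eta, 0 < eta -> exists delta, 0 < delta /\
          forall eps, 0 < eps < delta ->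
            dist2 (fst (z eps)) x0 < eta /\ dist2 (snd (z eps)) y0 < eta)).
Proof.
  intros (O & Bd & _) HP HL1 HL2 G Ge. split.
  - intros epsn zn x0 y0 H1 H2 H3 H4 H5 H6 H7 Hx Nx Hy Ny.
    exact (KR_critical_limit Om P L1 L2 HOm Heps epsn zn x0 y0 O Bd HP HL1 HL2 G Ge
      H1 H2 H3 H4 H5 H6 H7 Hx Nx Hy Ny).
  - intros x0 y0 Hx Nx Hy Ny N Nd.
    destruct (KR_critical_persistence Om P L1 L2 HOm Heps x0 y0 O Bd HP G Ge Hx Nx Hy Ny N Nd)
      as (s & eps0 & mu & Hs & He0 & Hmu & K).
    assert (C : forall eps, exists z, 0 < eps < eps0 ->
      dist4 (x0, y0) z <= mu eps /\ mu eps < s /\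
      KRnondeg (punctured Om P eps) (Heps eps) L1 L2 z /\
      forall w, box4 (x0, y0) s w ->
        KRcrit (punctured Om P eps) (Heps eps) L1 L2 w -> w = z).
    { intros eps. destruct (classic (0 < eps < eps0)) as [E | E].
      - destruct (K eps E) as [z Hz]. exists z. intros _. exact Hz.
      (* A dummy value outside the admissible range, since [choice] needs a point for every real
         eps. *)
      - exists (x0, y0). intros E'. contradiction. }
    apply choice in C. destruct C as [z Hz]. exists s, eps0, z.
    split; [exact Hs | split; [exact He0 | split]].
    + intros eps Heps'. destruct (Hz eps Heps') as (Z1 & Z2 & Z3 & Z4).
      destruct (dist4_dist2 (x0, y0) (z eps)) as [D1 D2]. simpl in D1, D2.
      split; [lra | split; [lra | split; [exact Z3 | ]]].
      (* Discs of radius [s] lie inside the squares of the same [s], so uniqueness on the squares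
         carries over with [d] equal to [s]. *)
      intros w W1 W2. apply Z4. split; apply dist2_box; assumption.
    + intros eta Heta. destruct (Hmu eta Heta) as [d [Hd Kd]].
      exists (Rmin d eps0). split; [apply Rmin_glb_lt; assumption | ]. intros eps Heps'.
      pose proof (Rmin_l d eps0). pose proof (Rmin_r d eps0).
      destruct (Hz eps ltac:(lra)) as (Z1 & _). specialize (Kd eps ltac:(lra)).
      destruct (dist4_dist2 (x0, y0) (z eps)) as [D1 D2]. simpl in D1, D2. lra.
Qed.
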